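(* Let $A:=\log(4/3)/(2\zeta(2))$ and let $\mathcal{G}(\lambda)=\lim_{Q\to\infty}\mathcal{G}_Q(\lambda)$ be the limiting gap distribution of the sets $\mathscr{S}_Q$ of $\operatorname{SL}(2,\mathbb{N})$-saturated Farey fractions. For every $\lambda\in(A,2A]$, $$\mathcal{G}(\lambda)=\frac{C_1(\lambda/A)}{A},$$ where, for $\eta\in[1,2]$ and $w_0(\eta):=\frac{1+\sqrt{1+8/\eta}}{4}$, $$C_1(\eta)=\frac{1}{2\zeta(2)}\int_{1/\sqrt{\eta}}^{w_0(\eta)}\left(w-\frac1{\eta w}\right)\left(2-3w+\frac{1}{\eta w}\right)\frac{dw}{w}+\frac1{2\zeta(2)}\int_{w_0(\eta)}^1\frac{(1-w)^2}{w}\,dw.$$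
   Context: $Q$ denotes a positive integer. Let $\mathcal{S}$ be the set of matrices $\begin{pmatrix} a&b\\ c&d\end{pmatrix}\in\operatorname{SL}(2,\mathbb{Z})$ with $a\ge b\ge d\ge 1$ and $a\ge c\ge d$, and let $\mathcal{S}_Q=\{M\in\mathcal{S}:\operatorname{Tr}M\le Q\}$. The set of $\operatorname{SL}(2,\mathbb{N})$-saturated Farey fractions of order $Q$ is $\mathscr{S}_Q:=\left\{d/b:\begin{pmatrix} a&b\\ c&d\end{pmatrix}\in\mathcal{S}_Q\right\}\subset\mathbb{Q}\cap(0,1]$ (without multiplicity), and $N(Q):=\#\mathscr{S}_Q$. For $\lambda\ge0$, $$\mathcal{G}_Q(\lambda):=\frac{\#\{\gamma_1<\gamma_2\ \text{consecutive in }\mathscr{S}_Q:\ \gamma_2-\gamma_1\le\lambda/N(Q)\}}{N(Q)}.$$ $\zeta$ is the Riemann zeta function. The claim includes that the limit exists for these $\lambda$. *)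

(* Defs.v *)
From mathcomp Require Export all_boot all_order all_algebra.
From mathcomp Require Export finmap.
From mathcomp Require Export all_classical all_reals all_analysis.

Set Implicit Arguments.
Unset Strict Implicit.
Unset Printing Implicit Defensive.

Import Order.TTheory GRing.Theory Num.Theory.
Import numFieldNormedType.Exports.

Local Open Scope classical_set_scope.
Local Open Scope ring_scope.

(* The matrix (a b; c d) is M with a = M 0 0, b = M 0 1, c = M 1 0, d = M 1 1. *)
Definition satMx : set 'M[int]_2 :=
  [set M | \det M = 1
           /\ [/\ M 0 1 <= M 0 0, M 1 1 <= M 0 1, 1 <= M 1 1,
                  M 1 0 <= M 0 0 & M 1 1 <= M 1 0]].

Definition satMxQ (Q : nat) : set 'M[int]_2 :=
  [set M | satMx M /\ \tr M <= Q%:Z].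

Definition satFarey (Q : nat) : set rat :=
  [set (M 1 1)%:~R / (M 0 1)%:~R | M in satMxQ Q].

(* [fset_set] sends infinite sets to the empty one; the two finiteness lemmas
   below show that this junk value is never used for the sets counted here. *)
Definition satCard (Q : nat) : nat := #|` fset_set (satFarey Q) |%fset.

Definition consecutive (A : set rat) : set (rat * rat) :=
  [set g | [/\ A g.1, A g.2, g.1 < g.2
             & forall x, A x -> ~ (g.1 < x /\ x < g.2)]].

Definition smallGaps (R : realType) (Q : nat) (lambda : R) : set (rat * rat) :=
  [set g | consecutive (satFarey Q) g
           /\ ratr (g.2 - g.1) <= lambda / (satCard Q)%:R].

Definition gapDistr (R : realType) (Q : nat) (lambda : R) : R :=
  #|` fset_set (smallGaps Q lambda) |%fset%:R / (satCard Q)%:R.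

(* Meaningful for s > 1 only. *)
Definition zeta (R : realType) (s : R) : R := limn (series (riemannR s)).

Definition gapA (R : realType) : R := ln (4 / 3) / (2 * zeta 2).

Definition w0 (R : realType) (eta : R) : R :=
  (1 + Num.sqrt (1 + 8 / eta)) / 4.

(* For 1 <= eta <= 2 one has 0 < 1 / sqrt eta <= w0 eta <= 1, so the integrals
   over these closed intervals are the oriented ones. *)
Definition C1 (R : realType) (eta : R) : R :=
  1 / (2 * zeta 2) *
    (\int[lebesgue_measure]_(w in `[1 / Num.sqrt eta, w0 eta])
       ((w - 1 / (eta * w)) * (2 - 3 * w + 1 / (eta * w)) / w))
  + 1 / (2 * zeta 2) *
    (\int[lebesgue_measure]_(w in `[w0 eta, 1]) ((1 - w) ^+ 2 / w)).

Lemma finite_satFarey (Q : nat) : finite_set (satFarey Q).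
Proof.
apply: finite_image.
apply: (@sub_finite_set _ _
  ((fun B : 'M['I_Q.+1]_2 => \matrix_(i, j) (val (B i j))%:Z) @` setT)); last first.
  exact: finite_image finite_finset.
move=> M [[_ [ab bd d1 ac cd]] trM].
have aQ : M 0 0 <= Q%:Z.
  apply: le_trans trM; rewrite /mxtrace !big_ord_recl big_ord0 addr0.
  have -> : lift ord0 ord0 = 1 :> 'I_2 by apply/val_inj.
  by rewrite lerDl (le_trans _ d1).
have MQ i j : 0 <= M i j <= Q%:Z.
  have d0 : 0 <= M 1 1 by apply: le_trans d1.
  have I2 (k : 'I_2) : k = 0 \/ k = 1.
    by case: k => [[|[|//]] ?]; [left|right]; apply/val_inj.
  apply/andP; case: (I2 i) => ->; case: (I2 j) => ->; split => //.
  - exact: le_trans d0 (le_trans bd ab).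
  - exact: le_trans d0 bd.
  - exact: le_trans ab aQ.
  - exact: le_trans d0 cd.
  - exact: le_trans ac aQ.
  - exact: le_trans bd (le_trans ab aQ).
exists (\matrix_(i, j) inord `|M i j|%N) => //.
apply/matrixP => i j; rewrite !mxE /=.
have /andP[M0 leM] := MQ i j.
rewrite inordK ?gez0_abs// ltnS.
by rewrite -lez_nat gez0_abs.
Qed.

Lemma finite_smallGaps (R : realType) (Q : nat) (lambda : R) :
  finite_set (smallGaps Q lambda).
Proof.
apply: (sub_finite_set _ (finite_setX (finite_satFarey Q) (finite_satFarey Q))).
by move=> g [[]].
Qed.

(* Main.v *)
(* For coprime d <= b let y in [1, b] be the inverse of d modulo b. The matrices
   of S with second column (b, d) have trace at least b + y + d, and this value
   is attained, so d/b lies in S_Q iff b + y + d <= Q. If consecutive d/b < d'/b'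
   have determinant 1 and b b' > Q^2/4, then necessarily b' = b - y, and
   conversely b - y is the denominator of a neighbour of determinant 1. The gap
   being 1/(b b'), the short gaps are the triples (b, y, d) with
   b (b - y) >= N(Q)/lambda; gaps of determinant at least 2 force b ~ Q, since
   lambda <= 2A, and are negligible. Hence N(Q) and the number of short gaps both
   count points of the modular hyperbolas y d = 1 (mod b), b <= Q, in regions
   that are down-closed in (y, d).

   These points are equidistributed for almost all b. This follows from
   Kloosterman's elementary fourth moment bound |S(k,h;b)|^4 <= 2 g b^3 tau(b)^3,
   g = gcd(k,h,b): smoothing by the indicator of an interval convolved with
   itself makes the Fourier coefficients squares, so their sum is controlled by
   Parseval, and a down-closed region is sandwiched by its shifts. Moduli with
   many divisors are rare because sum tau(b) = O(Q log Q). What remains is a sum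
   of phi(b) times a continuous density, evaluated by Abel summation from
   sum_{b <= n} phi(b) ~ n^2/(2 zeta(2)). *)

Require Import Defs.
From mathcomp Require Import all_field all_fingroup.
From mathcomp Require Import ring lra zify.
Set Implicit Arguments.
Unset Strict Implicit.
Unset Printing Implicit Defensive.
Import Order.TTheory GRing.Theory Num.Theory.
Import numFieldNormedType.Exports.
Local Open Scope classical_set_scope.
Local Open Scope ring_scope.

(** * The fourth moment of Kloosterman sums *)

Section Annihilators.
Variable A : finComUnitRingType.
Implicit Types a b u y : A.

(** Since b is composite, the equations y1 + y2 = y3 + y4 and 1/y1 + 1/y2 = 1/y3 + 1/y4 have more
    than the obvious solutions. Counting them through sizes of annihilators works in any finite
    commutative ring and needs no factorisation of b; the price is divisor functions. Shifting a
    down-closed region gives only an upper bound for its point count; the lower bound is the upper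
    bound for the complement reflected by p -> -p, a map that preserves the hyperbola. With an
    accuracy parameter K the window has length M ~ x/K and the saving asked of Kloosterman sums is c
    = K^3: both errors become O(x/K), under the condition 2 K^15 tau(x)^4 <= x. The threshold
    N(Q)/lambda is itself known only asymptotically, so short gaps are counted uniformly for
    thresholds t with t/Q^2 close to k = A/lambda. Moduli b <= Q/3 are treated apart: there every
    unit satisfies the trace condition, and none gives a short gap. *)

Definition ann a : nat := #|[pred r : A | r * a == 0]|.

Lemma card_coset_ann a b : (#|[pred y : A | (y * a == b)%R]| <= ann a)%N.
Proof.
case: (pickP [pred y : A | y * a == b]) => [y0 /= /eqP y0b|none]; last by rewrite (eq_card0 none).
rewrite /ann -[leqRHS](fintype.card_image (@addrI _ y0)).
apply/subset_leq_card/fintype.subsetP => y; rewrite inE => /eqP yb.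
apply/fintype.imageP; exists (y - y0); last by rewrite /= addrC subrK.
by rewrite inE mulrBl yb y0b subrr.
Qed.

(** Multiplication by a maps the annihilator of a b into that of b, and its fibres lie in cosets of
    the annihilator of a. *)
Lemma ann_mul a b : (ann (a * b)%R <= ann a * ann b)%N.
Proof.
rewrite /ann -!sum1_card.
rewrite (partition_big (fun r => r * a) (fun s => s * b == 0)) /=; last first.
  by move=> r; rewrite !inE mulrA.
rewrite mulnC; rewrite big_distrl /=; apply: leq_sum => s _.
rewrite mul1n !sum1_card; apply: leq_trans (card_coset_ann a s).
by apply/subset_leq_card/fintype.subsetP => y; rewrite !inE => /andP[].
Qed.

(** Additive energy of the curve {(y, 1/y)} in A x A: what Parseval produces from the fourth
    moment. *)
Definition energy : nat :=
  (\sum_(p : A * A | (p.1 \is a GRing.unit) && (p.2 \is a GRing.unit))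
   \sum_(q : A * A | (q.1 \is a GRing.unit) && (q.2 \is a GRing.unit))
     ((p.1 + p.2 == q.1 + q.2)%R && (p.1^-1 + p.2^-1 == q.1^-1 + q.2^-1)%R))%N.

(** With s the common sum, clearing denominators gives s y1 y2 = s y3 y4, so s kills (X - y1)(X -
    y2) at X = y3. In a field this leaves three obvious families; with zero divisors the product
    itself is kept. *)
Lemma energy_factor (y1 y2 y3 y4 : A) :
  y1 \is a GRing.unit -> y2 \is a GRing.unit ->
  y3 \is a GRing.unit -> y4 \is a GRing.unit ->
  y1 + y2 = y3 + y4 -> y1^-1 + y2^-1 = y3^-1 + y4^-1 ->
  (y1 + y2) * (y3 - y1) * (y2 - y3) = 0.
Proof.
move=> u1 u2 u3 u4 e1 e2.
have inv_sum a b : a \is a GRing.unit -> b \is a GRing.unit ->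
    (a^-1 + b^-1) * (a * b) = a + b.
  move=> ua ub; rewrite mulrDl mulrA mulVr // mul1r mulrCA mulVr // mulr1.
  by rewrite addrC.
have e3 : (y1 + y2) * (y3 * y4) = (y1 + y2) * (y1 * y2).
  by rewrite -[in LHS](inv_sum _ _ u1 u2) e2 [RHS]mulrC e1 -(inv_sum _ _ u3 u4); ring.
have -> : (y1 + y2) * (y3 - y1) * (y2 - y3) =
   (y1 + y2) * (y3 * (y1 + y2 - y3)) - (y1 + y2) * (y1 * y2) by ring.
have -> : y1 + y2 - y3 = y4 by rewrite e1 addrC addKr.
by rewrite e3 subrr.
Qed.

(** The fourth unknown is determined by the sum. With u = y3 - y1 and w = y2 - y3 the factored
    equation is linear in y1 with coefficient 2 u w, so each pair (u, w) leaves at most as many y1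
    as the annihilator of 2 u w has elements. *)
Lemma energy_le : (energy <= ann 2%:R * (\sum_(u : A) ann u) ^ 2)%N.
Proof.
pose Z (y1 y2 y3 : A) := (y1 + y2) * (y3 - y1) * (y2 - y3) == 0.
have -> : ((\sum_(u : A) ann u) ^ 2 = \sum_(u : A) \sum_(w : A) ann u * ann w)%N.
  rewrite expnS expn1 big_distrl /=; apply: eq_bigr => u _.
  by rewrite big_distrr.
apply: (@leq_trans (\sum_(y1 : A) \sum_(y2 : A) \sum_(y3 : A) Z y1 y2 y3)%N).
  rewrite pair_big /= /energy big_mkcond /=; apply: leq_sum => -[y1 y2] _ /=.
  case: ifP => // /andP[u1 u2].
  have -> : (\sum_(y3 : A) Z y1 y2 y3 =
     \sum_(y3 : A) \sum_(y4 : A) (Z y1 y2 y3 && (y4 == y1 + y2 - y3)%R))%N.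
    apply: eq_bigr => y3 _; rewrite (bigD1 (y1 + y2 - y3)) //= eqxx andbT.
    by rewrite big1 ?addn0 // => y4 /negPf ->; rewrite andbF.
  rewrite pair_big /= big_mkcond /=; apply: leq_sum => -[y3 y4] _ /=.
  case: ifP => // /andP[u3 u4].
  case: eqP => //= e1; case: eqP => //= e2.
  rewrite lt0b /Z (energy_factor u1 u2 u3 u4 e1 e2) eqxx /=.
  by rewrite e1 addrC addKr.
apply: (@leq_trans (\sum_(u : A) \sum_(w : A) ann (2%:R * (u * w))%R)%N); last first.
  rewrite big_distrr /=; apply: leq_sum => u _; rewrite big_distrr /=.
  apply: leq_sum => w _; apply: leq_trans (ann_mul _ _) _.
  by rewrite leq_mul2l ann_mul orbT.
have -> : (\sum_(y1 : A) \sum_(y2 : A) \sum_(y3 : A) Z y1 y2 y3 =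
   \sum_(y1 : A) \sum_(u : A) \sum_(w : A) Z y1 (y1 + u + w)%R (y1 + u)%R)%N.
  apply: eq_bigr => y1 _; rewrite exchange_big /=.
  rewrite (reindex_inj (addrI y1)) /=; apply: eq_bigr => u _.
  by rewrite (reindex_inj (addrI (y1 + u))).
rewrite exchange_big /=; apply: leq_sum => u _.
rewrite exchange_big /=; apply: leq_sum => w _.
apply: leq_trans (card_coset_ann _ (- ((u + w) * u * w))).
rewrite -sum1_card [leqRHS]big_mkcond /=; apply: leq_sum => y _.
rewrite inE /Z; case: eqP => //= e.
have -> // : y * (2%:R * (u * w)) == - ((u + w) * u * w).
rewrite -addr_eq0 -e; apply/eqP; ring.
Qed.

End Annihilators.

(** * Kloosterman sums for a primitive additive character *)

Section Characters.
Variables (A : finComUnitRingType) (w : A -> algC).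
Hypothesis wD : forall a b, w (a + b) = w a * w b.
Hypothesis w_conj : forall a, (w a)^* = w (- a).
Hypothesis w_norm : forall a, `|w a| = 1.
Hypothesis w_sum : forall b, \sum_a w (a * b) = (#|A| * (b == 0))%:R.

Lemma char_zero : w 0 = 1.
Proof.
apply: (@mulfI _ (w 0)); first by rewrite -normr_eq0 w_norm oner_eq0.
by rewrite -wD addr0 mulr1.
Qed.

Lemma sum_char2 (a b : A) :
  \sum_k \sum_h w (k * a + h * b) = (#|A| ^ 2 * ((a == 0) && (b == 0)))%:R.
Proof.
under eq_bigr do under eq_bigr do rewrite wD.
under eq_bigr do rewrite -mulr_sumr w_sum.
rewrite -mulr_suml w_sum -natrM; congr _%:R.
by case: (a == 0); case: (b == 0); rewrite /= ?muln1 ?muln0 ?mul0n // expnS expn1.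
Qed.

(** Parseval for the image of counting measure on [P] under i -> (f i, g i): after expanding the
    square, orthogonality keeps the pairs with equal images. *)
Lemma parseval2 (I : finType) (P : pred I) (f g : I -> A) :
  \sum_k \sum_h `|\sum_(i | P i) w (k * f i + h * g i)| ^+ 2 =
  (#|A| ^ 2 * \sum_(i | P i) \sum_(j | P j) ((f i == f j) && (g i == g j)))%:R.
Proof.
have expand k h : `|\sum_(i | P i) w (k * f i + h * g i)| ^+ 2 =
    \sum_(i | P i) \sum_(j | P j) w (k * (f i - f j) + h * (g i - g j)).
  rewrite normCK rmorph_sum mulr_suml; apply: eq_bigr => i _.
  rewrite mulr_sumr; apply: eq_bigr => j _.
  by rewrite /= w_conj -wD; congr w; ring.
rewrite (eq_bigr _ (fun k _ => eq_bigr _ (fun h _ => expand k h))).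
under eq_bigr do rewrite exchange_big /=.
rewrite exchange_big /= big_distrr natr_sum /=; apply: eq_bigr => i _.
under eq_bigr do rewrite exchange_big /=.
rewrite exchange_big /= big_distrr natr_sum /=; apply: eq_bigr => j _.
by rewrite sum_char2 !subr_eq0.
Qed.

Definition kloosterman (k h : A) : algC :=
  \sum_(y | y \is a GRing.unit) w (k * y + h * y^-1).

(** Squaring gives an exponential sum over pairs of units, so the fourth moment becomes a second
    moment, accessible to [parseval2]. *)
Lemma kloosterman_sq k h : kloosterman k h ^+ 2 =
  \sum_(p : A * A | (p.1 \is a GRing.unit) && (p.2 \is a GRing.unit))
    w (k * (p.1 + p.2) + h * (p.1^-1 + p.2^-1)).
Proof.
rewrite expr2 {1}/kloosterman mulr_suml.
under eq_bigr do rewrite mulr_sumr.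
rewrite pair_big /=; apply: eq_bigr => -[y z] _ /=.
by rewrite -wD; congr w; ring.
Qed.

Lemma kloosterman_moment4 :
  \sum_k \sum_h `|kloosterman k h| ^+ 4 = (#|A| ^ 2 * energy A)%:R.
Proof.
rewrite -(parseval2 _ (fun p : A * A => p.1 + p.2) (fun p => p.1^-1 + p.2^-1)).
apply: eq_bigr => k _; apply: eq_bigr => h _.
by rewrite -kloosterman_sq normrX -exprM.
Qed.

Lemma kloosterman_unit t k h : t \is a GRing.unit ->
  kloosterman (t * k) (t^-1 * h) = kloosterman k h.
Proof.
move=> ut; rewrite /kloosterman [RHS](reindex_inj (mulrI ut)) /=.
apply: eq_big => [y|y uy]; first by rewrite unitrMr.
rewrite invrM //; move: y^-1 t^-1 => y' t'; congr w; ring.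
Qed.

Definition ann2 (k h : A) : nat := #|[pred r : A | (r * k == 0)%R && (r * h == 0)%R]|.

Definition card_units : nat := #|[pred y : A | y \is a GRing.unit]|.

(* [S (k, h) = S (t k, h / t)] for every unit [t], so the fourth power of a
   single sum is repeated about [card_units / ann2 k h] times in the moment. *)
Lemma kloosterman_bound k h :
  card_units%:R * `|kloosterman k h| ^+ 4 <= (ann2 k h * (#|A| ^ 2 * energy A))%:R.
Proof.
have -> : card_units%:R * `|kloosterman k h| ^+ 4 =
    \sum_(t | t \is a GRing.unit) `|kloosterman (t * k) (t^-1 * h)| ^+ 4.
  rewrite (eq_bigr (fun=> `|kloosterman k h| ^+ 4)); last first.
    by move=> t ut; rewrite kloosterman_unit.
  by rewrite sumr_const mulr_natl.
rewrite natrM -kloosterman_moment4.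
rewrite (partition_big (fun t => (t * k, t^-1 * h)) predT) //=.
rewrite pair_big /= mulr_sumr; apply: ler_sum => -[k' h'] _ /=.
rewrite (eq_bigr (fun=> `|kloosterman k' h'| ^+ 4)); last first.
  by move=> t /andP[_ /eqP[-> ->]].
rewrite sumr_const -[leLHS]mulr_natl ler_wpM2r ?exprn_ge0 //.
rewrite ler_nat.
pose T := [pred t : A | (t \is a GRing.unit) && ((t * k, t^-1 * h) == (k', h'))].
suff: (#|T| <= ann2 k h)%N by [].
case: (pickP T) => [t0 /= /andP[ut0 /eqP[kt0 ht0]]|none]; last by rewrite (eq_card0 none).
rewrite /ann2 -[leqRHS](fintype.card_image (@addrI _ t0)).
apply/subset_leq_card/fintype.subsetP => t /andP[ut /eqP[kt ht]].
apply/fintype.imageP; exists (t - t0); last by rewrite /= addrC subrK.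
have hE u : u \is a GRing.unit -> u^-1 * h = h' -> h = u * h'.
  by move=> uu <-; rewrite mulrA divrr // mul1r.
(* As t h' = h = t0 h', the difference t - t0 kills h', hence also h = t h'. *)
rewrite inE mulrBl kt kt0 subrr eqxx /= [in X in _ * X](hE _ ut ht) mulrCA.
by rewrite mulrBl -(hE _ ut ht) -(hE _ ut0 ht0) subrr mulr0.
Qed.

Lemma mulr_sum_pair (I J : finType) (P : pred I) (Q : pred J) (f : I -> algC) (g : J -> algC) :
  (\sum_(i | P i) f i) * (\sum_(j | Q j) g j) =
  \sum_(p | P p.1 && Q p.2) f p.1 * g p.2.
Proof.
rewrite mulr_suml; under eq_bigr do rewrite mulr_sumr.
by rewrite pair_big.
Qed.

(** * Smoothed counts and their Fourier expansion *)

Variable M : nat.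

Definition window_shift (s : 'I_M * 'I_M) : A := (s.1 + s.2)%:R.

Definition expsum k : algC := \sum_(l < M) w (- (k * l%:R)).

Lemma expsum_sq k : expsum k ^+ 2 = \sum_s w (- (k * window_shift s)).
Proof.
rewrite expr2 {1}/expsum mulr_suml.
under eq_bigr do rewrite mulr_sumr.
rewrite pair_big /=; apply: eq_bigr => -[l m] _ /=.
by rewrite -wD /window_shift natrD; congr w; ring.
Qed.

(* The number of points of [D] on the modular hyperbola, averaged over the
   shifts of both coordinates by [l + l'] with [l, l' < M] (and multiplied
   by [M ^ 4]). *)
Definition smooth_count (D : pred (A * A)) : nat :=
  (\sum_(y : A | y \is a GRing.unit) \sum_(s : 'I_M * 'I_M)
   \sum_(s' : 'I_M * 'I_M) D (y - window_shift s, y^-1 - window_shift s')%R)%N.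

(** Orthogonality in both coordinates detects that the shifted point (y, 1/y) equals a point c of
    [D]. The four sums on the right are merged into one over (y, s, s', c), whose phase is linear in
    (k, h). *)
Lemma smooth_count_fourier (D : pred (A * A)) :
  (#|A| ^ 2 * smooth_count D)%:R =
  \sum_k \sum_h kloosterman k h * expsum k ^+ 2 * expsum h ^+ 2
     * \sum_(c | D c) w (- (k * c.1 + h * c.2)).
Proof.
pose F (i : A * (('I_M * 'I_M) * (('I_M * 'I_M) * (A * A)))) : A * A :=
  let: (y, (s, (s', c))) := i in (y - window_shift s - c.1, y^-1 - window_shift s' - c.2).
pose P (i : A * (('I_M * 'I_M) * (('I_M * 'I_M) * (A * A)))) :=
  let: (y, (s, (s', c))) := i in (y \is a GRing.unit) && D c.
have rhs k h : kloosterman k h * expsum k ^+ 2 * expsum h ^+ 2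
     * (\sum_(c | D c) w (- (k * c.1 + h * c.2))) =
     \sum_(i | P i) w (k * (F i).1 + h * (F i).2).
  rewrite !expsum_sq /kloosterman -!mulrA !mulr_sum_pair.
  apply: eq_big => [[y [s [s' c]]]|[y [s [s' c]]] _] //=.
  by rewrite -!wD; congr w; ring.
rewrite (eq_bigr _ (fun k _ => eq_bigr _ (fun h _ => rhs k h))).
under eq_bigr do rewrite exchange_big /=.
rewrite exchange_big /=.
under eq_bigr do rewrite sum_char2.
rewrite -natr_sum -big_distrr /=; congr (_ * _)%:R.
rewrite /smooth_count.
have ind p : (D p = \sum_(c | D c) (p == c) :> nat)%N.
  case Dp: (D p).
    rewrite (bigD1 p) //= eqxx big1 // => c /andP[_ /negPf].
    by rewrite eq_sym => ->.
  by rewrite big1 // => c Dc; case: eqP => // pc; rewrite pc Dc in Dp.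
rewrite (eq_bigr _ (fun y _ => eq_bigr _ (fun s _ => eq_bigr _ (fun s1 _ => ind _)))).
under eq_bigr do under eq_bigr do rewrite pair_big /=.
under eq_bigr do rewrite pair_big /=.
rewrite pair_big /=; apply: eq_big => [[y [s [s' c]]]|[y [s [s' [c1 c2]]]] _] //=.
by rewrite !subr_eq0.
Qed.

Definition smooth_error : algC :=
  \sum_(p : A * A | p != (0, 0)) `|kloosterman p.1 p.2| * `|expsum p.1| ^+ 2 * `|expsum p.2| ^+ 2.

(** The frequency (0, 0) is the main term. On the others the transform of [D] is bounded by its
    number of points, so its shape does not enter: all decay comes from the window and the
    Kloosterman sums. *)
Lemma smooth_count_le (D : pred (A * A)) :
  `|(#|A| ^ 2 * smooth_count D)%:R - (M ^ 4 * #|D| * card_units)%:R| <=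
  #|D|%:R * smooth_error.
Proof.
rewrite smooth_count_fourier pair_big /= (bigD1 (0, 0)) //=.
have -> : kloosterman 0 0 = card_units%:R.
  rewrite /kloosterman (eq_bigr (fun=> 1)) ?sumr_const // => y _.
  by rewrite !mul0r addr0 char_zero.
have -> : expsum 0 = M%:R.
  rewrite /expsum (eq_bigr (fun=> 1)) ?sumr_const ?card_ord // => y _.
  by rewrite mul0r oppr0 char_zero.
have -> : \sum_(c | D c) w (- (0 * c.1 + 0 * c.2)) = #|D|%:R.
  rewrite (eq_bigr (fun=> 1)) ?sumr_const // => y _.
  by rewrite !mul0r addr0 oppr0 char_zero.
have -> : (M ^ 4 * #|D| * card_units)%:R =
   card_units%:R * M%:R ^+ 2 * M%:R ^+ 2 * #|D|%:R :> algC.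
  by rewrite (natrM _ (M ^ 4 * #|D|)) (natrM _ (M ^ 4)) natrX; ring.
rewrite addrAC subrr add0r; apply: le_trans (ler_norm_sum _ _ _) _.
rewrite /smooth_error mulr_sumr; apply: ler_sum => -[k h] _ /=.
rewrite normrM (normrM _ (expsum h ^+ 2)) (normrM _ (expsum k ^+ 2)) !normrX mulrC.
rewrite ler_wpM2r ?mulr_ge0 ?exprn_ge0 //.
apply: le_trans (ler_norm_sum _ _ _) _.
by rewrite (eq_bigr (fun=> 1)) ?sumr_const.
Qed.

(** Parseval on the frequencies killed by m: the condition k m = 0 is detected by summing w (a k m)
    over a, and the sum over k then forces a m = l - l'. *)
Lemma sum_expsum_ann (m : A) :
  \sum_(k | k * m == 0) `|expsum k| ^+ 2 =
  (\sum_(l < M) \sum_(l' < M) #|[pred a : A | (a * m == l%:R - l'%:R)%R]|)%:R.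
Proof.
apply: (@mulfI _ #|A|%:R).
  by rewrite pnatr_eq0 -lt0n; apply/card_gt0P; exists 0.
have -> : #|A|%:R * (\sum_(k | k * m == 0) `|expsum k| ^+ 2) =
   \sum_k \sum_a w (a * (k * m)) * `|expsum k| ^+ 2.
  rewrite mulr_sumr [LHS]big_mkcond /=; apply: eq_bigr => k _.
  rewrite -mulr_suml w_sum natrM.
  by case: eqP; rewrite ?mulr1 ?mulr0 ?mul0r.
have ex k a : w (a * (k * m)) * `|expsum k| ^+ 2 =
   \sum_(l < M) \sum_(l' < M) w (k * (a * m - (l%:R - l'%:R))).
  rewrite normCK rmorph_sum mulr_suml mulr_sumr; apply: eq_bigr => l _.
  rewrite mulr_sumr mulr_sumr; apply: eq_bigr => l' _.
  by rewrite /= w_conj -!wD; congr w; ring.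
rewrite (eq_bigr _ (fun k _ => eq_bigr _ (fun a _ => ex k a))).
under eq_bigr do rewrite exchange_big /=.
rewrite exchange_big /= natr_sum mulr_sumr; apply: eq_bigr => l _.
under eq_bigr do rewrite exchange_big /=.
rewrite exchange_big /= natr_sum mulr_sumr; apply: eq_bigr => l' _.
rewrite exchange_big /=.
under eq_bigr do rewrite w_sum.
rewrite -natr_sum -natrM -big_distrr /=; congr (_ * _)%:R.
by rewrite -sum1_card [RHS]big_mkcond; apply: eq_bigr => a _; rewrite inE subr_eq0; case: eqP => //.
Qed.

End Characters.

(** * Kloosterman sums modulo x *)

Lemma sum_eqmod (q m l : nat) : (0 < m)%N ->
  (\sum_(0 <= i < q * m) (i == l %[mod m]) = q)%N.
Proof.
move=> m0; elim: q => [|q IH]; first by rewrite mul0n big_nil.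
rewrite (@big_cat_nat _ _ _ (q * m)%N) //=; last by rewrite leq_pmul2r.
rewrite IH -[X in (\sum_(X <= _ < _) _)%N]add0n big_addn mulSn addnK.
rewrite (bigD1_seq (l %% m)%N) ?iota_uniq ?mem_index_iota ?ltn_mod //=.
rewrite [(l %% m + _)%N]addnC modnMDl modn_mod eqxx big1_seq ?addn0 ?addn1 // => i /andP[il].
rewrite mem_index_iota => /andP[_ im].
by rewrite addnC modnMDl modn_small // (negPf il).
Qed.

Lemma sum_dvdn (q m : nat) : (0 < m)%N -> (\sum_(0 <= i < q * m) (m %| i) = q)%N.
Proof.
by move=> m0; rewrite -[RHS](sum_eqmod q 0 m0); apply: eq_bigr => i _; rewrite mod0n.
Qed.

(** The primes of the cofactor are added one at a time. A new prime p multiplies phi by p - 1; if p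
    already divides d, the integers below d coprime to d are among those below p d coprime to p
    d. *)
Lemma leq_totient_dvd d n : (0 < n)%N -> (d %| n)%N -> (totient d <= totient n)%N.
Proof.
move=> n0 /dvdnP[e en]; rewrite {n}en in n0 *.
elim: e {-2}e (leqnn e) d n0 => [|m IH] e em d n0.
  by move: em; rewrite leqn0 => /eqP e0; rewrite e0 mul0n in n0.
have [e1|e1] := leqP e 1.
  by case: e {em} e1 n0 => [|[|]] // _ _; rewrite mul1n.
have pp := pdiv_prime e1; set p := pdiv e in pp.
have [e' eE] := dvdnP (pdiv_dvd e); rewrite -/p in eE.
rewrite eE -mulnA; apply: (@leq_trans (totient (p * d))); last first.
  apply: IH; last by rewrite mulnA -eE.
  rewrite -ltnS; apply: leq_trans em; rewrite eE.
  have e'0 : (0 < e')%N by case: e' eE e1 => [->|].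
  by rewrite -[X in (X < _)%N]muln1 ltn_pmul2l // prime_gt1.
have d0 : (0 < d)%N by move: n0; rewrite muln_gt0 => /andP[].
have [pd|npd] := boolP (p %| d)%N; last first.
  rewrite totient_coprime ?prime_coprime //.
  by apply: leq_pmull; rewrite totient_gt0 prime_gt0.
rewrite !totient_count_coprime [leqRHS](@big_cat_nat _ _ _ d) //=; last first.
  by rewrite leq_pmull // prime_gt0.
apply: leq_trans (leq_addr _ _); apply: leq_sum => i _.
case cdi: (coprime d i) => //; rewrite coprimeMl cdi andbT.
by rewrite (coprime_dvdl pd cdi).
Qed.

Definition tau (n : nat) : nat := size (divisors n).

Lemma tau_count n : (0 < n)%N -> (tau n = \sum_(1 <= g < n.+1) (g %| n))%N.
Proof.
move=> n0; rewrite /tau -sum1_size.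
rewrite [RHS](bigID (fun g => g %| n)%N) /= [X in (_ + X)%N]big1 ?addn0; last by move=> g /negPf ->.
rewrite [RHS](eq_bigr (fun=> 1%N)); last by move=> g ->.
rewrite -[RHS]big_filter; apply: perm_big; apply: uniq_perm.
- exact: divisors_uniq.
- by rewrite filter_uniq // iota_uniq.
move=> g; rewrite mem_filter -dvdn_divisors // mem_index_iota ltnS.
by case gn: (g %| n)%N => //=; rewrite (dvdn_leq n0 gn) (dvdn_gt0 n0 gn).
Qed.

(** Gauss's sum of phi over the divisors of n has tau(n) terms, each at most phi(n). It turns the
    number of units into the modulus at the cost of one divisor factor. *)
Lemma totient_tau n : (0 < n)%N -> (n <= totient n * tau n)%N.
Proof.
move=> n0; rewrite -{1}(cyclic.sum_totient_dvd n) tau_count //.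
rewrite -(big_mkord (fun d => d %| n)%N totient) /= big_ltn_cond //.
have -> : (0 %| n)%N = false by rewrite dvd0n; case: (n) n0.
rewrite mulnC big_distrl /= big_mkcond /=; apply: leq_sum => d _.
by case dn: (d %| n)%N => //; rewrite mul1n leq_totient_dvd.
Qed.

Section Modulus.
Variable n : nat.
Notation x := n.+2.
Notation Zx := 'I_n.+2.

Lemma sum_dvdn_Zx m : (m %| x)%N -> (\sum_(r : Zx) (m %| r) = x %/ m)%N.
Proof.
move=> mx; rewrite -(big_mkord predT (fun r => (m %| r) : nat)) /=.
by rewrite -{1}(divnK mx) sum_dvdn // (dvdn_gt0 _ mx).
Qed.

Lemma mulZx_eq0 (r k : Zx) : (r * k == 0) = (x %| r * k)%N.
Proof. by rewrite -val_eqE /= /dvdn. Qed.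

Lemma mulZx_nat_eq0 (k : Zx) m : (k * m%:R == 0) = (x %| k * m)%N.
Proof. by rewrite -val_eqE /= Zp_nat /= modnMmr /dvdn. Qed.

Definition level (k h : Zx) : nat := gcdn (gcdn k h) x.

Lemma level_dvd k h : (level k h %| x)%N.
Proof. exact: dvdn_gcdr. Qed.

Lemma level_gt0 k h : (0 < level k h)%N.
Proof. by rewrite gcdn_gt0 orbT. Qed.

(** An element r kills both k and h exactly when x / gcd(k, h, x) divides r. *)
Lemma ann2_level k h : ann2 k h = level k h.
Proof.
have gx := level_dvd k h.
have dx : (x %/ level k h %| x)%N by rewrite dvdn_divLR ?level_gt0 // dvdn_mulr.
rewrite /ann2 -sum1_card big_mkcond /=.
transitivity (\sum_(r : Zx) (x %/ level k h %| r))%N; last first.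
  by rewrite sum_dvdn_Zx // divnA ?dvdnn // ?mulKn ?level_gt0.
apply: eq_bigr => r _; rewrite inE !mulZx_eq0 -dvdn_gcd -muln_gcdr.
have -> : (x %| r * gcdn k h)%N = (x %| r * level k h)%N.
  by rewrite /level (muln_gcdr r (gcdn k h)) dvdn_gcd [(_ %| r * n.+2)%N]dvdn_mull ?andbT.
by rewrite -dvdn_divLR ?level_gt0 //; case: ifP.
Qed.

Lemma ann_gcdn (a : Zx) : ann a = gcdn a x.
Proof.
have := ann2_level a a; rewrite /level gcdnn => <-.
by apply: eq_card => r; rewrite !inE andbb.
Qed.

Lemma ann_nat_le m : (0 < m)%N -> (ann (m%:R : Zx) <= m)%N.
Proof.
move=> m0; rewrite ann_gcdn Zp_nat /= gcdn_modl.
by apply: dvdn_leq => //; apply: dvdn_gcdl.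
Qed.

(** The annihilator of u has gcd(u, x) elements, at most the sum of the divisors g of x that divide
    u; each g occurs for x / g residues and contributes x in total. *)
Lemma sum_ann_le : (\sum_(u : Zx) ann u <= x * tau x)%N.
Proof.
apply: (@leq_trans (\sum_(u : Zx) \sum_(1 <= g < x.+1) (g %| x) * (g * (g %| u)))%N).
  apply: leq_sum => u _; rewrite ann_gcdn.
  have gx : (gcdn u x %| x)%N by apply: dvdn_gcdr.
  have g0 : (0 < gcdn u x)%N by rewrite gcdn_gt0 orbT.
  rewrite (bigD1_seq (gcdn u x)) ?iota_uniq //=; last first.
    by rewrite mem_index_iota g0 ltnS dvdn_leq.
  by rewrite gx dvdn_gcdl muln1 mul1n leq_addr.
rewrite exchange_big /= tau_count // big_distrr /=.
rewrite big_seq_cond [leqRHS]big_seq_cond; apply: leq_sum => g.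
rewrite andbT mem_index_iota => /andP[g0 _].
rewrite -!big_distrr /=; case gx: (g %| x)%N; rewrite ?mul0n // mul1n muln1.
by rewrite sum_dvdn_Zx // mulnC divnK.
Qed.

Lemma energy_Zx_le : (energy Zx <= 2 * (x * tau x) ^ 2)%N.
Proof.
apply: leq_trans (energy_le _) _.
by rewrite leq_mul ?ann_nat_le // leq_sqr sum_ann_le.
Qed.

Lemma card_units_Zx : card_units Zx = totient x.
Proof.
rewrite totient_count_coprime big_mkord /card_units -sum1_card big_mkcond /=.
apply: eq_bigr => y _; rewrite inE.
by have := @unitZpE n.+2 y isT; rewrite natr_Zp => ->; case: coprime.
Qed.

Variable z : algC.
Hypothesis z_prim : x.-primitive_root z.

Definition Zchar (a : Zx) : algC := z ^+ a.

Lemma ZcharD a b : Zchar (a + b) = Zchar a * Zchar b.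
Proof. by rewrite /Zchar /= prim_expr_mod // exprD. Qed.

Lemma Zchar_norm a : `|Zchar a| = 1.
Proof.
have z1 : `|z| = 1.
  by apply/eqP; rewrite -(@pexpr_eq1 _ _ x) // -normrX prim_expr_order // normr1.
by rewrite /Zchar normrX z1 expr1n.
Qed.

Lemma Zchar_conj a : (Zchar a)^* = Zchar (- a).
Proof.
have : Zchar a * (Zchar a)^* = Zchar a * Zchar (- a).
  by rewrite -normCK Zchar_norm expr1n -ZcharD subrr /Zchar expr0.
by apply: mulfI; rewrite -normr_eq0 Zchar_norm oner_eq0.
Qed.

Lemma Zchar_sum b : \sum_(a : Zx) Zchar (a * b) = (#|Zx| * (b == 0))%:R.
Proof.
rewrite card_ord; have [->|b0] := eqVneq b 0.
  rewrite (eq_bigr (fun=> 1)) => [|a _]; last by rewrite mulr0 /Zchar expr0.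
  by rewrite sumr_const card_ord muln1.
rewrite muln0 (eq_bigr (fun a : Zx => (z ^+ b) ^+ a)); last first.
  by move=> a _; rewrite /Zchar /= prim_expr_mod // -exprM mulnC.
have := subrX1 (z ^+ b) x; rewrite exprAC (prim_expr_order z_prim) expr1n subrr.
move/esym/eqP; rewrite mulf_eq0 subr_eq0 -(prim_order_dvd z_prim).
case/orP => [|/eqP //]; rewrite gtnNdvd ?lt0n //.
Qed.

(** Two factors tau come from the energy and the third from x <= phi(x) tau(x); the coefficient 2
    bounds the annihilator of 2. *)
Lemma kloosterman_Zx_le k h :
  `|kloosterman Zchar k h| ^+ 4 <= (2 * level k h * x ^ 3 * tau x ^ 3)%:R.
Proof.
have := kloosterman_bound ZcharD Zchar_conj Zchar_sum k h.
rewrite card_units_Zx ann2_level card_ord => le1.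
have le2 : (totient x)%:R * `|kloosterman Zchar k h| ^+ 4 <=
    (level k h * (x ^ 2 * (2 * (x * tau x) ^ 2)))%:R.
  by apply: le_trans le1 _; rewrite ler_nat !leq_mul // energy_Zx_le.
rewrite -(ler_pM2l (_ : 0 < x%:R)) ?ltr0n //.
apply: (@le_trans _ _ ((totient x * tau x)%:R * `|kloosterman Zchar k h| ^+ 4)).
  by rewrite ler_wpM2r ?exprn_ge0 // ler_nat totient_tau.
rewrite mulnC natrM -mulrA.
apply: le_trans (ler_wpM2l _ le2) _; first exact: ler0n.
rewrite -!natrM ler_nat; apply: eq_leq.
have -> : (x ^ 3 = x * x ^ 2)%N by rewrite -expnS.
have -> : (tau x ^ 3 = tau x * tau x ^ 2)%N by rewrite -expnS.
rewrite expnMn; lia.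
Qed.

Notation E M := (expsum Zchar M).

Lemma expsum0 M : E M 0 = M%:R.
Proof.
rewrite /expsum (eq_bigr (fun=> 1)) ?sumr_const ?card_ord // => l _.
by rewrite mul0r oppr0 /Zchar expr0.
Qed.

Lemma natr_Zx_eq (i j : nat) : (i%:R == j%:R :> Zx) = (i == j %[mod x])%N.
Proof. by rewrite -val_eqE /= !Zp_nat. Qed.

(** For each l at most M / m + 1 values l' are congruent to l modulo m, and for these a m = l - l'
    has at most m solutions. *)
Lemma sum_expsum_sub M m : (m %| x)%N ->
  \sum_(k | k * m%:R == 0) `|E M k| ^+ 2 <= (M ^ 2 + m * M)%:R.
Proof.
move=> mx; have m0 : (0 < m)%N by apply: dvdn_gt0 mx.
rewrite (sum_expsum_ann ZcharD Zchar_conj Zchar_sum) ler_nat.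
apply: (@leq_trans (\sum_(l < M) m * (M %/ m + 1))%N); last first.
  rewrite sum_nat_const card_ord mulnC mulnDr muln1 [(m * (_ %/ _))%N]mulnC.
  by rewrite mulnDl -mulnn leq_add2r leq_mul2r leq_trunc_div orbT.
apply: leq_sum => l _.
apply: (@leq_trans (\sum_(l' < M) m * (l' == l %[mod m]))%N).
  apply: leq_sum => l' _; case: eqP => ll'.
    by rewrite muln1; apply: leq_trans (card_coset_ann _ _) (ann_nat_le _).
  rewrite muln0 leqn0; apply/eqP/eq_card0 => a; rewrite !inE; apply/negP => /eqP alm.
  apply: ll'; have /eqP : (a * m + l')%:R = l%:R :> Zx.
    by rewrite natrD natrM natr_Zp alm subrK.
  rewrite natr_Zx_eq => /eqP /(congr1 (modn^~ m)).
  by rewrite !modn_dvdm // modnMDl.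
rewrite -big_distrr leq_mul2l /=; apply/orP; right.
rewrite -(big_mkord predT (fun l' => (l' == l %[mod m]) : nat)) /=.
rewrite -[leqRHS](sum_eqmod _ l m0) [leqRHS](@big_cat_nat _ _ _ M) //=; first exact: leq_addr.
by rewrite addn1 ltnW // ltn_ceil.
Qed.

Lemma sum_expsum M : (M <= x)%N ->
  \sum_k `|E M k| ^+ 2 = (x * M)%:R.
Proof.
move=> Mx.
transitivity (\sum_(k | k * 0 == 0 :> Zx) `|E M k| ^+ 2).
  by apply: eq_bigl => k; rewrite mulr0 eqxx.
rewrite (sum_expsum_ann ZcharD Zchar_conj Zchar_sum); congr _%:R.
transitivity (\sum_(l < M) x)%N; last by rewrite sum_nat_const card_ord mulnC.
apply: eq_bigr => l _; rewrite (bigD1 l) //= big1 ?addn0 => [|l' l'l].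
  rewrite -[RHS]card_ord; apply: eq_card => a.
  by rewrite !inE mulr0 subrr eqxx.
apply/eq_card0 => a; rewrite !inE mulr0 eq_sym subr_eq0 natr_Zx_eq.
rewrite !modn_small ?(leq_trans (ltn_ord _) Mx) //.
by rewrite eq_sym val_eqE (negPf l'l).
Qed.

(** For such levels the fourth power is at most 2 c tau^4 x^3, and the condition on c^5 tau^4 is
    what makes this at most x^4 / c^4. *)
Lemma kloosterman_level_le c k h : (0 < c)%N -> (2 * c ^ 5 * tau x ^ 4 <= x)%N ->
  (level k h <= c * tau x)%N -> `|kloosterman Zchar k h| <= x%:R / c%:R.
Proof.
move=> c0 cx lev; rewrite -(@ler_pXn2r _ 4) ?nnegrE ?divr_ge0 //.
apply: le_trans (kloosterman_Zx_le k h) _.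
rewrite expr_div_n ler_pdivlMr ?exprn_gt0 ?ltr0n // -!natrX -natrM ler_nat.
apply: (@leq_trans (2 * (c * tau x) * x ^ 3 * tau x ^ 3 * c ^ 4)).
  by rewrite leq_mul2r leq_mul ?orbT // leq_mul2r leq_mul2l lev !orbT.
apply: (@leq_trans (2 * c ^ 5 * tau x ^ 4 * x ^ 3)); last first.
  by rewrite [leqRHS]expnS leq_mul2r cx orbT.
have -> : (c ^ 5 = c * c ^ 4)%N by rewrite -expnS.
have -> : (tau x ^ 4 = tau x * tau x ^ 3)%N by rewrite -expnS.
by apply: eq_leq; lia.
Qed.

Lemma kloosterman_Zx_trivial k h : `|kloosterman Zchar k h| <= x%:R.
Proof.
apply: le_trans (ler_norm_sum _ _ _) _.
rewrite (eq_bigr (fun=> 1)) => [|y _]; last exact: Zchar_norm.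
by rewrite sumr_const ler_nat -[leqRHS]card_ord max_card.
Qed.

(** Removing the zero frequency is essential, since it alone carries M^4: what remains of (M^2 + m
    M)^2 is 2 m M^3 + m^2 M^2, and M, m <= x. *)
Lemma sum_expsum_sub2 M m : (m %| x)%N -> (M <= x)%N ->
  \sum_(p : Zx * Zx | (p != (0, 0)) && ((p.1 * m%:R == 0) && (p.2 * m%:R == 0)))
     `|E M p.1| ^+ 2 * `|E M p.2| ^+ 2 <= (3 * m * x * M ^ 2)%:R.
Proof.
move=> mx Mx.
pose T := \sum_(k | k * m%:R == 0) `|E M k| ^+ 2.
have T2 : \sum_(p : Zx * Zx | (p.1 * m%:R == 0) && (p.2 * m%:R == 0))
     `|E M p.1| ^+ 2 * `|E M p.2| ^+ 2 = T ^+ 2.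
  by rewrite expr2 mulr_sum_pair.
move: T2; rewrite (bigD1 (0, 0)) /= ?mul0r ?eqxx // expsum0 normr_nat => T2.
rewrite (eq_bigl (fun p : Zx * Zx =>
    ((p.1 * m%:R == 0) && (p.2 * m%:R == 0)) && (p != (0, 0)))); last first.
  by move=> p; rewrite andbC.
move/(canRL (addKr _)): T2 => ->.
have T0 : 0 <= T by apply: sumr_ge0 => k _; rewrite exprn_ge0.
have TM : T ^+ 2 <= (M ^ 2 + m * M)%:R ^+ 2.
  by rewrite ler_pXn2r ?nnegrE // sum_expsum_sub.
rewrite addrC lerBlDr; apply: le_trans TM _.
rewrite -!natrX -natrM -natrD ler_nat.
have mlex : (m <= x)%N by apply: dvdn_leq.
move: (x) Mx mlex => X Mx mlex; nia.
Qed.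

(** Levels up to c tau(x) get the bound x / c against a total Parseval mass (x M)^2. A larger level
    g gets only the trivial bound x, but its frequencies lie in the small subgroup killed by x / g <
    x / (c tau(x)). There are at most tau(x) such g, and they account for 3 of the 4. *)
Lemma smooth_error_le M c : (0 < c)%N -> (2 * c ^ 5 * tau x ^ 4 <= x)%N ->
  (M <= x)%N -> c%:R * smooth_error Zchar M <= (4 * x ^ 3 * M ^ 2)%:R.
Proof.
move=> c0 cx Mx.
pose T (p : Zx * Zx) := `|E M p.1| ^+ 2 * `|E M p.2| ^+ 2.
have T0 p : 0 <= T p by rewrite mulr_ge0 ?exprn_ge0.
pose bad (g : 'I_x.+1) := (g %| x)%N && (c * tau x < g)%N.
pose B (g : 'I_x.+1) (p : Zx * Zx) :=
  (p.1 * (x %/ g)%:R == 0) && (p.2 * (x %/ g)%:R == 0).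
have pointwise p : `|kloosterman Zchar p.1 p.2| <=
    x%:R / c%:R + \sum_(g | bad g) (B g p)%:R * x%:R.
  have [lev|lev] := leqP (level p.1 p.2) (c * tau x).
    apply: le_trans (kloosterman_level_le c0 cx lev) _.
    by rewrite lerDl sumr_ge0 // => g _; rewrite mulr_ge0.
  have lx : (level p.1 p.2 < x.+1)%N by rewrite ltnS dvdn_leq ?level_dvd.
  rewrite (bigD1 (Ordinal lx)) /=; last by rewrite /bad /= level_dvd.
  have -> : B (Ordinal lx) p.
    have lk : (level p.1 p.2 %| p.1)%N by rewrite (dvdn_trans (dvdn_gcdl _ _)) ?dvdn_gcdl.
    have lh : (level p.1 p.2 %| p.2)%N by rewrite (dvdn_trans (dvdn_gcdl _ _)) ?dvdn_gcdr.
    rewrite /B /= !mulZx_nat_eq0 !muln_divA ?level_dvd //.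
    by rewrite -!divn_mulAC // !dvdn_mull.
  rewrite mul1r; apply: le_trans (kloosterman_Zx_trivial _ _) _.
  by rewrite addrCA lerDl addr_ge0 ?divr_ge0 // sumr_ge0.
have sumT : \sum_p T p = ((x * M) ^ 2)%:R.
  rewrite natrX -(sum_expsum Mx) expr2 mulr_sum_pair.
  by apply: eq_bigl => p.
have le1 : smooth_error Zchar M <=
    x%:R / c%:R * ((x * M) ^ 2)%:R +
    \sum_(g | bad g) x%:R * (3 * (x %/ g) * x * M ^ 2)%:R.
  apply: (@le_trans _ _ (\sum_(p | p != (0, 0))
       (x%:R / c%:R + \sum_(g | bad g) (B g p)%:R * x%:R) * T p)).
    apply: ler_sum => p _; rewrite -mulrA -/(T p).
    by rewrite ler_wpM2r.
  under eq_bigr do rewrite mulrDl.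
  rewrite big_split /= lerD //.
    rewrite -mulr_sumr ler_wpM2l ?divr_ge0 // -sumT.
    by rewrite [leRHS](bigD1 (0, 0)) //= lerDr.
  under eq_bigr do rewrite mulr_suml.
  rewrite exchange_big /=; apply: ler_sum => g /andP[gx _].
  have mx : (x %/ g %| x)%N by apply: dvdn_div.
  apply: le_trans (ler_wpM2l _ (sum_expsum_sub2 mx Mx)); last exact: ler0n.
  rewrite mulr_sumr big_mkcondr /=; apply: ler_sum => p _.
  rewrite /B; case: ifP => _; last by rewrite !mul0r.
  by rewrite mul1r.
apply: le_trans (ler_wpM2l _ le1) _; first exact: ler0n.
rewrite mulrDr mulrA mulrCA divff ?pnatr_eq0 -?lt0n // mulr1.
have le2 : c%:R * (\sum_(g | bad g) x%:R * (3 * (x %/ g) * x * M ^ 2)%:R : algC) <=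
   (3 * x ^ 3 * M ^ 2)%:R.
  under eq_bigr do rewrite -natrM.
  rewrite -natr_sum -natrM ler_nat.
  have t0 : (0 < tau x)%N by rewrite /tau; case: (divisors x) (divisors_id (ltn0Sn n.+1)).
  have aux a b d X N : (a * (b * d) <= X)%N ->
      (a * (b * (X * (3 * d * X * N))) <= 3 * X ^ 3 * N)%N.
    move=> abX; have -> : (X ^ 3 = X * X * X)%N by rewrite !expnS expn0 muln1 mulnA.
    have -> : (a * (b * (X * (3 * d * X * N))) = 3 * (X * X) * N * (a * (b * d)))%N by lia.
    have -> : (3 * (X * X * X) * N = 3 * (X * X) * N * X)%N by lia.
    by rewrite leq_mul2l abX orbT.
  rewrite -(leq_pmul2l t0) !big_distrr /=.
  apply: (@leq_trans (\sum_(g : 'I_x.+1 | bad g) 3 * x ^ 3 * M ^ 2)%N).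
    apply: leq_sum => g /andP[gx cg].
    have gE : ((x %/ g) * g = x)%N by rewrite divnK.
    have : (tau x * c * (x %/ g) <= x)%N.
      by rewrite -[leqRHS]gE mulnC leq_mul2l [(tau x * c)%N]mulnC ltnW // orbT.
    by rewrite -mulnA => /aux; apply.
  rewrite sum_nat_const leq_mul2r; apply/orP; right.
  rewrite tau_count // -sum1_card big_mkcond /=.
  apply: (@leq_trans (\sum_(g < x.+1) ((g %| x) && (0 < g)))%N).
    apply: leq_sum => g _; rewrite unfold_in /bad; case: (g %| x)%N => //=.
    by case: ifP => // /(leq_ltn_trans (leq0n _)) ->.
  rewrite -(big_mkord predT (fun g => ((g %| x) && (0 < g))%N : nat)) /=.
  rewrite big_ltn // ltnn andbF add0n.
  by apply: leq_sum => g _; case: (g %| x)%N => //=; case: (0 < g)%N.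
apply: le_trans (lerD (lexx _) le2) _.
rewrite -natrM -natrD ler_nat; apply: eq_leq.
have -> : (x ^ 3 = x * x ^ 2)%N by rewrite -expnS.
rewrite expnMn; lia.
Qed.

End Modulus.

(** * Equidistribution on modular hyperbolas *)

(** Representatives run over [1, x] rather than [0, x). The choices agree for x > 1, where 0 is no
    unit; for x = 1 the fraction 1/1 needs y = v = 1. *)
Definition hyp (x : nat) (D : nat -> nat -> bool) : nat :=
  (\sum_(1 <= y < x.+1) \sum_(1 <= v < x.+1) ((y * v == 1 %[mod x]) && D y v))%N.

Definition box (x : nat) (D : nat -> nat -> bool) : nat :=
  (\sum_(c < x) \sum_(c' < x) D c c')%N.

Definition down_closed (D : nat -> nat -> bool) :=
  forall a a' c c', (a <= c)%N -> (a' <= c')%N -> D c c' -> D a a'.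

Section Equidistribution.
Variable n : nat.
Notation x := n.+2.
Notation Zx := 'I_n.+2.

Definition hypZ (D : pred (Zx * Zx)) : nat :=
  (\sum_(y : Zx | y \is a GRing.unit) D (y, y^-1)%R)%N.

Lemma hyp_hypZ D : hyp x D = hypZ (fun p => D p.1 p.2).
Proof.
have shiftsum (F : nat -> nat) : (F 0 = F x -> \sum_(1 <= i < x.+1) F i = \sum_(i < x) F i)%N.
  by move=> F0; rewrite -(big_mkord predT F) [RHS]big_ltn // big_nat_recr //= F0 addnC.
rewrite /hyp shiftsum; last first.
  by rewrite !big1_seq // => v _; rewrite ?mul0n ?modnMr ?modnMl ?mod0n modn_small.
rewrite /hypZ [RHS]big_mkcond /=; apply: eq_bigr => y _.
rewrite shiftsum; last by rewrite muln0 modnMl mod0n modn_small.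
have prodE (v : Zx) : (y * v == 1 %[mod x])%N = (y * v == 1 :> Zx).
  by rewrite -[RHS]val_eqE.
case: ifP => uy; last first.
  rewrite big1 // => v _; rewrite prodE; case: eqP => // yv.
  by have /negP[] := negbT uy; apply/unitrP; exists v; rewrite mulrC yv.
rewrite (bigD1 y^-1) //= prodE divrr // eqxx big1 ?addn0 // => v vy.
rewrite prodE; case: eqP => // yv.
by move: vy; rewrite -[v]mul1r -(mulVr uy) -mulrA yv mulr1 eqxx.
Qed.

(** Only positive representatives are compared: negation reverses their order but fixes 0, so the
    reflected complement in the lower bound need not be down-closed at 0. *)
Definition down_closedZ (D : pred (Zx * Zx)) :=
  forall a a' c c' : Zx, (0 < a <= c)%N -> (0 < a' <= c')%N -> D (c, c') -> D (a, a').

Lemma val_sub_shift M (y : Zx) (s : 'I_M * 'I_M) : (2 * M <= y)%N ->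
  (0 < (y - window_shift Zx s)%R <= y)%N.
Proof.
move=> My; have sM : (s.1 + s.2 < 2 * M)%N.
  by rewrite mul2n -addnn; have := ltn_ord s.1; have := ltn_ord s.2; lia.
have sy : (s.1 + s.2 < y)%N by apply: leq_trans sM My.
suff -> : (y - window_shift Zx s = (y - (s.1 + s.2))%:R :> Zx)%R.
  rewrite Zp_nat /= modn_small; last by apply: leq_ltn_trans (leq_subr _ _) (ltn_ord y).
  by rewrite subn_gt0 sy leq_subr.
by rewrite natrB ?(ltnW sy) // natr_Zp.
Qed.

(** If y and 1/y are at least 2 M, every shift moves the point down without wrapping around and
    keeps it in [D]. At most 2 M units fail this for y, and at most 2 M for 1/y. *)
Lemma hypZ_smooth_count M D : down_closedZ D ->
  (M ^ 4 * hypZ D <= smooth_count M D + M ^ 4 * (4 * M))%N.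
Proof.
move=> dD.
have M4 : (\sum_(s : 'I_M * 'I_M) \sum_(s' : 'I_M * 'I_M) 1 = M ^ 4)%N.
  by rewrite !sum_nat_const card_prod card_ord !expnS expn0 !muln1 !mulnA.
have small : (\sum_(y : Zx | y \is a GRing.unit) (y < 2 * M) <= 2 * M)%N.
  rewrite big_mkcond /=; apply: (@leq_trans (\sum_(y < x) (y < 2 * M))%N).
    by apply: leq_sum => y _; case: ifP.
  rewrite -(big_mkord predT (fun y => (y < 2 * M) : nat)%N).
  have [xM|Mx] := leqP x (2 * M).
    apply: leq_trans xM; rewrite -[leqRHS]subn0 -[leqRHS]muln1 -sum_nat_const_nat.
    by apply: leq_sum => y _; case: ltnP.
  rewrite (@big_cat_nat _ _ _ (2 * M)) //=; last exact: ltnW.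
  rewrite [X in (_ + X)%N]big1_seq ?addn0; last first.
    by move=> y /andP[_]; rewrite mem_index_iota => /andP[My _]; rewrite ltnNge My.
  rewrite -[leqRHS]subn0 -[leqRHS]muln1 -sum_nat_const_nat.
  by apply: leq_sum => y _; case: ltnP.
have smallV : (\sum_(y : Zx | y \is a GRing.unit) ((y^-1)%R < 2 * M) <= 2 * M)%N.
  apply: leq_trans small; rewrite [leqRHS](reindex_inj (can_inj (@invrK _))) /=.
  by apply: eq_leq; apply: eq_bigl => y; rewrite unitrV.
apply: (@leq_trans (smooth_count M D + M ^ 4 *
   (\sum_(y : Zx | y \is a GRing.unit) (y < 2 * M) +
    \sum_(y : Zx | y \is a GRing.unit) ((y^-1)%R < 2 * M)))%N); last first.
  rewrite leq_add2l leq_mul2l; apply/orP; right.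
  by apply: leq_trans (leq_add small smallV) _; lia.
rewrite /hypZ /smooth_count -big_split /= !big_distrr /= -big_split /=.
apply: leq_sum => y uy.
have [y1|y1] := ltnP y (2 * M).
  case: (D _); rewrite ?muln0 ?leq0n // muln1.
  by apply: leq_trans (leq_addl _ _); rewrite mulnDr muln1 leq_addr.
have [y2|y2] := ltnP (y^-1)%R (2 * M).
  case: (D _); rewrite ?muln0 ?leq0n // muln1.
  by apply: leq_trans (leq_addl _ _); rewrite /= ?add0n ?muln1.
rewrite muln0 addn0; case Dy: (D _); last by rewrite muln0.
rewrite muln1 -M4; apply: leq_sum => s _; apply: leq_sum => s' _.
by rewrite (dD _ _ _ _ (val_sub_shift s y1) (val_sub_shift s' y2) Dy).
Qed.

Lemma smooth_count_upper M c (D : pred (Zx * Zx)) : (0 < c)%N -> (2 * c ^ 5 * tau x ^ 4 <= x)%N ->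
  (M <= x)%N ->
  (c * x ^ 2 * smooth_count M D <=
   c * M ^ 4 * #|D| * totient x + 4 * x ^ 5 * M ^ 2)%N.
Proof.
move=> c0 cx Mx; have [z z_prim] := C_prim_root_exists (ltn0Sn n.+1).
have le1 := smooth_count_le (ZcharD z_prim) (Zchar_norm z_prim) (Zchar_sum z_prim) M D.
have le2 := smooth_error_le z_prim c0 cx Mx.
rewrite card_units_Zx card_ord in le1.
have D2 : (#|D| <= x ^ 2)%N.
  by apply: leq_trans (max_card _) _; rewrite card_prod card_ord mulnn.
rewrite -(ler_nat algC).
have le3 : (x ^ 2 * smooth_count M D)%:R <=
    (M ^ 4 * #|D| * totient x)%:R + #|D|%:R * smooth_error (@Zchar n z) M :> algC.
  by rewrite -lerBlDl; apply: le_trans le1; rewrite real_ler_norm ?realB ?realn.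
have e0 : 0 <= smooth_error (@Zchar n z) M.
  by apply: sumr_ge0 => p _; rewrite !mulr_ge0 ?exprn_ge0.
have le4 : #|D|%:R * (c%:R * smooth_error (@Zchar n z) M) <=
    (x ^ 2 * (4 * x ^ 3 * M ^ 2))%:R.
  rewrite natrM; apply: ler_pM => //; last by rewrite ler_nat.
  by rewrite mulr_ge0.
have le5 := ler_wpM2l (ler0n algC c) le3.
have -> : (c * x ^ 2 * smooth_count M D = c * (x ^ 2 * smooth_count M D))%N by rewrite mulnA.
rewrite natrM; apply: le_trans le5 _.
rewrite mulrDr mulrCA -natrM natrD.
apply: lerD; first by rewrite ler_nat !mulnA.
apply: le_trans le4 _; rewrite ler_nat.
have -> : (x ^ 5 = x ^ 2 * x ^ 3)%N by rewrite -expnD.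
by apply: eq_leq; lia.
Qed.

(** With M about x / K, smoothing costs 4 M <= 8 x / K points. The Fourier error 4 x^3 / (c M^2) is
    at most 4 x / K for c = K^3. Hence the 12, and the exponent 15 as 3 times 5. *)
Lemma hypZ_upper K D : (1 < K)%N -> (2 * K ^ 15 * tau x ^ 4 <= x)%N ->
  down_closedZ D ->
  (K * x ^ 2 * hypZ D <= K * totient x * #|D| + 12 * x ^ 3)%N.
Proof.
move=> K1 Kx dD; have K0 : (0 < K)%N by apply: ltn_trans K1.
pose M := (x %/ K + 1)%N.
have c0 : (0 < K ^ 3)%N by rewrite expn_gt0 K0.
have cx : (2 * (K ^ 3) ^ 5 * tau x ^ 4 <= x)%N by rewrite -expnM.
have t0 : (0 < tau x)%N by rewrite /tau; case: (divisors x) (divisors_id (ltn0Sn n.+1)).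
have Klex : (2 * K <= x)%N.
  apply: leq_trans Kx; rewrite -mulnA leq_mul2l /=.
  rewrite -[leqLHS]muln1 leq_mul ?expn_gt0 ?t0 //.
  by rewrite -[X in (X <= _)%N]expn1 leq_exp2l.
have KM1 : (x <= K * M)%N by rewrite mulnC /M addn1 ltnW // ltn_ceil.
have KM2 : (K * M <= 2 * x)%N.
  rewrite /M mulnDr muln1 mulnC mul2n -addnn leq_add ?leq_trunc_div //.
  by apply: leq_trans Klex; rewrite leq_pmull.
have Mx : (M <= x)%N.
  by rewrite -(leq_pmul2l K0); apply: leq_trans KM2 _; rewrite leq_mul2r K1 orbT.
have M0 : (0 < M)%N by rewrite /M addn1.
have up := smooth_count_upper D c0 cx Mx.
have sm := hypZ_smooth_count M dD.
have le1 : (K ^ 3 * x ^ 2 * (M ^ 4 * hypZ D) <=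
   K ^ 3 * M ^ 4 * #|D| * totient x + 4 * x ^ 5 * M ^ 2
   + K ^ 3 * x ^ 2 * (M ^ 4 * (4 * M)))%N.
  apply: leq_trans (leq_add up (leqnn _)).
  by rewrite -mulnDr leq_mul2l sm orbT.
have P0 : (0 < K ^ 3 * M ^ 4)%N by rewrite muln_gt0 c0 expn_gt0 M0.
rewrite -(leq_pmul2l P0).
apply: (@leq_trans (K * (K ^ 3 * x ^ 2 * (M ^ 4 * hypZ D)))%N); first by apply: eq_leq; lia.
apply: leq_trans (leq_mul (leqnn K) le1) _.
have x5 : (x ^ 2 <= (K * M) ^ 2)%N by rewrite leq_sqr.
have xE5 : (x ^ 5 = x ^ 3 * x ^ 2)%N by rewrite -expnD.
have xE3 : (x ^ 3 = x ^ 2 * x)%N by rewrite expnSr.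
have KE : (K ^ 3 = K * K ^ 2)%N by rewrite expnS.
have ME : (M ^ 4 = M ^ 2 * M ^ 2)%N by rewrite -expnD.
have t1 : (K * (4 * x ^ 5 * M ^ 2) <= 4 * (x ^ 3 * (K ^ 3 * M ^ 4)))%N.
  apply: (@leq_trans (4 * K * x ^ 3 * M ^ 2 * x ^ 2)); first by rewrite xE5; lia.
  apply: leq_trans (leq_mul (leqnn _) x5) _.
  by rewrite expnMn KE ME; lia.
have t2 : (K * (K ^ 3 * x ^ 2 * (M ^ 4 * (4 * M))) <= 8 * (x ^ 3 * (K ^ 3 * M ^ 4)))%N.
  apply: (@leq_trans (4 * K ^ 3 * x ^ 2 * M ^ 4 * (K * M))); first by lia.
  apply: leq_trans (leq_mul (leqnn _) KM2) _.
  by rewrite xE3; lia.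
rewrite (mulnDr K (_ + _)%N) (mulnDr K (K ^ 3 * _ * _ * _)%N) [leqRHS]mulnDr addnAC; move: t1 t2.
set u1 := (K * (4 * _ * _))%N; set u2 := (K * (K ^ 3 * _ * _))%N.
set u3 := (x ^ 3 * (K ^ 3 * M ^ 4))%N => t1 t2.
apply: (@leq_trans (K * (K ^ 3 * M ^ 4 * #|D| * totient x) + 8 * u3 + 4 * u3)).
  exact: leq_add (leq_add (leqnn _) t2) t1.
rewrite -addnA -mulnDl /u3; apply: eq_leq; clear; lia.
Qed.

(** The complement reflected by p -> -p is down-closed again, and negation commutes with inversion.
    Its upper bound is the lower bound for [D], the totals being phi(x) points on the hyperbola and
    x^2 in the square. *)
Lemma hypZ_lower K D : (1 < K)%N -> (2 * K ^ 15 * tau x ^ 4 <= x)%N ->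
  down_closedZ D ->
  (K * totient x * #|D| <= K * x ^ 2 * hypZ D + 12 * x ^ 3)%N.
Proof.
move=> K1 Kx dD.
pose D' : pred (Zx * Zx) := fun p => ~~ D (- p.1, - p.2).
have valN (a : Zx) : (0 < a)%N -> (- a)%R = (x - a)%N :> nat.
  by move=> a0; rewrite /= modn_small // ltn_subrL a0.
have dD' : down_closedZ D'.
  move=> a a' c c' /andP[a0 ac] /andP[a'0 a'c']; apply: contra.
  have c0 := leq_trans a0 ac; have c'0 := leq_trans a'0 a'c'.
  apply: dD; rewrite !valN //.
    by rewrite subn_gt0 ltn_ord leq_sub2l.
  by rewrite subn_gt0 ltn_ord leq_sub2l.
have cardD' : (#|D'| + #|D| = x ^ 2)%N.
  have -> : #|D'| = #|[predC D]|.
    pose neg (p : Zx * Zx) := (- p.1, - p.2).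
    have negK : involutive neg by case=> a b; rewrite /neg /= !opprK.
    rewrite -!sum1_card [LHS](reindex_inj (inv_inj negK)) /=.
    by apply: eq_bigl => -[a b]; rewrite !inE !unfold_in /D' /neg /= !opprK.
  by rewrite addnC cardC card_prod card_ord mulnn.
have hypD' : (hypZ D' + hypZ D = totient x)%N.
  rewrite -card_units_Zx /card_units -sum1_card /hypZ.
  rewrite [in X in (_ + X)%N](reindex_inj oppr_inj) /=.
  rewrite [in X in (_ + X)%N](eq_bigl (fun y => y \is a GRing.unit)); last first.
    by move=> y; rewrite unitrN.
  rewrite -big_split /=; apply: eq_bigr => y _.
  by rewrite /D' /= invrN; case: (D _).
have up := hypZ_upper K1 Kx dD'.
have e : (K * x ^ 2 * (hypZ D' + hypZ D) = K * totient x * (#|D'| + #|D|))%N.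
  by rewrite hypD' cardD' mulnAC.
move: up e; rewrite (mulnDr (K * x ^ 2)%N) (mulnDr (K * totient x)%N).
have aux : forall a1 a2 b1 b2 e, (a1 <= b1 + e -> a1 + a2 = b1 + b2 -> b2 <= a2 + e)%N.
  by clear=> *; lia.
exact: aux.
Qed.

End Equidistribution.

Lemma hyp_equidistribution (R : realType) (K x : nat) (D : nat -> nat -> bool) :
  (1 < K)%N -> (2 * K ^ 15 * tau x ^ 4 <= x)%N -> (0 < x)%N -> down_closed D ->
  `|(hyp x D)%:R - (totient x * box x D)%:R / x%:R ^+ 2| <= 12 * x%:R / K%:R :> R.
Proof.
move=> K1 Kx x0 dD.
have x1 : (1 < x)%N.
  apply: leq_trans Kx; rewrite -mulnA -[X in (X <= _)%N]muln1 leq_mul2l /=.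
  have t0 : (0 < tau x)%N by rewrite /tau; case: (divisors x) (divisors_id x0).
  by rewrite muln_gt0 !expn_gt0 t0 (ltn_trans _ K1).
case: x x1 x0 Kx => [|[|n]] // _ _ Kx.
pose Dp (p : 'I_n.+2 * 'I_n.+2) := D p.1 p.2.
have dDp : down_closedZ Dp.
  by move=> a a' c c' /andP[_ ac] /andP[_ ac']; apply: dD.
have boxE : box n.+2 D = #|Dp|.
  rewrite /box pair_big /= -sum1_card [RHS]big_mkcond /=.
  by apply: eq_bigr => -[a b] _; rewrite unfold_in /Dp /=; case: (D a b).
have up := hypZ_upper K1 Kx dDp; have lo := hypZ_lower K1 Kx dDp.
rewrite hyp_hypZ -/Dp boxE; set x := n.+2 in up lo *.
have Kp : 0 < K%:R :> R by rewrite ltr0n (ltn_trans _ K1).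
have xp : 0 < x%:R :> R by rewrite ltr0n.
have x2p : 0 < x%:R ^+ 2 :> R by rewrite exprn_gt0.
have scale (u v : R) : K%:R * x%:R ^+ 2 * u <= K%:R * x%:R ^+ 2 * v -> u <= v.
  by rewrite ler_pM2l // mulr_gt0.
have e1 : K%:R * x%:R ^+ 2 * ((totient x * #|Dp|)%:R / x%:R ^+ 2) =
   (K * totient x * #|Dp|)%:R :> R.
  by rewrite !natrM; field; rewrite lt0r_neq0.
have e2 : K%:R * x%:R ^+ 2 * (12 * x%:R / K%:R) = (12 * x ^ 3)%:R :> R.
  by rewrite (natrM R 12) (natrX R x 3); field; rewrite lt0r_neq0.
have e3 : K%:R * x%:R ^+ 2 * (hypZ Dp)%:R = (K * x ^ 2 * hypZ Dp)%:R :> R.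
  by rewrite (natrM R (K * x ^ 2)) (natrM R K) (natrX R x 2).
rewrite ler_norml; apply/andP; split; apply: scale.
  rewrite mulrN mulrBr e1 e2 e3 lerNl opprB lerBlDr -natrD ler_nat addnC.
  exact: lo.
rewrite mulrBr e1 e2 e3 lerBlDr -natrD ler_nat addnC; exact: up.
Qed.

(** * Summatory functions of phi and tau *)

Section Harmonic.
Variable R : realType.

Definition harm (n : nat) : R := \sum_(1 <= g < n.+1) g%:R^-1.

Lemma harm_le_ln n : (0 < n)%N -> harm n <= 1 + ln (n%:R : R).
Proof.
elim: n => // -[|n] IH _.
  by rewrite /harm big_nat1 invr1 ln1 addr0.
rewrite /harm big_nat_recr //=.
apply: le_trans (lerD (IH isT) (lexx _)) _; rewrite -addrA lerD2l.
have p1 : 0 < n.+1%:R :> R by rewrite ltr0n.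
have p2 : 0 < n.+2%:R :> R by rewrite ltr0n.
have e : 1 - n.+2%:R^-1 = n.+1%:R / n.+2%:R :> R.
  rewrite -[n.+2%:R]natr1; move: n.+1%:R p1 => m m0.
  by field; rewrite lt0r_neq0 //; lra.
have := @le_ln1Dx R (- n.+2%:R^-1); rewrite e ln_div ?posrE // lerBlDr => le1.
rewrite addrC -lerBrDl addrC; apply: le1.
by rewrite ltrN2 invf_lt1 // ltr1n.
Qed.

(** This is ln s <= s - 1 for n = s^8. The eighth root is chosen against Q^(1/4) = s^2, the size of
    tau on the moduli to be excluded: s is of smaller order. *)
Lemma harm_le_root (s : R) n : (0 < n)%N -> 1 <= s -> n%:R = s ^+ 8 -> harm n <= 9 * s.
Proof.
move=> n0 s1 ns; have s0 : 0 < s by apply: lt_le_trans s1.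
apply: le_trans (harm_le_ln n0) _; rewrite ns lnXn // -mulr_natl.
have := @le_ln1Dx R (s - 1); rewrite addrCA subrr addr0 => /(_ _) le1.
have {}le1 : ln s <= s - 1 by apply: le1; rewrite ltrBrDr addrC subrr.
lra.
Qed.

Lemma root8_nat n : (0 < n)%N -> exists2 s : R, 1 <= s & n%:R = s ^+ 8.
Proof.
move=> n0; have n1 : 1 <= n%:R :> R by rewrite ler1n.
pose s := Num.sqrt (Num.sqrt (Num.sqrt (n%:R : R))).
have sq1 (a : R) : 1 <= a -> 1 <= Num.sqrt a by move=> a1; rewrite -sqrtr1 ler_wsqrtr.
exists s; first by rewrite /s !sq1.
by rewrite -[8%N]/(2 * (2 * 2))%N !exprM !sqr_sqrtr ?sqrtr_ge0.
Qed.

Lemma root8_large (B : R) : exists N, forall n (s : R), (N <= n)%N -> 1 <= s ->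
  n%:R = s ^+ 8 -> B <= s.
Proof.
exists (Num.bound (Num.max B 0 ^+ 8)).+1 => n s Nn s1 ns.
have s0 : 0 <= s by apply: le_trans s1.
apply: (@le_trans _ _ (Num.max B 0)); first by rewrite le_max lexx.
have B0 : 0 <= Num.max B 0 by rewrite le_max lexx orbT.
rewrite -(@ler_pXn2r _ 8) // -ns; apply: ltW.
apply: (@lt_le_trans _ _ (Num.bound (Num.max B 0 ^+ 8))%:R); last first.
  by rewrite ler_nat ltnW.
by have := archi_boundP (exprn_ge0 8 B0).
Qed.

Lemma harm_small (e : R) : 0 < e -> exists N, forall n, (N <= n)%N -> harm n <= e * n%:R.
Proof.
move=> e0; have [N HN] := root8_large (9 / e).
exists N.+1 => n Nn; have n0 : (0 < n)%N by apply: leq_trans Nn.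
have [s s1 ns] := root8_nat n0; have Bs := HN n s (ltnW Nn) s1 ns.
apply: le_trans (harm_le_root n0 s1 ns) _; rewrite ns.
have s0 : 0 < s by apply: lt_le_trans s1.
rewrite exprS mulrCA mulrC ler_pM2l //; move: Bs; rewrite ler_pdivrMr // => Bs.
rewrite mulrC in Bs; apply: le_trans Bs _; rewrite ler_pM2l //.
by rewrite -[leLHS]expr1 ler_weXn2l.
Qed.

Definition sqsum (n : nat) : R := \sum_(1 <= g < n.+1) (g%:R ^+ 2)^-1.

Lemma series_riemann2 : series (riemannR (2 : R)) = fun n => \sum_(1 <= g < n.+1) (g%:R ^+ 2)^-1.
Proof.
apply/funext => n; rewrite /series /= big_add1 /=; apply: eq_bigr => k _.
by rewrite /riemannR powR_mulrn.
Qed.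

Lemma sqsum_tail n k : (0 < n)%N ->
  \sum_(n.+1 <= g < (n + k).+1) (g%:R ^+ 2)^-1 <= n%:R^-1 - (n + k)%:R^-1 :> R.
Proof.
move=> n0; elim: k => [|k IH]; first by rewrite addn0 big_geq // subrr.
rewrite addnS big_nat_recr /=; last by rewrite ltnS leq_addr.
apply: le_trans (lerD IH (lexx _)) _.
set m := (n + k)%N; have m0 : 0 < m%:R :> R by rewrite ltr0n /m addn_gt0 n0.
have m1 : 0 < m.+1%:R :> R by rewrite ltr0n.
rewrite -addrA lerD2l addrC -lerBrDr opprK addrC.
have -> : m%:R^-1 - m.+1%:R^-1 = (m%:R * m.+1%:R)^-1 :> R.
  rewrite -[m.+1%:R]natr1; move: (m%:R) m0 => a a0.
  by field; rewrite !lt0r_neq0 //; lra.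
rewrite lef_pV2 ?posrE ?exprn_gt0 ?mulr_gt0 // expr2 ler_pM2r //.
by rewrite ler_nat.
Qed.

Lemma sqsum_nd : {homo sqsum : n m / (n <= m)%N >-> n <= m}.
Proof.
move=> n m nm; rewrite /sqsum (@big_cat_nat _ _ _ n.+1 1 m.+1) //= lerDl.
by apply: sumr_ge0 => g _; rewrite invr_ge0 exprn_ge0.
Qed.

Lemma sqsum_cat n m : (n <= m)%N ->
  sqsum m = sqsum n + \sum_(n.+1 <= g < m.+1) (g%:R ^+ 2)^-1.
Proof. by move=> nm; rewrite /sqsum (@big_cat_nat _ _ _ n.+1 1 m.+1). Qed.

Lemma sqsum_le n m : (0 < n)%N -> sqsum m <= sqsum n + n%:R^-1.
Proof.
move=> n0; have [nm|mn] := leqP n m; last first.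
  apply: le_trans (sqsum_nd (ltnW mn)) _.
  by rewrite lerDl invr_ge0.
rewrite (sqsum_cat nm) lerD2l -(subnKC nm).
apply: le_trans (sqsum_tail _ n0) _.
by rewrite gerBl invr_ge0.
Qed.

Lemma sqsum_cvg : cvgn sqsum.
Proof.
apply: nondecreasing_is_cvgn; first exact: sqsum_nd.
by exists (sqsum 1 + 1%:R^-1) => _ [m _ <-]; apply: sqsum_le.
Qed.

Lemma zeta2E : zeta (2 : R) = limn sqsum.
Proof. by rewrite /zeta series_riemann2. Qed.

Lemma sqsum_le_zeta n : sqsum n <= zeta 2.
Proof. by rewrite zeta2E; apply: nondecreasing_cvgn_le; [exact: sqsum_nd|exact: sqsum_cvg]. Qed.

Lemma zeta_le_sqsum n : (0 < n)%N -> zeta 2 <= sqsum n + n%:R^-1.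
Proof.
move=> n0; rewrite zeta2E; apply: limr_le; first exact: sqsum_cvg.
by apply: nearW => m; apply: sqsum_le.
Qed.

Lemma zeta2_ge1 : 1 <= zeta (2 : R).
Proof. by apply: le_trans (sqsum_le_zeta 1); rewrite /sqsum big_nat1 expr1n invr1. Qed.

Lemma zeta2_gt0 : 0 < zeta (2 : R).
Proof. exact: lt_le_trans zeta2_ge1. Qed.

(** The tail is cut at n = 2, giving 1 + 1/4 + 1/2. The contraction of the totient remainder uses it
    as zeta(2) - 1 <= 3/4. *)
Lemma zeta2_le : zeta (2 : R) <= 7 / 4.
Proof.
apply: le_trans (zeta_le_sqsum (n := 2) isT) _.
rewrite /sqsum big_nat_recr //= big_nat1; lra.
Qed.

End Harmonic.

(** Both sides sum F d over the pairs of positive integers (g, d) with g d <= n. *)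
Lemma sum_divisors_hyperbola (F : nat -> nat) n :
  (\sum_(1 <= x < n.+1) \sum_(1 <= d < n.+1 | d %| x) F d =
   \sum_(1 <= g < n.+1) \sum_(1 <= d < (n %/ g).+1) F d)%N.
Proof.
have dvE x d : (0 < x)%N -> (x <= n)%N -> (0 < d)%N ->
    (\sum_(1 <= g < n.+1) (x == g * d) = (d %| x))%N.
  move=> x0 xn d0; case: (boolP (d %| x)%N) => [/dvdnP[q xE]|nd]; last first.
    by rewrite big1 // => g _; case: eqP => // xE; rewrite xE dvdn_mull in nd.
  have q0 : (0 < q)%N by case: q xE x0 => // ->.
  have qn : (q <= n)%N by apply: leq_trans xn; rewrite xE leq_pmulr.
  rewrite (bigD1_seq q) ?iota_uniq ?mem_index_iota ?q0 //= xE eqxx big1 ?addn0 // => g gq.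
  by rewrite eqn_pmul2r // eq_sym (negPf gq).
transitivity (\sum_(1 <= x < n.+1) \sum_(1 <= d < n.+1) \sum_(1 <= g < n.+1)
   (x == g * d) * F d)%N.
  rewrite big_seq [RHS]big_seq; apply: eq_bigr => x.
  rewrite mem_index_iota ltnS => /andP[x0 xn].
  rewrite big_mkcond big_seq [RHS]big_seq; apply: eq_bigr => d.
  rewrite mem_index_iota => /andP[d0 _].
  by rewrite -big_distrl /= dvE //; case: (d %| x)%N; rewrite ?mul1n.
rewrite exchange_big /=; under eq_bigr do rewrite exchange_big /=.
rewrite exchange_big /= big_seq [RHS]big_seq; apply: eq_bigr => g.
rewrite mem_index_iota ltnS => /andP[g0 gn].
have ngn : ((n %/ g).+1 <= n.+1)%N by rewrite ltnS leq_div.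
rewrite (@big_cat_nat _ _ _ (n %/ g).+1) //= [X in (_ + X)%N]big1_seq ?addn0; last first.
  move=> d /andP[_]; rewrite mem_index_iota => /andP[dg dn].
  rewrite big1_seq // => x /andP[_]; rewrite mem_index_iota ltnS => /andP[_ xn].
  case: eqP => // xE; move: xn; rewrite xE mulnC -leq_divRL // leqNgt.
  by rewrite dg.
rewrite big_seq [RHS]big_seq; apply: eq_bigr => d.
rewrite mem_index_iota ltnS => /andP[d0 dg].
rewrite (bigD1_seq (g * d)%N) ?iota_uniq ?mem_index_iota //=; last first.
  by rewrite muln_gt0 g0 d0 ltnS mulnC -leq_divRL.
by rewrite eqxx mul1n big1 ?addn0 // => x /negPf ->.
Qed.

Definition totient_sum (n : nat) : nat := (\sum_(1 <= x < n.+1) totient x)%N.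

(** Gauss's identity summed over x <= n. It determines the summatory function of phi recursively and
    takes the place of Moebius inversion. *)
Lemma totient_sum_hyperbola n :
  (\sum_(1 <= g < n.+1) totient_sum (n %/ g) = \sum_(1 <= x < n.+1) x)%N.
Proof.
rewrite -(sum_divisors_hyperbola totient) big_seq [RHS]big_seq; apply: eq_bigr => x.
rewrite mem_index_iota ltnS => /andP[x0 xn].
rewrite -{2}(cyclic.sum_totient_dvd x).
rewrite -(big_mkord (fun d => d %| x)%N totient) /= [RHS]big_ltn_cond //.
rewrite dvd0n eqn0Ngt x0 /= (@big_cat_nat _ _ _ x.+1 1 n.+1) //=.
rewrite [X in (_ + X)%N]big1_seq ?addn0 // => d /andP[dx]; rewrite mem_index_iota.
by move=> /andP[xd _]; move: (dvdn_leq x0 dx); rewrite leqNgt xd.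
Qed.

Lemma tau_sum_hyperbola n :
  (\sum_(1 <= x < n.+1) tau x = \sum_(1 <= g < n.+1) n %/ g)%N.
Proof.
transitivity (\sum_(1 <= x < n.+1) \sum_(1 <= d < n.+1 | d %| x) 1)%N.
  rewrite big_seq [RHS]big_seq; apply: eq_bigr => x.
  rewrite mem_index_iota ltnS => /andP[x0 xn].
  rewrite tau_count // [RHS]big_mkcond (@big_cat_nat _ _ _ x.+1 1 n.+1) //=.
  rewrite [X in (_ = _ + X)%N]big1_seq ?addn0.
    by apply: eq_bigr => d _; case: (d %| x)%N.
  move=> d /andP[_]; rewrite mem_index_iota => /andP[xd _].
  by rewrite gtnNdvd.
rewrite (sum_divisors_hyperbola (fun=> 1%N)); apply: eq_bigr => g _.
by rewrite sum_nat_const_nat muln1 subn1.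
Qed.

Section TotientSum.
Variable R : realType.
Notation Z := (zeta (2 : R)).

Lemma tau_sum_le n : (\sum_(1 <= x < n.+1) tau x)%N%:R <= n%:R * harm R n.
Proof.
rewrite tau_sum_hyperbola natr_sum /harm mulr_sumr.
rewrite big_seq [leRHS]big_seq; apply: ler_sum => g.
rewrite mem_index_iota => /andP[g0 _].
by rewrite ler_pdivlMr ?ltr0n // -natrM ler_nat leq_trunc_div.
Qed.

Let r (n : nat) : R := (totient_sum n)%:R - n%:R ^+ 2 / (2 * Z).

Lemma totient_sum_le n : (totient_sum n <= n ^ 2)%N.
Proof.
rewrite -mulnn -[X in (_ <= X * _)%N](subn1 n.+1) -sum_nat_const_nat /totient_sum.
rewrite big_seq [leqRHS]big_seq; apply: leq_sum => x.
rewrite mem_index_iota ltnS => /andP[x0 xn]; apply: leq_trans xn.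
rewrite totient_count_coprime -[leqRHS]subn0 -[leqRHS]muln1 -sum_nat_const_nat.
by apply: leq_sum => d _; case: coprime.
Qed.

Lemma totient_rem_trivial n : `|r n| <= n%:R ^+ 2.
Proof.
have z1 := zeta2_ge1 R.
have a : (totient_sum n)%:R <= n%:R ^+ 2 :> R by rewrite -natrX ler_nat totient_sum_le.
have b : 0 <= n%:R ^+ 2 / (2 * Z) <= n%:R ^+ 2.
  rewrite divr_ge0 ?exprn_ge0 //=; last lra.
  rewrite ler_pdivrMr; last lra.
  by rewrite -[leLHS]mulr1 ler_wpM2l ?exprn_ge0 //; lra.
have c : 0 <= (totient_sum n)%:R :> R by [].
rewrite /r ler_norml; lra.
Qed.

(** If q is the floor of y = n / g then y^2 - q^2 <= 2 y; the last n is n^2 times the bound 1 / n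
    for the tail of the zeta series. *)
Lemma sum_floor_sq_le n : (0 < n)%N ->
  n%:R ^+ 2 * Z - (\sum_(1 <= g < n.+1) (n %/ g) ^ 2)%N%:R <=
  2 * n%:R * harm R n + n%:R.
Proof.
move=> n0; have np : 0 < n%:R :> R by rewrite ltr0n.
have zs := ler_wpM2l (exprn_ge0 2 (ltW np)) (zeta_le_sqsum R n0).
have : n%:R ^+ 2 * sqsum R n - (\sum_(1 <= g < n.+1) (n %/ g) ^ 2)%N%:R <=
   2 * n%:R * harm R n.
  rewrite /sqsum /harm natr_sum !mulr_sumr -sumrB big_seq [leRHS]big_seq.
  apply: ler_sum => g; rewrite mem_index_iota => /andP[g0 _].
  have gp : 0 < g%:R :> R by rewrite ltr0n.
  set q := (n %/ g)%N; rewrite natrX.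
  have q1 : q%:R <= n%:R / g%:R :> R by rewrite ler_pdivlMr // -natrM ler_nat leq_trunc_div.
  have q2 : n%:R / g%:R <= q%:R + 1 :> R.
    by rewrite ler_pdivrMr // natr1 -natrM ler_nat ltnW // ltn_ceil.
  have q0 : 0 <= q%:R :> R by [].
  rewrite -exprVn -exprMn -mulrA; move: (n%:R / g%:R) q1 q2 => y; nra.
rewrite mulrDr in zs.
have : n%:R ^+ 2 * n%:R^-1 = n%:R :> R by field; rewrite lt0r_neq0.
by move: zs; lra.
Qed.

(** The totals n (n + 1) / 2 and n^2 zeta(2) / (2 zeta(2)) agree to first order; there remain n / 2
    and the rounding error of the squared floors. *)
Lemma totient_rem_sum_le n : (0 < n)%N ->
  `|\sum_(1 <= g < n.+1) r (n %/ g)| <= 2 * n%:R * harm R n.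
Proof.
move=> n0; have np : 0 < n%:R :> R by rewrite ltr0n.
have z1 := zeta2_ge1 R.
have h1 : 1 <= harm R n.
  by rewrite /harm big_ltn // invr1 lerDl sumr_ge0.
have nh : n%:R <= n%:R * harm R n by rewrite -[leLHS]mulr1 ler_wpM2l // ltW.
rewrite /r sumrB -mulr_suml -natr_sum totient_sum_hyperbola.
have -> : (\sum_(1 <= x < n.+1) x)%N%:R = (n%:R ^+ 2 + n%:R) / 2 :> R.
  elim: (n) => [|m IH]; first by rewrite big_geq // expr0n /= add0r mul0r.
  rewrite big_nat_recr //= natrD IH -[m.+1%:R]natr1; by field.
have -> : \sum_(1 <= g < n.+1) (n %/ g)%:R ^+ 2 =
    (\sum_(1 <= g < n.+1) (n %/ g) ^ 2)%N%:R :> R.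
  by rewrite natr_sum; apply: eq_bigr => g _; rewrite natrX.
have lo := sum_floor_sq_le n0.
have up : (\sum_(1 <= g < n.+1) (n %/ g) ^ 2)%N%:R <= n%:R ^+ 2 * Z.
  apply: (@le_trans _ _ (n%:R ^+ 2 * sqsum R n)); last first.
    by rewrite ler_wpM2l ?exprn_ge0 // sqsum_le_zeta.
  rewrite natr_sum /sqsum mulr_sumr big_seq [leRHS]big_seq; apply: ler_sum => g.
  rewrite mem_index_iota => /andP[g0 _].
  rewrite -exprVn -exprMn natrX ler_pXn2r ?nnegrE ?divr_ge0 //.
  by rewrite ler_pdivlMr ?ltr0n // -natrM ler_nat leq_trunc_div.
move: ((\sum_(1 <= g < n.+1) (n %/ g) ^ 2)%N%:R : R) lo up => S lo up.
have -> : (n%:R ^+ 2 + n%:R) / 2 - S / (2 * Z) =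
    n%:R / 2 + (n%:R ^+ 2 * Z - S) / (2 * Z).
  by field; rewrite lt0r_neq0 //; lra.
have d0 : 0 <= (n%:R ^+ 2 * Z - S) / (2 * Z) by rewrite divr_ge0; lra.
have d1 : (n%:R ^+ 2 * Z - S) / (2 * Z) <= (n%:R ^+ 2 * Z - S) / 2.
  by rewrite ler_wpM2l ?lef_pV2 ?posrE; lra.
rewrite ger0_norm; last by apply: addr_ge0 => //; lra.
move: nh; rewrite -mulrA in lo *; lra.
Qed.

(* The remainder satisfies [r n = - \sum_(2 <= g) r (n / g) + o(n ^ 2)], and
   [zeta 2 - 1 < 9 / 10], so any bound [r n = O(c n ^ 2)] improves itself. *)
Lemma totient_rem_contract c : 0 < c ->
  (exists N, forall n, (N <= n)%N -> `|r n| <= c * n%:R ^+ 2) ->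
  exists N, forall n, (N <= n)%N -> `|r n| <= 9 / 10 * c * n%:R ^+ 2.
Proof.
(* The new constant is 3/4 from zeta(2) - 1, plus 2/40 from the harmonic sum, plus 1/10 from the g
   with n / g < N. *)
move=> c0 [N HN]; have [N1 HN1] := harm_small (R := R) (divr_gt0 c0 (ltr0n R 40)).
pose N2 := (Num.bound ((N%:R ^+ 2) * (10 / c) : R)).+1.
exists (maxn N1 N2) => n; rewrite geq_max => /andP[n1 n2].
have n0 : (0 < n)%N by apply: leq_trans n2.
have np : 0 < n%:R :> R by rewrite ltr0n.
have z2 := zeta2_le R.
have h1 := HN1 n n1.
have h2 : (N%:R ^+ 2) * (10 / c) <= n%:R :> R.
  apply/ltW/(@lt_le_trans _ _ (Num.bound ((N%:R ^+ 2) * (10 / c) : R))%:R).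
    by apply: archi_boundP; rewrite mulr_ge0 ?exprn_ge0 ?divr_ge0 // ltW.
  by rewrite ler_nat ltnW.
have h3 : N%:R ^+ 2 <= c / 10 * n%:R.
  by move: h2; rewrite mulrA ler_pdivrMr //; lra.
have := totient_rem_sum_le n0; rewrite big_ltn // divn1.
set S := \sum_(2 <= g < n.+1) _ => rS.
have Sle : `|S| <= c * n%:R ^+ 2 * (3 / 4) + n%:R * N%:R ^+ 2.
  apply: (@le_trans _ _ (\sum_(2 <= g < n.+1)
     (c * n%:R ^+ 2 * (g%:R ^+ 2)^-1 + N%:R ^+ 2))).
    apply: le_trans (ler_norm_sum _ _ _) _.
    rewrite big_seq [leRHS]big_seq; apply: ler_sum => g.
    rewrite mem_index_iota => /andP[g0 _].
    have gp : 0 < g%:R :> R by rewrite ltr0n (ltn_trans _ g0).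
    have [big|small] := leqP N (n %/ g).
      apply: le_trans (HN _ big) _; rewrite -[leLHS]addr0 lerD ?exprn_ge0 //.
      rewrite -mulrA ler_wpM2l ?(ltW c0) //.
      rewrite -exprVn -exprMn ler_pXn2r ?nnegrE ?divr_ge0 //.
      by rewrite ler_pdivlMr // -natrM ler_nat leq_trunc_div.
    apply: le_trans (totient_rem_trivial _) _; rewrite -[leLHS]add0r lerD //.
      by rewrite !mulr_ge0 ?invr_ge0 ?exprn_ge0 ?ltW.
    by rewrite ler_pXn2r ?nnegrE // ler_nat ltnW.
  rewrite big_split /= -mulr_sumr lerD //.
    rewrite ler_wpM2l ?mulr_ge0 ?exprn_ge0 ?(ltW c0) //.
    have := sqsum_le_zeta R n; rewrite /sqsum big_ltn // expr1n invr1; lra.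
  rewrite big_const_nat iter_addr_0 -[leLHS]mulr_natl ler_wpM2r ?exprn_ge0 // ler_nat.
  by rewrite leq_subLR; lia.
have rn : `|r n| <= 2 * n%:R * harm R n + `|S|.
  have := ler_normB (r n + S) S; rewrite addrK; lra.
have h1' : n%:R * harm R n <= c / 40 * n%:R ^+ 2.
  have -> : c / 40 * n%:R ^+ 2 = n%:R * (c / 40 * n%:R) by ring.
  by rewrite ler_pM2l.
have h3' : n%:R * N%:R ^+ 2 <= c / 10 * n%:R ^+ 2.
  have -> : c / 10 * n%:R ^+ 2 = n%:R * (c / 10 * n%:R) by ring.
  by rewrite ler_pM2l.
rewrite -mulrA in rn; move: (n%:R ^+ 2) h1' h3' Sle rn => n2' h1' h3' Sle rn.
have -> : 9 / 10 * c * n2' = c * n2' * (9 / 10) by field.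
have e1 : c / 40 * n2' = c * n2' / 40 by field.
have e2 : c / 10 * n2' = c * n2' / 10 by field.
rewrite e1 in h1'; rewrite e2 in h3'; lra.
Qed.

(** The contraction is iterated from the trivial remainder bound n^2; the number of iterations
    depends on e only. *)
Lemma totient_sum_asymp e : 0 < e ->
  exists N, forall n, (N <= n)%N ->
    `|(totient_sum n)%:R - n%:R ^+ 2 / (2 * Z)| <= e * n%:R ^+ 2.
Proof.
move=> e0.
have pw k : exists N, forall n, (N <= n)%N -> `|r n| <= (9 / 10) ^+ k * n%:R ^+ 2.
  elim: k => [|k IH].
    by exists 0 => n _; rewrite expr0 mul1r totient_rem_trivial.
  have [|N HN] := totient_rem_contract _ IH; first by rewrite exprn_gt0.
  by exists N => n Nn; rewrite exprS HN.
have [k ek] : exists k, (9 / 10) ^+ k <= e :> R.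
  have cv : (fun k => (9 / 10 : R) ^+ k) @ \oo --> (0 : R).
    by apply: cvg_expr; rewrite ger0_norm; lra.
  have /cvgrPdist_le /(_ e e0) [k _ Hk] := cv.
  by exists k; have := Hk k (leqnn k); rewrite /= sub0r normrN ger0_norm.
have [N HN] := pw k; exists N => n Nn; apply: le_trans (HN n Nn) _.
by rewrite ler_wpM2r ?exprn_ge0.
Qed.

(* Moduli with too many divisors are negligible: if [tau x ^ 4 >= x / C] on a
   large part of [1, Q], then [\sum tau] would exceed [Q * harm Q]. *)
Lemma many_divisors_rare (C : nat) (e : R) : 0 < e ->
  exists N, forall Q, (N <= Q)%N ->
    (\sum_(1 <= x < Q.+1 | (x < C * tau x ^ 4)%N) x)%N%:R <= e * Q%:R ^+ 2.
Proof.
(* A bad x > e Q / 2 has tau(x)^4 >= c Q >= (c s^2)^4, while tau is at most 9 s on average. The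
   successor of C keeps the quotient meaningful for C = 0. *)
move=> e0; pose c : R := Num.min 1 (e / (2 * C.+1%:R)).
have C1 : 0 < C.+1%:R :> R by rewrite ltr0n.
have c0 : 0 < c by rewrite lt_min ltr01 divr_gt0 // mulr_gt0.
have c1 : c <= 1 by rewrite ge_min lexx.
have cC : c * (2 * C.+1%:R) <= e.
  by rewrite -ler_pdivlMr ?mulr_gt0 // ge_min lexx orbT.
have [N HN] := root8_large (18 / (c * e)).
exists N.+1 => Q NQ; have Q0 : (0 < Q)%N by apply: leq_trans NQ.
have Qp : 0 < Q%:R :> R by rewrite ltr0n.
have [s s1 Qs] := root8_nat R Q0; have Bs := HN Q s (ltnW NQ) s1 Qs.
have s0 : 0 < s by apply: lt_le_trans s1.
have cs0 : 0 < c * s ^+ 2 by rewrite mulr_gt0 ?exprn_gt0.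
have pointwise x : (0 < x <= Q)%N -> (x < C * tau x ^ 4)%N ->
    x%:R <= e / 2 * Q%:R + Q%:R / (c * s ^+ 2) * (tau x)%:R :> R.
  move=> /andP[x0 xQ] bad.
  have t0 : 0 <= Q%:R / (c * s ^+ 2) * (tau x)%:R :> R.
    by rewrite mulr_ge0 // divr_ge0 // ltW.
  have [small|large] := leP (x%:R : R) (e / 2 * Q%:R); first lra.
  suff tl : c * s ^+ 2 <= (tau x)%:R.
    apply: (@le_trans _ _ (Q%:R : R)); first by rewrite ler_nat.
    apply: (@le_trans _ _ (Q%:R / (c * s ^+ 2) * (tau x)%:R)); last first.
      by rewrite lerDr mulr_ge0 ?ltW // divr_gt0.
    by rewrite mulrAC -mulrA ler_peMr ?(ltW Qp) // ler_pdivlMr // mul1r.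
  rewrite -(@ler_pXn2r _ 4) ?nnegrE ?(ltW cs0) // exprMn -exprM.
  rewrite [(2 * 4)%N]/= -Qs.
  have c4 : c ^+ 4 <= c by rewrite -[leRHS]expr1 ler_wiXn2l // ltW.
  apply: (@le_trans _ _ (c * Q%:R)); first by rewrite ler_wpM2r.
  have badR : x%:R <= C.+1%:R * (tau x)%:R ^+ 4 :> R.
    rewrite -natrX -natrM ler_nat; apply: leq_trans (ltnW bad) _.
    by rewrite leq_mul2r leqnSn orbT.
  have h0 : c * (2 * C.+1%:R) * Q%:R <= e * Q%:R by rewrite ler_wpM2r.
  rewrite -(ler_pM2l C1); move: badR large h0.
  move: (C.+1%:R : R) ((tau x)%:R ^+ 4) (Q%:R : R) (x%:R : R) => C' t q y h1 h2 h3.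
  have -> : C' * (c * q) = c * (2 * C') * q / 2 by field.
  have h2' : e * q / 2 < y by move: h2; have -> : e / 2 * q = e * q / 2 by field.
  lra.
rewrite natr_sum.
apply: (@le_trans _ _ (\sum_(1 <= x < Q.+1)
   (e / 2 * Q%:R + Q%:R / (c * s ^+ 2) * (tau x)%:R))).
  rewrite big_mkcond big_seq [leRHS]big_seq; apply: ler_sum => x.
  rewrite mem_index_iota ltnS => xQ; case: ifP => [bad|_]; first exact: pointwise.
  by rewrite addr_ge0 // mulr_ge0 // divr_ge0 // ltW.
rewrite big_split /=.
have -> : \sum_(1 <= x < Q.+1) e / 2 * Q%:R = Q%:R ^+ 2 * (e / 2) :> R.
  by rewrite big_const_nat iter_addr_0 subn1 -mulr_natr expr2 /=; ring.
rewrite -mulr_sumr -natr_sum.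
have t1 := tau_sum_le Q; have t2 := harm_le_root Q0 s1 Qs.
have t3 : (\sum_(1 <= x < Q.+1) tau x)%N%:R <= Q%:R * (9 * s).
  by apply: le_trans t1 _; rewrite ler_pM2l.
have f0 : 0 <= Q%:R / (c * s ^+ 2) by rewrite divr_ge0 // ltW.
have t4 := ler_wpM2l f0 t3.
have e1 : Q%:R / (c * s ^+ 2) * (Q%:R * (9 * s)) = Q%:R ^+ 2 * (9 / (c * s)).
  by field; rewrite !lt0r_neq0.
have e2 : 9 / (c * s) <= e / 2.
  move: Bs; rewrite ler_pdivrMr ?mulr_gt0 // ler_pdivrMr ?mulr_gt0 //.
  have -> : s * (c * e) = e * (c * s) by ring.
  have -> : e / 2 * (c * s) = e * (c * s) / 2 by field.
  lra.
have t5 : Q%:R ^+ 2 * (9 / (c * s)) <= Q%:R ^+ 2 * (e / 2) :> R.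
  by rewrite ler_wpM2l ?exprn_ge0.
rewrite e1 in t4; move: t4 t5; move: (Q%:R ^+ 2 : R) => q2.
have -> : q2 * (e / 2) = e * q2 / 2 by field.
lra.
Qed.

End TotientSum.

(** * Abel summation against phi *)

Section WeightedSums.
Variable R : realType.
Notation Z := (zeta (2 : R)).

Definition lipschitz_on (a b : R) (f : R -> R) (B : R) :=
  forall u v, a <= u <= b -> a <= v <= b -> `|f u| <= B /\ `|f u - f v| <= B * `|u - v|.

Lemma abel_sum_le (e h : nat -> R) (E B D : R) m n :
  (m < n)%N -> 0 <= B -> 0 <= D ->
  (forall x, (m <= x <= n)%N -> `|e x| <= E) ->
  (forall x, (m < x <= n)%N -> `|h x| <= B) ->
  (forall x, (m < x < n)%N -> `|h x.+1 - h x| <= D) ->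
  `|\sum_(m.+1 <= x < n.+1) (e x - e x.-1) * h x| <= E * (2 * B + D * (n - m)%:R).
Proof.
move=> mn B0 D0 eE hB hD.
have E0 : 0 <= E by apply: le_trans (normr_ge0 _) (eE m _); rewrite leqnn ltnW.
(* Moving the boundary term e n h n to the left lets the induction on n close. *)
suff main : `|\sum_(m.+1 <= x < n.+1) (e x - e x.-1) * h x - e n * h n| <=
    E * (B + D * (n - m.+1)%:R).
  have hn : `|e n * h n| <= E * B.
    by rewrite normrM; apply: ler_pM => //; [apply: eE|apply: hB]; rewrite leqnn ?andbT // ltnW.
  have := ler_normD (\sum_(m.+1 <= x < n.+1) (e x - e x.-1) * h x - e n * h n) (e n * h n).
  rewrite subrK => tri; apply: le_trans tri _.
  apply: le_trans (lerD main hn) _; rewrite -mulrDr ler_wpM2l //.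
  have nm : (n - m.+1)%:R <= (n - m)%:R :> R by rewrite ler_nat leq_sub2l.
  have := ler_wpM2l D0 nm; lra.
elim: n mn eE hB hD => // n IH; rewrite ltnS leq_eqVlt => /orP[/eqP <-|mn] eE hB hD.
  rewrite big_nat1 subnn mulr0 addr0 /= mulrBl addrAC subrr add0r normrN normrM.
  by apply: ler_pM => //; [apply: eE|apply: hB]; rewrite ?leqnn ?leqnSn.
rewrite big_nat_recr /=; last by rewrite ltnS ltnW.
have -> : forall S, S + (e n.+1 - e n) * h n.+1 - e n.+1 * h n.+1 =
   (S - e n * h n) - e n * (h n.+1 - h n) by move=> S; ring.
apply: le_trans (ler_normB _ _) _.
have le1 : `|e n * (h n.+1 - h n)| <= E * D.
  by rewrite normrM; apply: ler_pM => //; [apply: eE|apply: hD];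
    rewrite ?leqnSn ?ltnSn andbT // ltnW.
have {}IH := IH mn _ _ _.
apply: le_trans (lerD (IH _ _ _) le1) _.
- by move=> x /andP[mx xn]; rewrite eE // mx leqW.
- by move=> x /andP[mx xn]; rewrite hB // mx leqW.
- by move=> x /andP[mx xn]; rewrite hD // mx leqW.
rewrite subSn //.
rewrite -[(_.+1)%:R]natr1; lra.
Qed.

(** Mean value theorem for F(w) - h(v) w^2 / 2, whose derivative w (h(w) - h(v)) is at most B (v -
    u) on [u, v]. The weight w reflects that the sum of phi grows like x^2. *)
Lemma antiderivative_step (a b B : R) (h F : R -> R) u v :
  0 <= a -> b <= 1 -> 0 <= B -> lipschitz_on a b h B ->
  (forall w, a <= w <= b -> is_derive w 1 F (w * h w)) ->
  a <= u -> u <= v -> v <= b ->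
  `|F v - F u - h v * (v ^+ 2 - u ^+ 2) / 2| <= B * (v - u) ^+ 2.
Proof.
move=> a0 b1 B0 hB dF au uv vb.
pose G w := F w - h v / 2 * w ^+ 2.
have dG w : a <= w <= b -> is_derive w 1 G (w * (h w - h v)).
  move=> wab; have dFw := dF w wab.
  rewrite /G; apply: is_derive_eq.
  by rewrite -![_ *: _]/(_ * _); field.
have [c] : exists2 c, c \in `[u, v] & G v - G u = (c * (h c - h v)) * (v - u).
  apply: (@MVT_segment R G (fun w => w * (h w - h v))) => //.
    move=> w; rewrite in_itv /= => /andP[uw wv]; apply: dG; lra.
  apply: derivable_within_continuous => w; rewrite in_itv /= => /andP[uw wv].
  have wab : a <= w <= b by lra.
  by have := dG w wab; case.
rewrite in_itv /= => /andP[uc cv] GE.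
have -> : F v - F u - h v * (v ^+ 2 - u ^+ 2) / 2 = G v - G u by rewrite /G; field.
have cab : a <= c <= b by lra.
have vab : a <= v <= b by lra.
have [_ hcv] := hB c v cab vab.
rewrite GE !normrM (ger0_norm (_ : 0 <= v - u)); last lra.
rewrite (ger0_norm (_ : 0 <= c)); last lra.
rewrite expr2 mulrA ler_wpM2r //; first lra.
apply: (@le_trans _ _ (1 * `|h c - h v|)).
  by rewrite ler_wpM2r //; lra.
rewrite mul1r; apply: le_trans hcv _; rewrite ler_wpM2l //.
rewrite ler0_norm; lra.
Qed.

Lemma antiderivative_lipschitz (a b B : R) (h F : R -> R) u v :
  0 <= a -> b <= 1 -> 0 <= B -> lipschitz_on a b h B ->
  (forall w, a <= w <= b -> is_derive w 1 F (w * h w)) ->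
  a <= u -> u <= v -> v <= b -> `|F v - F u| <= 2 * B * (v - u).
Proof.
move=> a0 b1 B0 hB dF au uv vb.
have st := antiderivative_step a0 b1 B0 hB dF au uv vb.
have vab : a <= v <= b by lra.
have [hv _] := hB v v vab vab.
have := ler_normD (F v - F u - h v * (v ^+ 2 - u ^+ 2) / 2) (h v * (v ^+ 2 - u ^+ 2) / 2).
rewrite subrK => tri; apply: le_trans tri _.
apply: le_trans (lerD st (lexx _)) _.
have d0 : 0 <= v ^+ 2 - u ^+ 2 by nra.
rewrite !normrM (ger0_norm d0) (@ger0_norm _ 2^-1) ?invr_ge0 //.
have h1 : `|h v| * (v ^+ 2 - u ^+ 2) <= B * (v ^+ 2 - u ^+ 2) by rewrite ler_wpM2r.
have h2 : v ^+ 2 - u ^+ 2 <= 2 * (v - u) by nra.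
have h3 : (v - u) ^+ 2 <= v - u by nra.
have h4 := ler_wpM2l B0 h2.
have h5 := ler_wpM2l B0 h3.
lra.
Qed.

(** The sum starts at m + 2 so that the left end (x - 1) / Q of every mesh interval stays in
    [a, b]. *)
Lemma riemann_stieltjes_step (a b B : R) (h F : R -> R) (Q m n : nat) :
  0 <= a -> b <= 1 -> 0 <= B -> lipschitz_on a b h B ->
  (forall w, a <= w <= b -> is_derive w 1 F (w * h w)) ->
  (0 < Q)%N -> (m < n)%N -> a <= m.+1%:R / Q%:R -> n%:R / Q%:R <= b ->
  `|\sum_(m.+2 <= x < n.+1) h (x%:R / Q%:R) *
        ((x%:R / Q%:R) ^+ 2 - (x.-1%:R / Q%:R) ^+ 2) / 2
    - (F (n%:R / Q%:R) - F (m.+1%:R / Q%:R))| <= B * (n - m.+1)%:R / Q%:R ^+ 2.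
Proof.
move=> a0 b1 B0 hB dF Q0 mn am nb.
have Qp : 0 < Q%:R :> R by rewrite ltr0n.
elim: n mn nb => // n IH; rewrite ltnS leq_eqVlt => /orP[/eqP <-|mn] nb.
  by rewrite big_geq // !subrr subnn normr0 mulr0 mul0r.
rewrite big_nat_recr //=.
have nn : n%:R / Q%:R <= n.+1%:R / Q%:R :> R.
  by rewrite ler_pM2r ?invr_gt0 // ler_nat.
have un : a <= n%:R / Q%:R.
  by apply: le_trans am _; rewrite ler_pM2r ?invr_gt0 // ler_nat.
have {}IH := IH mn (le_trans nn nb).
have st := antiderivative_step a0 b1 B0 hB dF un nn nb.
set S := \sum_(_ <= _ < _) _ in IH *.
have dec t x y z : S + t - (x - y) = (S - (z - y)) - (x - z - t) by ring.
rewrite (dec _ _ _ (F (n%:R / Q%:R))).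
apply: le_trans (ler_normB _ _) _; apply: le_trans (lerD IH st) _.
have -> : n.+1%:R / Q%:R - n%:R / Q%:R = Q%:R^-1 :> R.
  by rewrite -mulrBl -natrB ?leqnSn // subSnn mul1r.
rewrite subSn //.
by rewrite -[(_.+1)%:R]natr1 mulrDr mulr1 mulrDl exprVn.
Qed.

Lemma weighted_totient_sum (a b B : R) (h F : R -> R) :
  0 <= a -> a < b -> b <= 1 -> 0 <= B -> lipschitz_on a b h B ->
  (forall w, a <= w <= b -> is_derive w 1 F (w * h w)) ->
  forall eps, 0 < eps -> exists N, forall Q, (N <= Q)%N ->
  `|\sum_(1 <= x < Q.+1 | (a * Q%:R < x%:R) && (x%:R <= b * Q%:R))
       (totient x)%:R * h (x%:R / Q%:R)
    - Q%:R ^+ 2 * (F b - F a) / Z| <= eps * Q%:R ^+ 2.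
Proof.
move=> a0 ab b1 B0 hB dF eps eps0.
(* Summation by parts costs at most 3 B del; the extra 2 keeps the denominator positive for B = 0,
   and (3 B + 1) del = eps / 2. *)
pose del := eps / (6 * B + 2).
have del0 : 0 < del by rewrite divr_gt0 //; lra.
have [N0 HN0] := totient_sum_asymp del0.
pose e (x : nat) : R := (totient_sum x)%:R - x%:R ^+ 2 / (2 * Z).
pose bnd := Num.max (2 / (b - a)) (Num.max (N0%:R ^+ 2 / del) (12 * B / eps)) + 1.
exists (Num.bound bnd).+1 => Q NQ.
have Q0 : (0 < Q)%N by apply: leq_trans NQ.
have Qp : 0 < Q%:R :> R by rewrite ltr0n.
have Q1 : 1 <= Q%:R :> R by rewrite ler1n.
have Qb : bnd <= Q%:R.
  apply/ltW/(@lt_le_trans _ _ (Num.bound bnd)%:R); last by rewrite ler_nat ltnW.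
  by apply: archi_boundP; rewrite addr_ge0 // le_max divr_ge0 //; lra.
have [Qb1 [Qb2 Qb3]] : 2 / (b - a) <= Q%:R /\ N0%:R ^+ 2 / del <= Q%:R /\ 12 * B / eps <= Q%:R.
  have := Qb; rewrite /bnd -lerBrDr !ge_max => /and3P[q1 q2 q3]; lra.
rewrite ler_pdivrMr in Qb1; last lra.
rewrite ler_pdivrMr // in Qb2; rewrite ler_pdivrMr // in Qb3.
have aQ0 : 0 <= a * Q%:R by rewrite mulr_ge0.
have bQ0 : 0 <= b * Q%:R by rewrite mulr_ge0 //; lra.
set m := Num.Def.trunc (a * Q%:R); set n := Num.Def.trunc (b * Q%:R).
have /andP[m1 m2] : m%:R <= a * Q%:R < m.+1%:R by rewrite truncn_itv.
have /andP[n1 n2] : n%:R <= b * Q%:R < n.+1%:R by rewrite truncn_itv.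
rewrite -natr1 in m2; rewrite -natr1 in n2.
have bQ : b * Q%:R <= Q%:R by rewrite -[leRHS]mul1r ler_pM2r.
have nQ : (n <= Q)%N by rewrite -(ler_nat R); apply: le_trans bQ.
have mn : (m < n)%N by rewrite -(ltr_nat R); lra.
have -> : \sum_(1 <= x < Q.+1 | (a * Q%:R < x%:R) && (x%:R <= b * Q%:R))
     (totient x)%:R * h (x%:R / Q%:R) =
   \sum_(m.+1 <= x < n.+1) (totient x)%:R * h (x%:R / Q%:R).
  rewrite [RHS](@big_nat_widen _ _ _ m.+1 n.+1 Q.+1) //.
  rewrite [RHS](@big_nat_widenl _ _ _ m.+1 1) //.
  apply: eq_bigl => x /=; rewrite ltnS.
  by rewrite /m /n truncn_lt_nat // truncn_ge_nat // andbC.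
have inab x : (m < x <= n)%N -> a <= x%:R / Q%:R <= b.
  move=> /andP[mx xn]; rewrite ler_pdivlMr // ler_pdivrMr //.
  have : m.+1%:R <= x%:R :> R by rewrite ler_nat.
  have : x%:R <= n%:R :> R by rewrite ler_nat.
  by rewrite -natr1; lra.
pose H (x : nat) := h (x%:R / Q%:R).
pose T (x : nat) := H x * ((x%:R / Q%:R) ^+ 2 - (x.-1%:R / Q%:R) ^+ 2) / 2.
(* phi(x) is the increment of e plus (x^2 - (x - 1)^2) / (2 zeta(2)): the first part is summed by
   parts, the second is a Riemann sum for w h(w) dw. *)
have -> : \sum_(m.+1 <= x < n.+1) (totient x)%:R * h (x%:R / Q%:R) =
    \sum_(m.+1 <= x < n.+1) (e x - e x.-1) * H x +
    Q%:R ^+ 2 / Z * \sum_(m.+1 <= x < n.+1) T x.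
  rewrite mulr_sumr -big_split /= big_seq [RHS]big_seq; apply: eq_bigr => x.
  rewrite mem_index_iota => /andP[mx _]; have x0 : (0 < x)%N by apply: leq_trans mx.
  case: x x0 {mx} => // x _; rewrite /T /H /e /=.
  have -> : (totient_sum x.+1)%:R = (totient_sum x)%:R + (totient x.+1)%:R :> R.
    by rewrite /totient_sum big_nat_recr //= natrD.
  by field; rewrite !lt0r_neq0 // zeta2_gt0.
have E1 : `|\sum_(m.+1 <= x < n.+1) (e x - e x.-1) * H x| <=
    (del * Q%:R ^+ 2) * (2 * B + B / Q%:R * (n - m)%:R).
  apply: abel_sum_le => //; first by rewrite divr_ge0.
  - move=> x /andP[_ xn]; have xQ : (x <= Q)%N by apply: leq_trans xn nQ.
    have xQR : x%:R <= Q%:R :> R by rewrite ler_nat.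
    have [large|small] := leqP N0 x.
      apply: le_trans (HN0 x large) _.
      by rewrite ler_pM2l // ler_pXn2r ?nnegrE.
    apply: le_trans (totient_rem_trivial R x) _.
    apply: (@le_trans _ _ (N0%:R ^+ 2)).
      by rewrite ler_pXn2r ?nnegrE // ler_nat ltnW.
    apply: le_trans Qb2 _; rewrite mulrC ler_pM2l // expr2.
    by rewrite -[leLHS]mul1r ler_pM2r.
  - by move=> x mxn; have [] := hB _ _ (inab x mxn) (inab x mxn).
  move=> x /andP[mx xn].
  have x1 : (m < x.+1 <= n)%N by rewrite ltnW.
  have x2 : (m < x <= n)%N by rewrite mx ltnW.
  have [_ le1] := hB _ _ (inab _ x1) (inab _ x2); apply: le_trans le1 _.
  rewrite -mulrBl -natrB ?leqnSn // subSnn mul1r.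
  by rewrite ger0_norm ?invr_ge0.
have ma : a <= m.+1%:R / Q%:R by rewrite ler_pdivlMr // -natr1 ltW.
have nb : n%:R / Q%:R <= b by rewrite ler_pdivrMr.
have mnQ : m.+1%:R / Q%:R <= n%:R / Q%:R :> R by rewrite ler_pM2r ?invr_gt0 // ler_nat.
(* B / Q for the first term, B / Q for the mesh, and 2 B / Q for each of the two end pieces. *)
have E2 : `|\sum_(m.+1 <= x < n.+1) T x - (F b - F a)| <= 6 * B / Q%:R.
  rewrite big_ltn //.
  have s1 := riemann_stieltjes_step a0 b1 B0 hB dF Q0 mn ma nb.
  have s2 := antiderivative_lipschitz a0 b1 B0 hB dF (lexx a) ma (le_trans mnQ nb).
  have s3 := antiderivative_lipschitz a0 b1 B0 hB dF (le_trans ma mnQ) nb (lexx b).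
  have s4 : `|T m.+1| <= B / Q%:R.
    have [h1 _] := hB _ _ (inab m.+1 (introT andP (conj (ltnSn m) mn)))
                     (inab m.+1 (introT andP (conj (ltnSn m) mn))).
    have -> : T m.+1 = H m.+1 * ((2 * m%:R + 1) / 2 / Q%:R / Q%:R).
      by rewrite /T /= -natr1; field; rewrite lt0r_neq0.
    have c0 : 0 <= (2 * m%:R + 1) / 2 / Q%:R / Q%:R :> R.
      by rewrite !divr_ge0 // addr_ge0 // mulr_ge0.
    rewrite normrM (ger0_norm c0); apply: ler_pM => //.
    rewrite -[leRHS]mul1r ler_pM2r ?invr_gt0 // ler_pdivrMr //.
    have : m.+1%:R <= Q%:R :> R by rewrite ler_nat (leq_trans mn).
    by rewrite -natr1; lra.
  have s1' : B * (n - m.+1)%:R / Q%:R ^+ 2 <= B / Q%:R.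
    rewrite -mulrA ler_wpM2l // expr2 invfM mulrA.
    rewrite -[leRHS]mul1r ler_pM2r ?invr_gt0 // ler_pdivrMr // mul1r ler_nat.
    by apply: leq_trans (leq_subr _ _) nQ.
  have s2' : m.+1%:R / Q%:R - a <= Q%:R^-1.
    by rewrite lerBlDr ler_pdivrMr // mulrDl mulVf ?lt0r_neq0 // -natr1; move: m1; clear; lra.
  have s3' : b - n%:R / Q%:R <= Q%:R^-1.
    have eQ : Q%:R^-1 + n%:R / Q%:R = (n%:R + 1) / Q%:R :> R by ring.
    by rewrite lerBlDr eQ ler_pdivlMr // ltW.
  have s2'' := ler_wpM2l (mulr_ge0 (ler0n R 2) B0) s2'.
  have s3'' := ler_wpM2l (mulr_ge0 (ler0n R 2) B0) s3'.
  move: s1 s2 s3 s4 s1' s2'' s3''; rewrite !ler_norml.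
  by move: (\sum_(_ <= _ < _) _) => S; clear; lra.
have Zp := zeta2_gt0 R; have Z1 := zeta2_ge1 R.
have -> : forall u v : R, u + Q%:R ^+ 2 / Z * v - Q%:R ^+ 2 * (F b - F a) / Z =
   u + Q%:R ^+ 2 / Z * (v - (F b - F a)).
  by move=> u v; field; rewrite lt0r_neq0.
apply: le_trans (ler_normD _ _) _; rewrite normrM ger0_norm ?divr_ge0 ?exprn_ge0 ?(ltW Zp) //.
have E1' : (del * Q%:R ^+ 2) * (2 * B + B / Q%:R * (n - m)%:R) <= eps / 2 * Q%:R ^+ 2.
  have c1 : B / Q%:R * (n - m)%:R <= B.
    rewrite -mulrA ler_piMr // mulrC ler_pdivrMr // mul1r ler_nat.
    by apply: leq_trans (leq_subr _ _) nQ.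
  rewrite mulrAC ler_wpM2r ?exprn_ge0 //.
  apply: (@le_trans _ _ (del * (3 * B + 1))); first by rewrite ler_pM2l //; move: c1; clear; lra.
  rewrite /del; have -> // : eps / (6 * B + 2) * (3 * B + 1) = eps / 2.
  by field; move: B0; clear; lra.
have E2' : Q%:R ^+ 2 / Z * `|\sum_(m.+1 <= x < n.+1) T x - (F b - F a)| <= eps / 2 * Q%:R ^+ 2.
  apply: (@le_trans _ _ (Q%:R ^+ 2 * (6 * B / Q%:R))).
    apply: ler_pM => //; first by rewrite divr_ge0 ?exprn_ge0 // ltW.
    by rewrite ler_pdivrMr // ler_peMr ?exprn_ge0.
  have -> : Q%:R ^+ 2 * (6 * B / Q%:R) = 12 * B * Q%:R / 2.
    by field; rewrite lt0r_neq0.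
  by have := ler_wpM2r (ltW Qp) Qb3; rewrite expr2; clear; lra.
by apply: le_trans (lerD (le_trans E1 E1') E2') _; clear; lra.
Qed.

End WeightedSums.

(** * Counting hyperbola points in trapezoids *)

Section LipschitzClosure.
Variables (R : realType) (a b : R).

Definition is_lipschitz_on (f : R -> R) := exists2 B, 0 <= B & lipschitz_on a b f B.

Lemma is_lipschitz_on_cst c : is_lipschitz_on (fun=> c).
Proof.
exists `|c| => // u v _ _; split => //.
by rewrite subrr normr0 mulr_ge0.
Qed.

Lemma is_lipschitz_onD f g : is_lipschitz_on f -> is_lipschitz_on g ->
  is_lipschitz_on (fun w => f w + g w).
Proof.
move=> [B B0 fB] [C C0 gC]; exists (B + C); first exact: addr_ge0.
move=> u v uab vab; have [f1 f2] := fB u v uab vab; have [g1 g2] := gC u v uab vab.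
split; first exact: le_trans (ler_normD _ _) (lerD f1 g1).
rewrite mulrDl.
have -> : f u + g u - (f v + g v) = (f u - f v) + (g u - g v) by ring.
exact: le_trans (ler_normD _ _) (lerD f2 g2).
Qed.

Lemma is_lipschitz_onM f g : is_lipschitz_on f -> is_lipschitz_on g ->
  is_lipschitz_on (fun w => f w * g w).
Proof.
move=> [B B0 fB] [C C0 gC]; exists (2 * B * C); first by rewrite !mulr_ge0.
move=> u v uab vab; have [f1 f2] := fB u v uab vab; have [g1 g2] := gC u v uab vab.
have [fv _] := fB v v vab vab.
have BC : 0 <= B * C by rewrite mulr_ge0.
split.
  rewrite normrM; apply: (@le_trans _ _ (B * C)); first exact: ler_pM.
  lra.
have -> : f u * g u - f v * g v = (f u - f v) * g u + f v * (g u - g v) by ring.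
apply: le_trans (ler_normD _ _) _; rewrite !normrM.
have e1 : `|f u - f v| * `|g u| <= (B * `|u - v|) * C by apply: ler_pM.
have e2 : `|f v| * `|g u - g v| <= B * (C * `|u - v|) by apply: ler_pM.
apply: le_trans (lerD e1 e2) _.
by have -> : B * `|u - v| * C + B * (C * `|u - v|) = 2 * B * C * `|u - v| by ring.
Qed.

Lemma is_lipschitz_on_id : is_lipschitz_on id.
Proof.
exists (`|a| + `|b| + 1); first by rewrite !addr_ge0.
move=> u v /andP[au ub] vab; have na := normr_ge0 a; have nb := normr_ge0 b.
split; last first.
  by rewrite -[leLHS]mul1r ler_wpM2r // lerDr addr_ge0.
have := ler_norm b; have := ler_norm (- a); rewrite normrN ler_norml; lra.
Qed.

Lemma is_lipschitz_on_inv : 0 < a -> is_lipschitz_on (fun w => w^-1).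
Proof.
move=> a0; exists (a^-1 + a ^- 2); first by rewrite addr_ge0 ?invr_ge0 ?exprn_ge0 ?ltW.
have i0 : 0 <= a^-1 by rewrite invr_ge0 ltW.
have i2 : 0 <= a ^- 2 by rewrite invr_ge0 exprn_ge0 // ltW.
move=> u v /andP[au _] /andP[av _].
have u0 : 0 < u by apply: lt_le_trans au.
have v0 : 0 < v by apply: lt_le_trans av.
split.
  rewrite ger0_norm ?invr_ge0 ?(ltW u0) //.
  by apply: (@le_trans _ _ a^-1); [rewrite lef_pV2 ?posrE|rewrite lerDl].
have -> : u^-1 - v^-1 = (u * v)^-1 * (v - u) by field; rewrite !lt0r_neq0.
have uv0 : 0 < u * v by rewrite mulr_gt0.
rewrite normrM ger0_norm ?invr_ge0 ?(ltW uv0) // distrC ler_wpM2r //.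
apply: (@le_trans _ _ (a ^- 2)); last by rewrite lerDr.
by rewrite lef_pV2 ?posrE ?exprn_gt0 // expr2 ler_pM // ltW.
Qed.

End LipschitzClosure.

Section Area.
Variable R : realType.

Definition posp (z : R) : R := Num.max z 0.

(* [tri z] is the area of the triangle [u, v >= 0, u + v <= z]. *)
Definition tri (z : R) : R := posp z ^+ 2 / 2.

(* By inclusion and exclusion, [area X S T] is the area of the region
   [0 <= u <= T, 0 <= v <= X, u + v <= S]. *)
Definition area (X S T : R) : R := tri S - tri (S - T) - tri (S - X) + tri (S - X - T).

Lemma posp_ge0 z : 0 <= posp z.
Proof. by rewrite /posp le_max lexx orbT. Qed.

Lemma pospE z : 0 <= z -> posp z = z.
Proof. by rewrite /posp; case: ltgtP. Qed.

Lemma pospN z : z <= 0 -> posp z = 0.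
Proof. by rewrite /posp; case: ltgtP. Qed.

Lemma posp_lip u v : `|posp u - posp v| <= `|u - v|.
Proof.
rewrite /posp; case: (leP u 0) => u0; case: (leP v 0) => v0 //.
- by rewrite subrr normr0.
- by rewrite sub0r normrN gtr0_norm // ler0_norm; lra.
by rewrite subr0 gtr0_norm // ger0_norm; lra.
Qed.

(** [tri] is an antiderivative of [posp], which varies by at most 1 over a unit step. *)
Lemma tri_step t : `|posp t - (tri t - tri (t - 1))| <= 1.
Proof.
rewrite /tri /posp; case: (leP t 0) => t0; case: (leP (t - 1) 0) => t1;
  rewrite ler_norml; nra.
Qed.

Lemma tri_lip B u v : 0 <= B -> u <= B -> v <= B -> `|tri u - tri v| <= B * `|u - v|.
Proof.
move=> B0 uB vB.
have -> : tri u - tri v = (posp u + posp v) / 2 * (posp u - posp v) by rewrite /tri; field.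
have pu : posp u <= B by rewrite /posp ge_max uB.
have pv : posp v <= B by rewrite /posp ge_max vB.
have pu0 := posp_ge0 u; have pv0 := posp_ge0 v.
rewrite normrM ger0_norm; last lra.
by apply: ler_pM; rewrite ?posp_lip //; lra.
Qed.

Lemma area_lip B X S T T' : 0 <= B -> S <= B -> 0 <= X -> 0 <= T -> 0 <= T' ->
  `|area X S T - area X S T'| <= 2 * B * `|T - T'|.
Proof.
move=> B0 SB X0 T0 T'0.
have -> : area X S T - area X S T' =
   (tri (S - X - T) - tri (S - X - T')) - (tri (S - T) - tri (S - T')).
  by rewrite /area; ring.
apply: le_trans (ler_normB _ _) _.
have e1 : `|tri (S - X - T) - tri (S - X - T')| <= B * `|S - X - T - (S - X - T')|.
  by apply: tri_lip => //; lra.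
have e2 : `|tri (S - T) - tri (S - T')| <= B * `|S - T - (S - T')|.
  by apply: tri_lip => //; lra.
apply: le_trans (lerD e1 e2) _.
have -> : S - X - T - (S - X - T') = - (T - T') by ring.
have -> : S - T - (S - T') = - (T - T') by ring.
rewrite normrN; lra.
Qed.

Lemma tri_scale c t : 0 < c -> tri (c * t) = c ^+ 2 * tri t.
Proof.
move=> c0; rewrite /tri /posp.
have -> : Num.max (c * t) 0 = c * Num.max t 0 by rewrite maxr_pMr ?ltW // mulr0.
by field.
Qed.

Lemma area_scale c X S T : 0 < c -> area (c * X) (c * S) (c * T) = c ^+ 2 * area X S T.
Proof.
move=> c0; rewrite /area -!mulrBr !tri_scale //; ring.
Qed.

Lemma area0 X S : area X S 0 = 0.
Proof. by rewrite /area !subr0; ring. Qed.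

(** Here x is the modulus. The bound n on y encodes the short-gap condition x (x - y) >= t; with n =
    x > 1 only the trace condition remains. *)
Definition trapezoid (x n Q : nat) : nat -> nat -> bool :=
  fun y v => (y < n)%N && (x + y + v <= Q)%N.

Lemma trapezoid_down x n Q : down_closed (trapezoid x n Q).
Proof.
move=> a a' c c' ac ac' /andP[h1 h2]; rewrite /trapezoid (leq_ltn_trans ac h1) /=.
by apply: leq_trans h2; rewrite -!addnA leq_add2l leq_add.
Qed.

Lemma sum_ltn_minn x k : (\sum_(c < x) (c < k) = minn k x)%N.
Proof.
elim: x => [|x IH]; first by rewrite big_ord0 minn0.
rewrite big_ord_recr IH; have [xk|kx] := ltnP x k.
  by rewrite (minn_idPr xk) /= addn1.
by rewrite (minn_idPl (leqW kx)) /= addn0.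
Qed.

Lemma row_count x c Q :
  `|(minn (Q.+1 - (x + c)) x)%:R - (posp (Q%:R - x%:R - c%:R) - posp (Q%:R - x%:R - x%:R - c%:R))|
    <= 1 :> R.
Proof.
have [Qxc|xcQ] := ltnP Q (x + c).
  have -> : (Q.+1 - (x + c) = 0)%N by lia.
  have h : Q%:R <= x%:R + c%:R :> R by rewrite -natrD ler_nat ltnW.
  have x0 : 0 <= x%:R :> R by [].
  by rewrite min0n !pospN ?subrr ?normr0 //; lra.
have h : x%:R + c%:R <= Q%:R :> R by rewrite -natrD ler_nat.
rewrite pospE; last lra.
have e : (Q.+1 - (x + c))%:R = Q%:R + 1 - (x%:R + c%:R) :> R.
  by rewrite natrB ?(leqW xcQ) // natrD -natr1.
have [h1|h1] := leqP (Q.+1 - (x + c)) x.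
  have h2 : Q%:R + 1 - (x%:R + c%:R) <= x%:R :> R by rewrite -e ler_nat.
  rewrite e pospN; last lra.
  rewrite ler_norml; lra.
have h2 : x%:R + 1 <= Q%:R + 1 - (x%:R + c%:R) :> R by rewrite -e natr1 ler_nat.
rewrite pospE; last lra.
rewrite ler_norml; lra.
Qed.

(** Each row costs one unit for its lattice count and one for each of the two [tri] differences. *)
Lemma box_trapezoid x n Q : (n <= x)%N ->
  `|(box x (trapezoid x n Q))%:R - area x%:R (Q%:R - x%:R) n%:R| <= 3 * n%:R :> R.
Proof.
move=> nx.
have -> : box x (trapezoid x n Q) = (\sum_(c < n) minn (Q.+1 - (x + c)) x)%N.
  rewrite /box -(big_mkord predT (fun c => \sum_(c' < x) trapezoid x n Q c c')%N).
  rewrite (@big_cat_nat _ _ _ n) //= [X in (_ + X)%N]big1_seq ?addn0; last first.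
    move=> c /andP[_]; rewrite mem_index_iota => /andP[nc _].
    by rewrite big1 // => c' _; rewrite /trapezoid ltnNge nc.
  rewrite big_mkord; apply: eq_bigr => c _; rewrite -sum_ltn_minn.
  by apply: eq_bigr => c' _; rewrite /trapezoid ltn_ord /=; congr nat_of_bool; lia.
elim: n {nx} => [|n IH].
  by rewrite big_ord0 area0 subrr normr0 mulr0.
rewrite big_ord_recr /= natrD.
have r := row_count x n Q.
have t1 := tri_step (Q%:R - x%:R - n%:R).
have t2 := tri_step (Q%:R - x%:R - x%:R - n%:R).
move: IH r t1 t2; rewrite /area -[n.+1%:R]natr1 !opprD !addrA.
move: ((minn _ _)%:R) ((\sum_(_ < _) _)%N%:R) => m S.
move: (posp _) (posp _) (tri _) (tri _) (tri _) (tri _) (tri _) (tri _).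
move=> p q A1 A2 A3 A4 A5 A6; rewrite !ler_norml; lra.
Qed.

End Area.

(** * Hyperbola points summed over the moduli *)

Section HyperbolaSums.
Variable R : realType.
Notation Z := (zeta (2 : R)).

(** Proportion of the residue square filled by the region at scale w = b / Q. Its sides are u <= w -
    kappa / w, from b (b - y) >= kappa Q^2, then v <= w and w + u + v <= 1. The positive part makes
    it vanish for w^2 <= kappa; kappa = 0 is the case of N(Q). *)
Definition density (kappa w : R) : R :=
  area w (1 - w) (posp (w - kappa / w)) / w ^+ 2.

Lemma hyp_le x D : (0 < x)%N -> (hyp x D <= totient x)%N.
Proof.
case: x => [|[|x]] // _.
  by rewrite /hyp !big_nat1 (leq_trans (leq_b1 _)).
rewrite hyp_hypZ -card_units_Zx /card_units -sum1_card.
by apply: leq_sum => y _; apply: leq_b1.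
Qed.

Lemma box_le x D : (box x D <= x ^ 2)%N.
Proof.
apply: (@leq_trans (\sum_(c < x) \sum_(c' < x) 1)%N).
  by apply: leq_sum => c _; apply: leq_sum => c' _; apply: leq_b1.
by rewrite !sum_nat_const !card_ord muln1 mulnn.
Qed.

Lemma totient_le x : (totient x <= x)%N.
Proof.
rewrite totient_count_coprime -[leqRHS]subn0 -[leqRHS]muln1 -sum_nat_const_nat.
by apply: leq_sum => d _; apply: leq_b1.
Qed.

(** Q < 3 x bounds 1 / w by 3. The 15 is 3 times 5, with 3 for the lattice rows and 2 for rounding
    the threshold to n; the 18 is 2 times 3^2. The second parameter kappa' later absorbs the error
    in N(Q). *)
Lemma box_density (kappa kappa' : R) (x n Q : nat) :
  (0 < x)%N -> (x <= Q)%N -> (Q < 3 * x)%N -> (n <= x)%N ->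
  `|n%:R - posp (x%:R - kappa' * Q%:R ^+ 2 / x%:R)| <= 1 ->
  `|(totient x * box x (trapezoid x n Q))%:R / x%:R ^+ 2
     - (totient x)%:R * density kappa (x%:R / Q%:R)|
   <= 15 + 18 * Q%:R * `|kappa' - kappa|.
Proof.
move=> x0 xQ Q3x nx nT.
have xp : 0 < x%:R :> R by rewrite ltr0n.
have Qp : 0 < Q%:R :> R by rewrite ltr0n (leq_trans x0).
have xQR : x%:R <= Q%:R :> R by rewrite ler_nat.
have nxR : n%:R <= x%:R :> R by rewrite ler_nat.
have Q3R : Q%:R <= 3 * x%:R :> R by rewrite -natrM ler_nat ltnW.
set w := x%:R / Q%:R; have wp : 0 < w by rewrite divr_gt0.
have w1 : w <= 1 by rewrite ler_pdivrMr // mul1r.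
pose th k := posp (w - k / w).
have TE : posp (x%:R - kappa' * Q%:R ^+ 2 / x%:R) = Q%:R * th kappa'.
  have -> : x%:R - kappa' * Q%:R ^+ 2 / x%:R = Q%:R * (w - kappa' / w).
    by rewrite /w; field; rewrite !lt0r_neq0.
  by rewrite /th /posp maxr_pMr ?ltW // mulr0.
have b1 := box_trapezoid R Q nx.
have b2 : `|area x%:R (Q%:R - x%:R) n%:R - area x%:R (Q%:R - x%:R) (Q%:R * th kappa')|
    <= 2 * Q%:R * 1.
  apply: le_trans (area_lip (ltW Qp) _ (ltW xp) _ _) _ => //.
  - by rewrite gerBl ltW.
  - by rewrite mulr_ge0 ?posp_ge0 // ltW.
  by rewrite ler_wpM2l // -TE.
have b3 : area x%:R (Q%:R - x%:R) (Q%:R * th kappa') =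
    Q%:R ^+ 2 * area w (1 - w) (th kappa').
  have xE : x%:R = Q%:R * w by rewrite /w mulrCA divff ?mulr1 // lt0r_neq0.
  by rewrite -area_scale // mulrBr mulr1 -xE.
have b4 : `|area w (1 - w) (th kappa') - area w (1 - w) (th kappa)| <=
    2 * 1 * (`|kappa' - kappa| / w).
  apply: le_trans (area_lip ler01 _ (ltW wp) (posp_ge0 _) (posp_ge0 _)) _.
    by rewrite gerBl ltW.
  rewrite ler_wpM2l ?mulr_ge0 //; apply: le_trans (posp_lip _ _) _.
  have -> : w - kappa' / w - (w - kappa / w) = - ((kappa' - kappa) / w).
    by field; rewrite lt0r_neq0.
  by rewrite normrN normrM (ger0_norm (_ : 0 <= w^-1)) // invr_ge0 ltW.
have tx : (totient x)%:R <= x%:R :> R by rewrite ler_nat totient_le.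
have dE : (totient x)%:R * density kappa w =
    (totient x)%:R * (Q%:R ^+ 2 * area w (1 - w) (th kappa)) / x%:R ^+ 2.
  by rewrite /density -/(th kappa) /w; field; rewrite !lt0r_neq0.
rewrite dE natrM -mulrBl -mulrBr !normrM.
rewrite (ger0_norm (_ : 0 <= (totient x)%:R)) //.
rewrite (ger0_norm (_ : 0 <= (x%:R ^+ 2)^-1)) ?invr_ge0 ?exprn_ge0 //.
set V := (box _ _)%:R - _.
have VE : `|V| <= 5 * Q%:R + Q%:R ^+ 2 * (2 * (`|kappa' - kappa| / w)).
  have -> : V = ((box x (trapezoid x n Q))%:R - area x%:R (Q%:R - x%:R) n%:R) +
    ((area x%:R (Q%:R - x%:R) n%:R - area x%:R (Q%:R - x%:R) (Q%:R * th kappa')) +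
     Q%:R ^+ 2 * (area w (1 - w) (th kappa') - area w (1 - w) (th kappa))).
    by rewrite /V b3; ring.
  apply: le_trans (ler_normD _ _) _.
  apply: (@le_trans _ _ (3 * Q%:R + (2 * Q%:R * 1 + Q%:R ^+ 2 * (2 * (`|kappa' - kappa| / w))))).
    apply: lerD; first by apply: le_trans b1 _; lra.
    apply: le_trans (ler_normD _ _) _; apply: lerD => //.
    rewrite normrM ger0_norm ?exprn_ge0 // ler_wpM2l ?exprn_ge0 //.
    by apply: le_trans b4 _; rewrite mulr1.
  lra.
apply: (@le_trans _ _ (x%:R * `|V| * (x%:R ^+ 2)^-1)).
  by rewrite ler_wpM2r ?invr_ge0 ?exprn_ge0 // ler_wpM2r.
rewrite ler_pdivrMr ?exprn_gt0 // [x%:R ^+ 2]expr2 mulrCA ler_pM2l //.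
apply: le_trans VE _.
have -> : Q%:R ^+ 2 * (2 * (`|kappa' - kappa| / w)) =
    2 * Q%:R ^+ 3 * `|kappa' - kappa| / x%:R.
  by rewrite /w; field; rewrite !lt0r_neq0.
have k0 := normr_ge0 (kappa' - kappa); move: (`|kappa' - kappa|) k0 => k k0.
have -> : (15 + 18 * Q%:R * k) * x%:R = 15 * x%:R + 18 * Q%:R * k * x%:R by ring.
apply: lerD; first lra.
rewrite ler_pdivrMr //.
have e1 : Q%:R ^+ 2 <= (3 * x%:R) ^+ 2 :> R.
  by rewrite ler_pXn2r ?nnegrE ?mulr_ge0 ?(ltW Qp) ?(ltW xp).
have e2 := ler_wpM2l (mulr_ge0 (mulr_ge0 (ler0n R 2) (ltW Qp)) k0) e1.
have -> : 2 * Q%:R ^+ 3 * k = 2 * Q%:R * k * Q%:R ^+ 2 by ring.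
by apply: le_trans e2 _; rewrite le_eqVlt; apply/orP; left; apply/eqP; ring.
Qed.

(** One third of eps goes to equidistribution through 12 / K, one to the moduli with many divisors,
    each bounded by x, and one to [box_density]. N is independent of kappa' and n, so the threshold
    may vary with Q. *)
Lemma hyp_sum_asymp (kappa eps : R) : 0 < eps ->
  exists N, forall Q, (N <= Q)%N -> forall (kappa' : R) (n : nat -> nat),
  (forall x, (0 < x <= Q)%N -> (Q < 3 * x)%N ->
     (n x <= x)%N /\ `|(n x)%:R - posp (x%:R - kappa' * Q%:R ^+ 2 / x%:R)| <= 1) ->
  `|\sum_(1 <= x < Q.+1 | (Q < 3 * x)%N) (hyp x (trapezoid x (n x) Q))%:R
    - \sum_(1 <= x < Q.+1 | (Q < 3 * x)%N) (totient x)%:R * density kappa (x%:R / Q%:R)|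
  <= (eps + 18 * `|kappa' - kappa|) * Q%:R ^+ 2.
Proof.
move=> eps0; have eps3 : 0 < eps / 3 by rewrite divr_gt0.
pose K := (Num.bound (36 / eps)).+2.
have K1 : (1 < K)%N by [].
have Kp : 0 < K%:R :> R by rewrite ltr0n.
have KE : 12 / K%:R <= eps / 3.
  rewrite ler_pdivrMr //.
  have : 36 / eps < K%:R.
    apply: lt_le_trans (archi_boundP _) _; first by rewrite divr_ge0 // ltW.
    by rewrite ler_nat /K; lia.
  rewrite ltr_pdivrMr //; lra.
pose C := (2 * K ^ 15)%N.
have [N1 HN1] := many_divisors_rare C eps3.
exists (maxn N1 (Num.bound (45 / eps)).+1) => Q; rewrite geq_max => /andP[QN1 QN2] kappa' n hn.
have Q0 : (0 < Q)%N by apply: leq_trans QN2.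
have Qp : 0 < Q%:R :> R by rewrite ltr0n.
have QE : 15 <= eps / 3 * Q%:R.
  have : 45 / eps < Q%:R.
    apply: lt_le_trans (archi_boundP _) _; first by rewrite divr_ge0 // ltW.
    by rewrite ler_nat ltnW.
  rewrite ltr_pdivrMr //; lra.
pose bad x := (x < C * tau x ^ 4)%N.
have pointwise x : (0 < x <= Q)%N -> (Q < 3 * x)%N ->
    `|(hyp x (trapezoid x (n x) Q))%:R - (totient x)%:R * density kappa (x%:R / Q%:R)| <=
    eps / 3 * Q%:R + (if bad x then x%:R else 0) + (eps / 3 * Q%:R + 18 * Q%:R * `|kappa' - kappa|).
  move=> /andP[x0 xQ] x3; have xp : 0 < x%:R :> R by rewrite ltr0n.
  have [nx nT] := hn x (introT andP (conj x0 xQ)) x3.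
  set a := (hyp _ _)%:R; set b := (totient x)%:R * _.
  pose c : R := (totient x * box x (trapezoid x (n x) Q))%:R / x%:R ^+ 2.
  have bd : `|c - b| <= eps / 3 * Q%:R + 18 * Q%:R * `|kappa' - kappa|.
    by apply: le_trans (box_density kappa x0 xQ x3 nx nT) _; rewrite lerD2r.
  have -> : a - b = (a - c) + (c - b) by ring.
  apply: le_trans (ler_normD _ _) _; apply: lerD => //.
  have [bx|nbx] := boolP (bad x).
    apply: (@le_trans _ _ x%:R); last by rewrite lerDr mulr_ge0 // ltW.
    have a1 : 0 <= a <= x%:R by rewrite /a ler0n ler_nat (leq_trans (hyp_le _ x0)) ?totient_le.
    have c1 : 0 <= c <= x%:R.
      rewrite divr_ge0 ?exprn_ge0 //= ler_pdivrMr ?exprn_gt0 // -natrX -natrM ler_nat.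
      by apply: leq_mul; [apply: totient_le|apply: box_le].
    rewrite ler_norml; lra.
  have good : (2 * K ^ 15 * tau x ^ 4 <= x)%N by rewrite leqNgt.
  have he := hyp_equidistribution R K1 good x0 (@trapezoid_down x (n x) Q).
  rewrite addr0; apply: le_trans he _.
  have xQR : x%:R <= Q%:R :> R by rewrite ler_nat.
  by rewrite mulrAC; apply: ler_pM.
rewrite -sumrB; apply: le_trans (ler_norm_sum _ _ _) _.
apply: (@le_trans _ _ (\sum_(1 <= x < Q.+1)
  (eps / 3 * Q%:R + (if bad x then x%:R else 0) + (eps / 3 * Q%:R + 18 * Q%:R * `|kappa' - kappa|)))).
  rewrite big_mkcond big_seq [leRHS]big_seq; apply: ler_sum => x.
  rewrite mem_index_iota ltnS => xQ; case: ifP => x3; first exact: pointwise.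
  have p1 : 0 <= eps / 3 * Q%:R by rewrite mulr_ge0 // ltW.
  have p2 : 0 <= 18 * Q%:R * `|kappa' - kappa| by rewrite !mulr_ge0.
  have p3 : 0 <= (if bad x then x%:R else 0 : R) by case: ifP.
  by rewrite !addr_ge0.
rewrite !big_split /= -big_mkcond /= -natr_sum.
have cst (r : R) : \sum_(1 <= x < Q.+1) r = r * Q%:R.
  by rewrite big_const_nat iter_addr_0 subn1 mulr_natr.
rewrite !cst; have := HN1 Q QN1; rewrite -/bad.
have -> : 18 * Q%:R * `|kappa' - kappa| * Q%:R = 18 * `|kappa' - kappa| * Q%:R ^+ 2 by ring.
rewrite mulrDl -!mulrA -!expr2; lra.
Qed.

End HyperbolaSums.

(** * Densities, their antiderivatives and the main term of N(Q) *)

Section MainAsymptotics.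
Variable R : realType.
Notation Z := (zeta (2 : R)).

(** The three antiderivatives of w times the density: [antider1] where the line u = w - k / w cuts
    the triangle, [antider2] where the triangle is whole, [antider3] for kappa = 0 and 1/3 < w <=
    1/2. *)
Definition antider1 (k w : R) : R :=
  w - 3 / 4 * w ^+ 2 + 2 * k * ln w + k * w^-1 + k ^+ 2 / 4 * w^-1 ^+ 2.

Definition antider2 (w : R) : R := (ln w - 2 * w + w ^+ 2 / 2) / 2.

Definition antider3 (w : R) : R := - (7 / 4) * w ^+ 2 + 3 * w - ln w / 2.

Lemma is_derive_inv (w : R) : 0 < w -> is_derive w 1 (fun u : R => u^-1) (- w ^- 2).
Proof.
move=> w0; have wn : (id w : R) != 0 by rewrite lt0r_neq0.
by apply: (is_derive_eq (is_deriveV wn (is_derive_id w 1))); rewrite -[_ *: _]/(_ * _) mulr1.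
Qed.

(** The density is spelled with sums, products and inverses only, so that the closure rules for
    Lipschitz functions apply to it term by term. *)
Lemma is_derive_antider1 (k w : R) : 0 < w ->
  is_derive w 1 (antider1 k) (w * ((w + (- k) * w^-1) * (2 + (-3) * w + k * w^-1)
     * (w^-1 * (w^-1 * 2^-1)))).
Proof.
move=> w0; have d1 := is_derive1_ln w0; have d2 := is_derive_inv w0.
rewrite /antider1; apply: is_derive_eq.
rewrite -![_ *: _]/(_ * _); field; by rewrite lt0r_neq0.
Qed.

Lemma is_derive_antider2 (w : R) : 0 < w ->
  is_derive w 1 antider2 (w * ((1 + (-1) * w) * (1 + (-1) * w) * (w^-1 * (w^-1 * 2^-1)))).
Proof.
move=> w0; have d1 := is_derive1_ln w0.
rewrite /antider2; apply: is_derive_eq.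
rewrite -![_ *: _]/(_ * _); field; by rewrite lt0r_neq0.
Qed.

Lemma is_derive_antider3 (w : R) : 0 < w ->
  is_derive w 1 antider3 (w * (- (7 / 2) + 3 * w^-1 + (- 2^-1) * (w^-1 * w^-1))).
Proof.
move=> w0; have d1 := is_derive1_ln w0.
rewrite /antider3; apply: is_derive_eq.
rewrite -![_ *: _]/(_ * _); field; by rewrite lt0r_neq0.
Qed.

Lemma density_piece (kappa a b : R) (h F : R -> R) :
  0 <= a -> a < b -> b <= 1 -> is_lipschitz_on a b h ->
  (forall w, a <= w <= b -> is_derive w 1 F (w * h w)) ->
  (forall w, a < w <= b -> density kappa w = h w) ->
  forall eps, 0 < eps -> exists N, forall Q, (N <= Q)%N ->
  `|\sum_(1 <= x < Q.+1 | (a * Q%:R < x%:R) && (x%:R <= b * Q%:R))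
       (totient x)%:R * density kappa (x%:R / Q%:R)
    - Q%:R ^+ 2 * (F b - F a) / Z| <= eps * Q%:R ^+ 2.
Proof.
move=> a0 ab b1 [B B0 hB] dF dens eps eps0.
have [N HN] := weighted_totient_sum a0 ab b1 B0 hB dF eps0.
exists N.+1 => Q NQ; have Qp : 0 < Q%:R :> R by rewrite ltr0n (leq_trans _ NQ).
rewrite (eq_bigr (fun x => (totient x)%:R * h (x%:R / Q%:R))); first exact: HN (ltnW NQ).
move=> x /andP[ax xb]; rewrite dens //.
by rewrite ltr_pdivlMr // ax ler_pdivrMr.
Qed.

Lemma split_sum (c : R) Q (P : pred nat) (f : nat -> R) :
  \sum_(1 <= x < Q.+1 | P x) f x =
  \sum_(1 <= x < Q.+1 | P x && (x%:R <= c * Q%:R)) f x +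
  \sum_(1 <= x < Q.+1 | P x && (c * Q%:R < x%:R)) f x.
Proof.
rewrite (bigID (fun x => x%:R <= c * Q%:R)) /=; congr (_ + _).
by apply: eq_bigl => x; rewrite ltNge.
Qed.

Lemma hyp_full x (D : nat -> nat -> bool) : (0 < x)%N ->
  (forall y v, (y <= x)%N -> (v <= x)%N -> D y v) -> hyp x D = totient x.
Proof.
case: x => [|[|x]] // _ full.
  by rewrite /hyp !big_nat1 full.
rewrite hyp_hypZ -card_units_Zx /card_units -sum1_card.
by apply: eq_bigr => y _; rewrite full // ltnW.
Qed.

Lemma hyp_ext x (D D' : nat -> nat -> bool) :
  (forall y v, (0 < y <= x)%N -> (0 < v <= x)%N -> y * v = 1 %[mod x] -> D y v = D' y v) ->
  hyp x D = hyp x D'.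
Proof.
move=> DD'; rewrite /hyp big_seq [RHS]big_seq; apply: eq_bigr => y.
rewrite mem_index_iota ltnS => yx; rewrite big_seq [RHS]big_seq; apply: eq_bigr => v.
rewrite mem_index_iota ltnS => vx; case: eqP => //= yv.
by rewrite (DD' y v yx vx yv).
Qed.

Definition sat_count (Q : nat) : nat :=
  (\sum_(1 <= x < Q.+1) hyp x (fun y v => x + y + v <= Q))%N.

Definition gap_count (Q : nat) (t : R) : nat :=
  (\sum_(1 <= x < Q.+1) hyp x (fun y v => (t <= (x * (x - y))%:R :> R) && (x + y + v <= Q)%N))%N.

Lemma pred_third Q x : (Q < 3 * x)%N = (3^-1 * Q%:R < x%:R :> R).
Proof. by rewrite mulrC ltr_pdivrMr // -natrM ltr_nat mulnC. Qed.

Lemma sat_count_split Q : (2 < Q)%N ->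
  (sat_count Q)%:R =
  \sum_(1 <= x < Q.+1 | ~~ (Q < 3 * x)%N) (totient x)%:R +
  \sum_(1 <= x < Q.+1 | (Q < 3 * x)%N) (hyp x (trapezoid x x Q))%:R :> R.
Proof.
move=> Q2; rewrite /sat_count natr_sum (bigID (fun x => (Q < 3 * x)%N)) /= addrC.
congr (_ + _); rewrite big_seq_cond [RHS]big_seq_cond; apply: eq_bigr => x.
  rewrite mem_index_iota -leqNgt => /andP[/andP[x0 _] x3]; congr _%:R.
  by apply: hyp_full => // y v yx vx; lia.
rewrite mem_index_iota => /andP[/andP[x0 _] x3]; congr _%:R.
apply: hyp_ext => y v /andP[y0 yx] _ yv; rewrite /trapezoid.
(* The representative y = x is 0 modulo x, hence no unit, as x > 1 here. *)
suff -> : (y < x)%N by [].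
rewrite ltn_neqAle yx andbT; apply/eqP => yE; move: yv; rewrite yE modnMr.
have x1 : (1 < x)%N by lia.
by rewrite modn_small.
Qed.

Lemma eq_range_sum Q (P P' : pred nat) (f : nat -> R) :
  (forall x, (0 < x <= Q)%N -> P x = P' x) ->
  \sum_(1 <= x < Q.+1 | P x) f x = \sum_(1 <= x < Q.+1 | P' x) f x.
Proof.
move=> PP'; rewrite big_seq_cond [RHS]big_seq_cond; apply: eq_bigl => x.
by rewrite mem_index_iota ltnS; case xQ: (0 < x <= Q)%N => //=; rewrite PP'.
Qed.

Lemma lip_density2 (a b : R) : 0 < a -> is_lipschitz_on a b
  (fun w : R => (1 + (-1) * w) * (1 + (-1) * w) * (w^-1 * (w^-1 * 2^-1))).
Proof.
move=> a0; have Li := is_lipschitz_on_inv b a0; have Lid := is_lipschitz_on_id a b.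
have L1 : is_lipschitz_on a b (fun w : R => 1 + (-1) * w).
  apply: (is_lipschitz_onD (f := fun=> 1) (g := fun w => -1 * w)); first exact: is_lipschitz_on_cst.
  by apply: (is_lipschitz_onM (f := fun=> -1) (g := id)); first exact: is_lipschitz_on_cst.
apply: (is_lipschitz_onM (is_lipschitz_onM L1 L1)).
apply: (is_lipschitz_onM Li); apply: (is_lipschitz_onM Li).
exact: is_lipschitz_on_cst.
Qed.

Lemma lip_density1 (k a b : R) : 0 < a -> is_lipschitz_on a b
  (fun w : R => (w + (- k) * w^-1) * (2 + (-3) * w + k * w^-1) * (w^-1 * (w^-1 * 2^-1))).
Proof.
move=> a0; have Li := is_lipschitz_on_inv b a0; have Lid := is_lipschitz_on_id a b.
have Lc := is_lipschitz_on_cst a b.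
have L1 := is_lipschitz_onD Lid (is_lipschitz_onM (Lc (- k)) Li).
have L2 := is_lipschitz_onD (is_lipschitz_onD (Lc 2) (is_lipschitz_onM (Lc (-3)) Lid))
   (is_lipschitz_onM (Lc k) Li).
exact: is_lipschitz_onM (is_lipschitz_onM L1 L2)
  (is_lipschitz_onM Li (is_lipschitz_onM Li (Lc 2^-1))).
Qed.

Lemma lip_density3 (a b : R) : 0 < a -> is_lipschitz_on a b
  (fun w : R => - (7 / 2) + 3 * w^-1 + (- 2^-1) * (w^-1 * w^-1)).
Proof.
move=> a0; have Li := is_lipschitz_on_inv b a0.
have Lc := is_lipschitz_on_cst a b.
exact: is_lipschitz_onD (is_lipschitz_onD (Lc (- (7 / 2))) (is_lipschitz_onM (Lc 3) Li))
  (is_lipschitz_onM (Lc (- 2^-1)) (is_lipschitz_onM Li Li)).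
Qed.

(** The square of side w with the corner beyond u + v = 1 - w cut off. *)
Lemma density0_piece3 (w : R) : 3^-1 < w <= 2^-1 ->
  density 0 w = - (7 / 2) + 3 * w^-1 + (- 2^-1) * (w^-1 * w^-1).
Proof.
move=> /andP[w1 w2]; have w0 : 0 < w by lra.
rewrite /density mul0r subr0 (pospE (ltW w0)) /area /tri.
rewrite (@pospE _ (1 - w)); last lra.
rewrite (@pospE _ (1 - w - w)); last lra.
rewrite (@pospN _ (1 - w - w - w)); last lra.
by field; rewrite lt0r_neq0.
Qed.

Lemma density_piece2 (k w : R) : 2^-1 < w <= 1 -> 0 <= posp (w - k / w) ->
  1 - w <= posp (w - k / w) ->
  density k w = (1 + (-1) * w) * (1 + (-1) * w) * (w^-1 * (w^-1 * 2^-1)).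
Proof.
move=> /andP[w1 w2] T0 T1; have w0 : 0 < w by lra.
rewrite /density; move: (posp (w - k / w)) T0 T1 => T T0 T1.
rewrite /area /tri.
rewrite (@pospE _ (1 - w)); last lra.
rewrite (@pospN _ (1 - w - T)); last lra.
rewrite (@pospN _ (1 - w - w)); last lra.
rewrite (@pospN _ (1 - w - w - T)); last lra.
by field; rewrite lt0r_neq0.
Qed.

(** The quadratic condition says w - k / w <= 1 - w, so the line u = w - k / w cuts the triangle.
    Equality holds at the positive root (1 + sqrt (1 + 8 k)) / 4. *)
Lemma density_piece1 (k w : R) : 2^-1 < w <= 1 -> k <= w ^+ 2 -> 2 * w ^+ 2 - w - k <= 0 ->
  density k w =
  (w + (- k) * w^-1) * (2 + (-3) * w + k * w^-1) * (w^-1 * (w^-1 * 2^-1)).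
Proof.
move=> /andP[w1 w2] kw wk; have w0 : 0 < w by lra.
have T0 : 0 <= w - k / w by rewrite subr_ge0 ler_pdivrMr // -expr2.
have T1 : w - k / w <= 1 - w.
  rewrite lerBlDr -lerBlDl -(ler_pM2r w0) [_ / _ * _]mulfVK ?lt0r_neq0 //; lra.
rewrite /density (pospE T0) /area /tri.
rewrite (@pospE _ (1 - w)); last lra.
rewrite (@pospE _ (1 - w - (w - k / w))); last lra.
rewrite (@pospN _ (1 - w - w)); last lra.
rewrite (@pospN _ (1 - w - w - (w - k / w))); last lra.
by field; rewrite lt0r_neq0.
Qed.

Lemma density_piece0 (k w : R) : 0 < w -> w ^+ 2 <= k -> density k w = 0.
Proof.
move=> w0 wk; rewrite /density pospN ?area0 ?mul0r //.
by rewrite subr_le0 ler_pdivlMr // -expr2.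
Qed.

Lemma sat_count_asymp (eps : R) : 0 < eps -> exists N, forall Q, (N <= Q)%N ->
  `|(sat_count Q)%:R - gapA R * Q%:R ^+ 2| <= eps * Q%:R ^+ 2.
Proof.
move=> eps0; have e4 : 0 < eps / 4 by rewrite divr_gt0.
have z0 := zeta2_gt0 R.
have i3 : 0 < 3^-1 :> R by rewrite invr_gt0.
have i2 : 0 < 2^-1 :> R by rewrite invr_gt0.
have i31 : 3^-1 <= 1 :> R by lra.
have i21 : 2^-1 <= 1 :> R by lra.
have i32 : 3^-1 < 2^-1 :> R by lra.
have i21' : 2^-1 < 1 :> R by lra.
have [N0 HN0] := hyp_sum_asymp 0 e4.
have lip1 : lipschitz_on 0 3^-1 (fun=> 1 : R) 1.
  by move=> u v _ _; rewrite normr1 subrr normr0 mul1r.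
have d1 (w : R) : 0 <= w <= 3^-1 -> is_derive w 1 (fun w : R => w ^+ 2 / 2) (w * 1).
  by move=> _; apply: is_derive_eq; rewrite -![_ *: _]/(_ * _); field.
have [N1 HN1] := weighted_totient_sum (lexx 0) i3 i31 ler01 lip1 d1 e4.
have d3 (w : R) : 3^-1 <= w <= 2^-1 -> is_derive w 1 antider3
    (w * (- (7 / 2) + 3 * w^-1 + (- 2^-1) * (w^-1 * w^-1))).
  by move=> /andP[w3 _]; apply: is_derive_antider3; apply: lt_le_trans w3.
have [N2 HN2] := density_piece (ltW i3) i32 i21 (lip_density3 2^-1 i3) d3 density0_piece3 e4.
have d2 (w : R) : 2^-1 <= w <= 1 -> is_derive w 1 antider2
    (w * ((1 + (-1) * w) * (1 + (-1) * w) * (w^-1 * (w^-1 * 2^-1)))).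
  by move=> /andP[w3 _]; apply: is_derive_antider2; apply: lt_le_trans w3.
have dens2 (w : R) : 2^-1 < w <= 1 -> density 0 w =
    (1 + (-1) * w) * (1 + (-1) * w) * (w^-1 * (w^-1 * 2^-1)).
  move=> w12; apply: density_piece2 => //; rewrite mul0r subr0; first exact: posp_ge0.
  by rewrite pospE; lra.
have [N3 HN3] := density_piece (ltW i2) i21' (lexx 1) (lip_density2 1 i2) d2 dens2 e4.
exists (maxn (maxn N0 N1) (maxn (maxn N2 N3) 3)) => Q.
rewrite !geq_max => /andP[/andP[Q0 Q1] /andP[/andP[Q2 Q3] Q4]].
have hn (x : nat) : (0 < x <= Q)%N -> (Q < 3 * x)%N ->
    (x <= x)%N /\ `|x%:R - posp (x%:R - 0 * Q%:R ^+ 2 / x%:R)| <= 1 :> R.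
  by move=> _ _; split=> //; rewrite !mul0r subr0 pospE // subrr normr0.
have h0 := HN0 Q Q0 0 (fun x => x) hn.
have h1 := HN1 Q Q1; have h2 := HN2 Q Q2; have h3 := HN3 Q Q3.
rewrite (sat_count_split Q4).
have S1 : \sum_(1 <= x < Q.+1 | ~~ (Q < 3 * x)%N) ((totient x)%:R : R) =
    \sum_(1 <= x < Q.+1 | (0 * Q%:R < x%:R :> R) && (x%:R <= 3^-1 * Q%:R :> R))
      ((totient x)%:R * 1).
  rewrite [RHS](eq_bigr (fun x => (totient x)%:R)); last by move=> x _; rewrite mulr1.
  apply: eq_range_sum => x /andP[x0 _].
  by rewrite pred_third -leNgt mul0r ltr0n x0.
have D0 : \sum_(1 <= x < Q.+1 | (Q < 3 * x)%N) (totient x)%:R * density (0 : R) (x%:R / Q%:R) =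
    \sum_(1 <= x < Q.+1 | (3^-1 * Q%:R < x%:R :> R) && (x%:R <= 2^-1 * Q%:R :> R))
       (totient x)%:R * density (0 : R) (x%:R / Q%:R) +
    \sum_(1 <= x < Q.+1 | (2^-1 * Q%:R < x%:R :> R) && (x%:R <= 1 * Q%:R :> R))
       ((totient x)%:R * density (0 : R) (x%:R / Q%:R)).
  rewrite (split_sum 2^-1); congr (_ + _); apply: eq_range_sum => x /andP[x0 xQ].
    by rewrite pred_third.
  rewrite pred_third mul1r ler_nat xQ andbT.
  case: (ltP (2^-1 * Q%:R : R) x%:R) => h; last by rewrite andbF.
  by rewrite andbT; apply: le_lt_trans h; rewrite ler_wpM2r // ltW.
rewrite S1; move: h0 h1 h2 h3; rewrite D0.
have l2 : ln (2^-1 : R) = - ln 2 by rewrite lnV ?posrE.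
have l3 : ln (3^-1 : R) = - ln 3 by rewrite lnV ?posrE.
have l43 : ln (4 / 3 : R) = ln 2 + ln 2 - ln 3.
  rewrite ln_div ?posrE //; congr (_ - _).
  by rewrite -lnM ?posrE //; congr ln; lra.
(* The rational parts cancel. The logarithms give (ln 2 - ln 3) / 2 on (1/3, 1/2] and ln 2 / 2 on
   (1/2, 1], in all ln(4/3) / 2. *)
have Atot : gapA R * Q%:R ^+ 2 = Q%:R ^+ 2 * (3^-1 ^+ 2 / 2 - 0 ^+ 2 / 2) / Z +
    Q%:R ^+ 2 * (antider3 2^-1 - antider3 3^-1) / Z +
    Q%:R ^+ 2 * (antider2 1 - antider2 2^-1) / Z.
  rewrite /gapA l43 /antider3 /antider2 l2 l3 ln1 expr0n /=.
  by field; rewrite lt0r_neq0.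
rewrite Atot subrr normr0 mulr0 addr0.
rewrite !ler_norml; lra.
Qed.

End MainAsymptotics.

(** * Main term of the short-gap count *)

Section GapAsymptotics.
Variable R : realType.
Notation Z := (zeta (2 : R)).

(** zeta(2) times the limit of [gap_count Q t] / Q^2 as t / Q^2 tends to k, with w0 the break
    between the cut and the whole triangle. *)
Definition gap_const (k w0 : R) : R :=
  (antider1 k w0 - antider1 k (Num.sqrt k)) + (antider2 1 - antider2 w0).

Lemma gap_count_asymp (k eps : R) : 2^-1 <= k < 1 -> 0 < eps ->
  exists N, exists2 del, 0 < del & forall Q, (N <= Q)%N -> forall t : R,
  `|t / Q%:R ^+ 2 - k| <= del ->
  `|(gap_count Q t)%:R - gap_const k ((1 + Num.sqrt (1 + 8 * k)) / 4) / Z * Q%:R ^+ 2|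
    <= eps * Q%:R ^+ 2.
Proof.
move=> /andP[k2 k1] eps0.
set r := Num.sqrt (1 + 8 * k); set w0 := (1 + r) / 4; set s := Num.sqrt k.
have r2 : r ^+ 2 = 1 + 8 * k by rewrite sqr_sqrtr //; lra.
have s2 : s ^+ 2 = k by rewrite sqr_sqrtr //; lra.
have r0 : 0 <= r by apply: sqrtr_ge0.
have s0 : 0 <= s by apply: sqrtr_ge0.
have s23 : 2 / 3 < s by nra.
have s1 : s < 1 by nra.
have w0E : 2 * w0 ^+ 2 - w0 - k = 0 by rewrite /w0; move: r2; lra.
have r3 : r < 3 by nra.
have w01 : w0 < 1 by rewrite /w0; lra.
have r1 : 2 < r by nra.
have w02 : 3 / 4 < w0 by rewrite /w0; lra.
have sw0 : s < w0 by nra.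
have i3 : 0 < 3^-1 :> R by rewrite invr_gt0.
have z0 := zeta2_gt0 R.
have e6 : 0 < eps / 6 by rewrite divr_gt0.
have [N0 HN0] := hyp_sum_asymp k e6.
have lip0 : is_lipschitz_on 3^-1 s (fun=> 0 : R) by apply: is_lipschitz_on_cst.
have d0 (w : R) : 3^-1 <= w <= s -> is_derive w 1 (fun=> 0 : R) (w * 0).
  by move=> _; apply: is_derive_eq; rewrite mulr0.
have dens0 (w : R) : 3^-1 < w <= s -> density k w = 0.
  move=> /andP[w3 ws]; apply: density_piece0; first lra.
  by rewrite -s2 ler_pXn2r ?nnegrE //; lra.
have i3s : 3^-1 < s by lra.
have [N1 HN1] := density_piece (ltW i3) i3s (ltW s1) lip0 d0 dens0 e6.
have sp : 0 < s by lra.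
have d1 (w : R) : s <= w <= w0 -> is_derive w 1 (@antider1 R k)
   (w * ((w + (- k) * w^-1) * (2 + (-3) * w + k * w^-1) * (w^-1 * (w^-1 * 2^-1)))).
  by move=> /andP[w3 _]; apply: is_derive_antider1; lra.
have dens1 (w : R) : s < w <= w0 -> density k w =
   (w + (- k) * w^-1) * (2 + (-3) * w + k * w^-1) * (w^-1 * (w^-1 * 2^-1)).
  move=> /andP[sw ww]; apply: density_piece1; first lra.
    by rewrite -s2 ler_pXn2r ?nnegrE //; lra.
  nra.
have [N2 HN2] := density_piece s0 sw0 (ltW w01) (lip_density1 k w0 sp) d1 dens1 e6.
have w0p : 0 < w0 by lra.
have d2 (w : R) : w0 <= w <= 1 -> is_derive w 1 (@antider2 R)
    (w * ((1 + (-1) * w) * (1 + (-1) * w) * (w^-1 * (w^-1 * 2^-1)))).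
  by move=> /andP[w3 _]; apply: is_derive_antider2; lra.
have dens2 (w : R) : w0 < w <= 1 -> density k w =
    (1 + (-1) * w) * (1 + (-1) * w) * (w^-1 * (w^-1 * 2^-1)).
  move=> /andP[ww w1]; have wp : 0 < w by lra.
  apply: density_piece2; first lra; first exact: posp_ge0.
  have Tw : 1 - w <= w - k / w.
    by rewrite lerBrDr -lerBrDl ler_pdivrMr //; nra.
  by apply: le_trans Tw _; rewrite /posp le_max lexx.
have [N3 HN3] := density_piece (ltW w0p) w01 (lexx 1) (lip_density2 1 w0p) d2 dens2 e6.
exists (maxn (maxn N0 N1) (maxn (maxn N2 N3) 1)).
(* 1/20 keeps t / Q^2 above 4/9, so that no modulus x <= Q / 3 has x^2 >= t; 108 is 6 times the
   factor 18 of [hyp_sum_asymp]. *)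
exists (Num.min (20^-1) (eps / 108)).
  by rewrite lt_min invr_gt0 ltr0n divr_gt0.
move=> Q; rewrite !geq_max => /andP[/andP[Q0 Q1] /andP[/andP[Q2 Q3] Q4]] t.
rewrite le_min => /andP[t1 t2].
have Qp : 0 < Q%:R :> R by rewrite ltr0n.
have Q2p : 0 < Q%:R ^+ 2 :> R by rewrite exprn_gt0.
set k' := t / Q%:R ^+ 2 in t1 t2.
have tE : t = k' * Q%:R ^+ 2 by rewrite /k' mulfVK // lt0r_neq0.
have k'9 : 4 / 9 < k' by move: t1 k2; rewrite ler_norml; clear; lra.
have tp : 0 < t by rewrite tE mulr_gt0 // (lt_trans _ k'9) // divr_gt0.
(* The number of y >= 0 with x (x - y) >= t: the successor accounts for y = 0, and the count is 0
   when t > x^2. *)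
pose n (x : nat) : nat := if t / x%:R <= x%:R then (Num.Def.trunc (x%:R - t / x%:R)).+1 else 0%N.
have nE x y : (0 < x)%N -> (y <= x)%N -> (t <= (x * (x - y))%:R) = (y < n x)%N.
  move=> x0 yx; have xp : 0 < x%:R :> R by rewrite ltr0n.
  rewrite natrM natrB // -ler_pdivrMl // mulrC lerBrDr addrC -lerBrDr /n.
  case: ifP => h; first by rewrite ltnS truncn_ge_nat // subr_ge0.
  rewrite ltn0; apply/negP => yt; move/negP: h; apply.
  by rewrite -subr_ge0; apply: le_trans yt.
have h0 : `|\sum_(1 <= x < Q.+1 | (Q < 3 * x)%N) (hyp x (trapezoid x (n x) Q))%:R
    - \sum_(1 <= x < Q.+1 | (Q < 3 * x)%N) (totient x)%:R * density k (x%:R / Q%:R)|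
  <= (eps / 6 + 18 * `|k' - k|) * Q%:R ^+ 2.
  apply: HN0 => // x /andP[x0 xQ] x3; have xp : 0 < x%:R :> R by rewrite ltr0n.
  have txp : 0 < t / x%:R by rewrite divr_gt0.
  rewrite -tE /n; case: ifP => h.
    have d : 0 <= x%:R - t / x%:R by rewrite subr_ge0.
    have /andP[f1 f2] := truncn_itv d; split.
      by rewrite truncn_lt_nat // gtrBl.
    by rewrite -natr1 in f2; rewrite (pospE d) -natr1 ler_norml; move: f1 f2; clear; lra.
  split=> //; rewrite pospN ?subrr ?normr0 //.
  by rewrite subr_le0 ltW // ltNge h.
have h1 := HN1 Q Q1; have h2 := HN2 Q Q2; have h3 := HN3 Q Q3.
have GE : (gap_count Q t)%:R =
    \sum_(1 <= x < Q.+1 | (Q < 3 * x)%N) (hyp x (trapezoid x (n x) Q))%:R :> R.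
  rewrite /gap_count natr_sum (bigID (fun x => (Q < 3 * x)%N)) /=.
  rewrite [X in _ + X]big1_seq ?addr0.
    rewrite big_seq_cond [RHS]big_seq_cond; apply: eq_bigr => x.
    rewrite mem_index_iota => /andP[/andP[x0 _] _]; congr _%:R.
    by apply: hyp_ext => y v /andP[_ yx] _ _; rewrite nE.
  move=> x; rewrite mem_index_iota -leqNgt => /andP[x3 /andP[x0 _]].
  have -> : hyp x (fun y v => (t <= (x * (x - y))%:R :> R) && (x + y + v <= Q)%N) = 0%N.
    rewrite /hyp big1 // => y _; rewrite big1 // => v _.
    suff -> : (t <= (x * (x - y))%:R) = false by rewrite andbF.
    apply/negbTE; rewrite -ltNge; apply: (@le_lt_trans _ _ (x%:R * x%:R)).
      by rewrite -natrM ler_nat leq_mul2l leq_subr orbT.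
    have x3R : 3 * x%:R <= Q%:R :> R by rewrite -natrM ler_nat.
    have hx : (3 * x%:R) ^+ 2 <= Q%:R ^+ 2 :> R by rewrite ler_pXn2r ?nnegrE ?mulr_ge0.
    have ht : 4 / 9 * Q%:R ^+ 2 < t by rewrite tE ltr_pM2r.
    by move: hx ht Q2p; rewrite exprMn !expr2; clear; lra.
  by [].
have D0 : \sum_(1 <= x < Q.+1 | (Q < 3 * x)%N) (totient x)%:R * density k (x%:R / Q%:R) =
    \sum_(1 <= x < Q.+1 | (3^-1 * Q%:R < x%:R :> R) && (x%:R <= s * Q%:R))
       (totient x)%:R * density k (x%:R / Q%:R) +
    (\sum_(1 <= x < Q.+1 | (s * Q%:R < x%:R :> R) && (x%:R <= w0 * Q%:R))
       (totient x)%:R * density k (x%:R / Q%:R) +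
    \sum_(1 <= x < Q.+1 | (w0 * Q%:R < x%:R :> R) && (x%:R <= 1 * Q%:R :> R))
       (totient x)%:R * density k (x%:R / Q%:R)).
  rewrite (split_sum s); congr (_ + _); first by apply: eq_range_sum => x _; rewrite (pred_third R).
  have sQ : 3^-1 * Q%:R <= s * Q%:R by rewrite ler_pM2r // ltW.
  have wQ : s * Q%:R <= w0 * Q%:R by rewrite ler_pM2r // ltW.
  rewrite (split_sum w0); congr (_ + _); apply: eq_range_sum => x /andP[x0 xQ].
    rewrite (pred_third R); case: (ltP (s * Q%:R) x%:R) => h; last by rewrite andbF.
    by have h' := le_lt_trans sQ h; rewrite h'.
  rewrite (pred_third R) mul1r ler_nat xQ andbT.
  case: (ltP (w0 * Q%:R) x%:R) => h; last by rewrite andbF.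
  have h1' := le_lt_trans wQ h; have h2' := le_lt_trans sQ h1'.
  by rewrite h1' h2'.
have tot : gap_const k w0 / Z * Q%:R ^+ 2 = Q%:R ^+ 2 * (0 - 0) / Z +
   (Q%:R ^+ 2 * (antider1 k w0 - antider1 k s) / Z +
    Q%:R ^+ 2 * (antider2 1 - antider2 w0) / Z).
  by rewrite /gap_const -/s; field; rewrite lt0r_neq0.
rewrite GE tot; move: h0 h1 h2 h3; rewrite D0.
have t3 : (eps / 6 + 18 * `|k' - k|) * Q%:R ^+ 2 <= (eps / 3) * Q%:R ^+ 2.
  by rewrite ler_pM2r //; move: t2; clear; lra.
have eQ : 0 < eps * Q%:R ^+ 2 by rewrite mulr_gt0.
by move=> /le_trans /(_ t3); rewrite !ler_norml; move: eQ; clear; lra.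
Qed.

End GapAsymptotics.

(** * Saturated Farey fractions and their gaps *)

Lemma det_mx2 (M : 'M[int]_2) : \det M = M 0 0 * M 1 1 - M 0 1 * M 1 0.
Proof.
have I1 : lift ord0 ord0 = 1 :> 'I_2 by apply/val_inj.
have I0 : lift (1 : 'I_2) ord0 = 0 :> 'I_2 by apply/val_inj.
rewrite (expand_det_row _ 0) !big_ord_recl big_ord0 addr0 /cofactor !det_mx11 !mxE /= I1.
by rewrite I0 expr0 mul1r expr1 mulN1r mulrN.
Qed.

Lemma card_fset_set_seq (T : choiceType) (A : set T) (s : seq T) :
  finite_set A -> uniq s -> (forall x, A x <-> x \in s) ->
  #|` fset_set A|%fset = size s.
Proof.
move=> fA us As; rewrite -(perm_size (uniq_perm (fset_uniq (fset_set A)) us _)) // => x.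
by rewrite in_fset_set //; apply/idP/idP => [/set_mem /As|/As /mem_set].
Qed.

Lemma leq_card_fset_set_seq (T : choiceType) (A : set T) (s : seq T) :
  finite_set A -> (forall x, A x -> x \in s) -> (#|` fset_set A|%fset <= size s)%N.
Proof.
move=> fA As; apply: uniq_leq_size; first exact: fset_uniq.
by move=> x; rewrite in_fset_set // => /set_mem /As.
Qed.

Lemma geq_card_fset_set_seq (T : choiceType) (A : set T) (s : seq T) :
  finite_set A -> uniq s -> (forall x, x \in s -> A x) -> (size s <= #|` fset_set A|%fset)%N.
Proof.
move=> fA us As; apply: uniq_leq_size => // x /As Ax.
by rewrite in_fset_set // mem_set.
Qed.

Definition inverse_triple (b y v : nat) : bool :=
  [&& (0 < y <= b)%N, (0 < v <= b)%N & (y * v == 1 %[mod b])%N].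

Definition sat_triple (Q b y v : nat) : bool :=
  inverse_triple b y v && (b + y + v <= Q)%N.

Definition frac (b v : nat) : rat := v%:R / b%:R.

Lemma frac_lt b v b' v' : (0 < b)%N -> (0 < b')%N ->
  (frac b v < frac b' v') = (v * b' < v' * b)%N.
Proof.
move=> b0 b'0; rewrite /frac ltr_pdivrMr ?ltr0n // mulrAC ltr_pdivlMr ?ltr0n //.
by rewrite -!natrM ltr_nat.
Qed.

(** Both fractions are reduced, so b and v agree; then y and y' invert the same residue and coincide
    in [1, b], the representative b being treated apart. *)
Lemma frac_inj b y v b' y' v' : inverse_triple b y v -> inverse_triple b' y' v' ->
  frac b v = frac b' v' -> [/\ b = b', y = y' & v = v'].
Proof.
move=> /and3P[/andP[y0 yb] /andP[v0 vb] yv] /and3P[/andP[y'0 y'b] /andP[v'0 v'b] yv'].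
have b0 : (0 < b)%N by apply: leq_trans y0 yb.
have b'0 : (0 < b')%N by apply: leq_trans y'0 y'b.
have cop c u w : (u * w == 1 %[mod c])%N -> coprime c w.
  move=> uw; have := coprime1n c; rewrite coprime_sym -coprime_modr -(eqP uw).
  by rewrite coprime_modr coprimeMr => /andP[].
have cv := cop _ _ _ yv; have cv' := cop _ _ _ yv'.
move=> /eqP; rewrite /frac eqr_div ?pnatr_eq0 -?lt0n // -!natrM eqr_nat => /eqP e.
have bb' : b = b'.
  apply/eqP; rewrite eqn_dvd; apply/andP; split.
    by rewrite -(Gauss_dvdr _ cv) e dvdn_mull.
  by rewrite -(Gauss_dvdr _ cv') -e dvdn_mull.
subst b'; have vv' : v = v' by move/eqP: e; rewrite eqn_pmul2r // => /eqP.
subst v'; split => //.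
have : (y == y' %[mod b])%N.
  have e1 : (y = y * (y' * v) %[mod b])%N.
    by rewrite -modnMmr (eqP yv') modnMmr muln1.
  have e2 : (y' = y' * (y * v) %[mod b])%N.
    by rewrite -modnMmr (eqP yv) modnMmr muln1.
  by rewrite e1 e2 mulnCA.
have [->|yb'] := eqVneq y b.
  rewrite modnn; have [->//|y'b'] := eqVneq y' b.
  rewrite modn_small; first by rewrite eq_sym -leqn0 leqNgt y'0.
  by rewrite ltn_neqAle y'b'.
have [->|y'b'] := eqVneq y' b.
  rewrite modnn modn_small; first by rewrite -leqn0 leqNgt y0.
  by rewrite ltn_neqAle yb'.
by rewrite !modn_small ?ltn_neqAle ?yb' ?y'b' // => /eqP.
Qed.

Lemma inverse_triple_dvd b y v : inverse_triple b y v -> exists c, (y * v = 1 + b * c)%N.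
Proof.
move=> /and3P[/andP[y0 _] /andP[v0 _] yv].
have yv0 : (0 < y * v)%N by rewrite muln_gt0 y0.
move: yv; rewrite eqn_mod_dvd // => /dvdnP[c e]; exists c.
by rewrite [(b * c)%N]mulnC -e subnKC.
Qed.

(** By the determinant, a is an inverse of d modulo b, and c >= d forces a > b, so a >= b + y.
    Conversely, if y v = 1 + b c, the matrix with rows (b + y, b) and (v + c, v) attains the trace b
    + y + v. *)
Lemma satFareyP Q (q : rat) :
  satFarey Q q <-> exists b y v, sat_triple Q b y v /\ q = frac b v.
Proof.
have I1 : lift ord0 ord0 = 1 :> 'I_2 by apply/val_inj.
split.
  move=> [M [[detM [ab bd d1 ac cd]] trM] <-].
  have bpos : 0 <= M 0 1 by apply: le_trans bd; apply: le_trans d1.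
  have dpos : 0 <= M 1 1 by apply: le_trans _ d1.
  have apos : 0 <= M 0 0 by apply: le_trans bpos ab.
  have cpos : 0 <= M 1 0 by apply: le_trans dpos cd.
  have trE : M 0 0 + M 1 1 <= Q%:Z.
    by move: trM; rewrite /mxtrace !big_ord_recl big_ord0 addr0 I1.
  have detE : M 0 0 * M 1 1 - M 0 1 * M 1 0 = 1.
    by move: detM; rewrite det_mx2.
  move: (M 0 0) (M 0 1) (M 1 0) (M 1 1) apos bpos cpos dpos ab bd d1 ac cd trE detE.
  move=> [a|//] [b|//] [c|//] [d|//] _ _ _ _ ab bd d1 ac cd trE detE.
  have {}detE : (a * d = 1 + b * c)%N by lia.
  have {}ab : (b <= a)%N by lia.
  have {}bd : (d <= b)%N by lia.
  have {}d1 : (0 < d)%N by lia.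
  have {}cd : (d <= c)%N by lia.
  have {}trE : (a + d <= Q)%N by lia.
  have b0 : (0 < b)%N by apply: leq_trans bd.
  have ba : (b < a)%N.
    rewrite -(ltn_pmul2r d1) detE add1n ltnS leq_mul2l cd orbT //.
  (* Dividing a - 1 yields the representative in [1, b] instead of [0, b). *)
  pose y := ((a - 1) %% b).+1.
  have aE : (a = (a - 1) %/ b * b + y)%N.
    by rewrite /y addnS -divn_eq subn1 prednK // (leq_ltn_trans _ ba).
  have q1 : (1 <= (a - 1) %/ b)%N by rewrite divn_gt0 // subn1 -ltnS prednK // (leq_ltn_trans _ ba).
  exists b, y, d; split; last by [].
  apply/andP; split; last first.
    apply: leq_trans trE; rewrite leq_add2r [leqRHS]aE leq_add2r.
    by rewrite -[leqLHS]mul1n leq_mul2r q1 orbT.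
  apply/and3P; split; [by rewrite /y /= ltn_mod|by rewrite d1|].
  have -> : (y * d = a * d %[mod b])%N.
    by rewrite [in RHS]aE mulnDl -mulnA [(b * d)%N]mulnC mulnA modnMDl.
  by rewrite detE addnC [(b * c)%N]mulnC modnMDl.
move=> [b [y [v [/andP[tr bQ] ->]]]]; have [c yv] := inverse_triple_dvd tr.
have /and3P[/andP[y0 yb] /andP[v0 vb] _] := tr.
have cy : (c < y)%N.
  have b0 : (0 < b)%N by apply: leq_trans yb.
  by rewrite -(ltn_pmul2l b0) -add1n -yv [(b * y)%N]mulnC leq_mul2l vb orbT.
pose M : 'M[int]_2 := \matrix_(i, j)
  (if (i == 0) then (if j == 0 then (b + y)%:Z else b%:Z)
   else (if j == 0 then (v + c)%:Z else v%:Z)).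
have M00 : M 0 0 = (b + y)%:Z by rewrite mxE.
have M01 : M 0 1 = b%:Z by rewrite mxE.
have M10 : M 1 0 = (v + c)%:Z by rewrite mxE.
have M11 : M 1 1 = v%:Z by rewrite mxE.
exists M; last by rewrite M11 M01.
split; last first.
  by rewrite /mxtrace !big_ord_recl big_ord0 addr0 I1 M00 M11; lia.
split; first by rewrite det_mx2 M00 M01 M10 M11; lia.
by rewrite M00 M01 M10 M11; split; lia.
Qed.

Lemma sum_restrict Q b (G : nat -> nat) : (b <= Q)%N ->
  (forall y, ~~ (0 < y <= b)%N -> G y = 0%N) ->
  (\sum_(y < Q.+1) G y = \sum_(1 <= y < b.+1) G y)%N.
Proof.
move=> bQ G0; rewrite -(big_mkord predT G) [LHS]big_ltn // G0 // add0n.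
rewrite (@big_cat_nat _ _ _ b.+1 1 Q.+1) //= [X in (_ + X)%N]big1_seq ?addn0 //.
move=> y /andP[_]; rewrite mem_index_iota => /andP[by' _].
by rewrite G0 // negb_and [(y <= b)%N]leqNgt by' orbT.
Qed.

Definition triple_index (Q : nat) : finType := ('I_Q.+1 * 'I_Q.+1 * 'I_Q.+1)%type.

Lemma card_triples Q (D : nat -> nat -> nat -> bool) :
  #|[pred T : triple_index Q | inverse_triple T.1.1 T.1.2 T.2 && D T.1.1 T.1.2 T.2]| =
  (\sum_(1 <= b < Q.+1) hyp b (D b))%N.
Proof.
pose F (b y v : nat) : nat := inverse_triple b y v && D b y v.
transitivity (\sum_(b < Q.+1) \sum_(y < Q.+1) \sum_(v < Q.+1) F b y v)%N.
  rewrite pair_bigA /= pair_bigA /= -sum1_card big_mkcond /=.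
  by apply: eq_bigr => T _; rewrite inE /F; case: (inverse_triple _ _ _ && _).
rewrite -(big_mkord predT (fun b => \sum_(y < Q.+1) \sum_(v < Q.+1) F b y v)%N).
rewrite [LHS]big_ltn // [X in (X + _)%N]big1 ?add0n => [|y _]; last first.
  by rewrite big1 // => v _; rewrite /F /inverse_triple; case: (nat_of_ord y).
rewrite big_seq [RHS]big_seq; apply: eq_bigr => b.
rewrite mem_index_iota ltnS => /andP[b0 bQ].
rewrite (@sum_restrict Q b (fun y => \sum_(v < Q.+1) F b y v)%N) //; last first.
  by move=> y nyb; rewrite big1 // => v _; rewrite /F /inverse_triple (negPf nyb).
rewrite /hyp big_seq [RHS]big_seq; apply: eq_bigr => y.
rewrite mem_index_iota ltnS => yb.
rewrite (@sum_restrict Q b (F b y)) //; last first.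
  by move=> v nvb; rewrite /F /inverse_triple (negPf nvb) /= andbF.
rewrite big_seq [RHS]big_seq; apply: eq_bigr => v.
by rewrite mem_index_iota ltnS => vb; rewrite /F /inverse_triple yb vb.
Qed.

Definition triple_frac Q (T : triple_index Q) : rat := frac T.1.1 T.2.

Lemma triple_frac_inj Q (D : pred (triple_index Q)) :
  {in [pred T : triple_index Q | inverse_triple T.1.1 T.1.2 T.2 && D T] &,
    injective (@triple_frac Q)}.
Proof.
move=> [[b y] v] [[b' y'] v'] /andP[/= t1 _] /andP[/= t2 _] /(frac_inj t1 t2)[e1 e2 e3].
by congr (_, _, _); apply: val_inj.
Qed.

Lemma sat_tripleP Q b y v : sat_triple Q b y v -> exists T : triple_index Q,
  [/\ T.1.1 = b :> nat, T.1.2 = y :> nat & T.2 = v :> nat].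
Proof.
move=> /andP[/and3P[/andP[_ yb] /andP[_ vb] _] bQ].
have bQ' : (b < Q.+1)%N.
  by rewrite ltnS; apply: leq_trans bQ; rewrite -addnA leq_addr.
by exists (Ordinal bQ', Ordinal (leq_ltn_trans yb bQ'), Ordinal (leq_ltn_trans vb bQ')).
Qed.

Lemma satCard_sat_count Q : satCard Q = sat_count Q.
Proof.
rewrite /sat_count -(card_triples Q (fun b y v => b + y + v <= Q)%N) cardE.
set P := [pred T : triple_index Q | _].
rewrite -(size_map (@triple_frac Q)); apply: card_fset_set_seq.
- exact: finite_satFarey.
- rewrite map_inj_in_uniq ?enum_uniq // => T T'; rewrite !mem_enum => PT PT'.
  exact: (@triple_frac_inj Q (fun T : triple_index Q => T.1.1 + T.1.2 + T.2 <= Q)%N).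
move=> q; rewrite satFareyP; split.
  move=> [b [y [v [tr ->]]]]; have [T [Tb Ty Tv]] := sat_tripleP tr.
  apply/mapP; exists T; last by rewrite /triple_frac Tb Tv.
  by rewrite mem_enum inE Tb Ty Tv.
move=> /mapP[T]; rewrite mem_enum => PT ->.
by exists T.1.1, T.1.2, T.2.
Qed.

Lemma inverse_triple_coprime b y v : inverse_triple b y v -> coprime b v.
Proof.
move=> /and3P[_ _ yv]; have := coprime1n b; rewrite coprime_sym -coprime_modr -(eqP yv).
by rewrite coprime_modr coprimeMr => /andP[].
Qed.

(** c = b (v' c - w b') + b' (w b - v c), and both brackets are positive. *)
Lemma between_denominator b v b' v' c w :
  (v' * b = v * b' + 1)%N -> (v * c < w * b)%N -> (w * b' < v' * c)%N ->
  (b + b' <= c)%N.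
Proof.
move=> e h1 h2.
have e1 : (v' * b * c = v * b' * c + c)%N by rewrite e mulnDl mul1n.
have h3 : (b * (w * b').+1 <= b * (v' * c))%N by rewrite leq_mul2l h2 orbT.
have h4 : (b' * (v * c).+1 <= b' * (w * b))%N by rewrite leq_mul2l h1 orbT.
move: e1 h3 h4; rewrite !mulnS.
have -> : (b * (w * b') = b' * (w * b))%N by rewrite [LHS]mulnC [RHS]mulnC mulnAC.
have -> : (v' * b * c = b * (v' * c))%N by rewrite mulnA [(b * v')%N]mulnC.
have -> : (v * b' * c = b' * (v * c))%N by rewrite mulnA [(b' * v)%N]mulnC.
move: (b * (v' * c))%N (b' * (v * c))%N (b' * (w * b))%N => X Y W.
clear; lia.
Qed.

(** * Short gaps and triples *)

Section Gaps.
Variables (R : realType) (Q : nat) (lambda : R).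
Hypothesis lambda0 : 0 < lambda.
Hypothesis N0 : (0 < satCard Q)%N.

Let t : R := (satCard Q)%:R / lambda.

Hypothesis t_large : Q%:R ^+ 2 < 4 * t.

(** By the inequality of means, b + b' <= Q would give 4 b b' <= Q^2 < 4 t. *)
Lemma large_denominators b b' : t <= (b * b')%:R -> (Q < b + b')%N.
Proof.
move=> tb; rewrite ltnNge; apply/negP => bQ.
have : (Q ^ 2 < 4 * (b * b'))%N.
  by rewrite -(ltr_nat R) natrX natrM; apply: lt_le_trans t_large _; rewrite ler_pM2l.
rewrite ltnNge => /negP; apply; apply: leq_trans (_ : (b + b') ^ 2 <= _)%N.
  exact: nat_AGM2.
by rewrite leq_sqr.
Qed.

Lemma small_frac b v b' v' d : (0 < b)%N -> (0 < b')%N -> (v' * b = v * b' + d)%N ->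
  (ratr (frac b' v' - frac b v) <= lambda / (satCard Q)%:R :> R) = (d%:R * t <= (b * b')%:R).
Proof.
move=> b0 b'0 e.
have -> : frac b' v' - frac b v = d%:R / (b * b')%:R.
  have bp : b%:R != 0 :> rat by rewrite pnatr_eq0 -lt0n.
  have b'p : b'%:R != 0 :> rat by rewrite pnatr_eq0 -lt0n.
  have e' : v'%:R * b%:R = v%:R * b'%:R + d%:R :> rat by rewrite -!natrM -natrD e.
  have -> : d%:R = v'%:R * b%:R - v%:R * b'%:R :> rat by rewrite e' addrC addKr.
  by rewrite /frac natrM; field; rewrite bp b'p.
rewrite fmorph_div !rmorph_nat.
have Np : 0 < (satCard Q)%:R :> R by rewrite ltr0n.
have bbp : 0 < (b * b')%:R :> R by rewrite ltr0n muln_gt0 b0.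
rewrite ler_pdivrMr // mulrAC ler_pdivlMr // /t mulrA [RHS]ler_pdivrMr //.
by rewrite [lambda * _]mulrC.
Qed.

(** Determinant one means b' = -y modulo b, and b' < b leaves only b - y. If b' > b, the mirror
    congruence y' = b modulo b' forces y' >= b, so b + b' <= Q, against the size of b b'. *)
Lemma det1_gap_denominator b y v b' y' v' :
  sat_triple Q b y v -> sat_triple Q b' y' v' -> (v' * b = v * b' + 1)%N ->
  t <= (b * b')%:R -> b' = (b - y)%N.
Proof.
move=> /andP[tr bQ] /andP[tr' b'Q] e tb; have Qb := large_denominators tb.
have [c yv] := inverse_triple_dvd tr; have [c' yv'] := inverse_triple_dvd tr'.
have cop := inverse_triple_coprime tr; have cop' := inverse_triple_coprime tr'.
have /and3P[/andP[y0 yb] /andP[v0 vb] _] := tr.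
have /and3P[/andP[y'0 y'b] /andP[v'0 v'b] _] := tr'.
have [bb'|b'b|bb'] := ltngtP b b'.
- have [by'|y'b'] := leqP b y'.
    suff : (b + b' <= Q)%N by rewrite leqNgt Qb.
    by apply: leq_trans b'Q; rewrite addnC; apply: leq_trans (leq_addr v' _); rewrite leq_add2l.
  have : (b' %| (b - y') * v')%N.
    have -> : ((b - y') * v' = v * b' - c' * b')%N.
      by rewrite mulnBl yv' [(b * v')%N]mulnC e [(c' * _)%N]mulnC addnC subnDl.
    by rewrite -mulnBl dvdn_mull.
  rewrite Gauss_dvdl // => /dvdn_leq; rewrite subn_gt0 => /(_ y'b').
  by rewrite leqNgt (leq_ltn_trans (leq_subr _ _) bb').
- have : (b %| (b' + y) * v)%N.
    have -> : ((b' + y) * v = v' * b + c * b)%N.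
      by rewrite mulnDl yv e [(b' * v)%N]mulnC [(c * b)%N]mulnC addnA.
    by rewrite -mulnDl dvdn_mull.
  rewrite Gauss_dvdl // => /dvdnP[q qE].
  have q1 : q = 1%N.
    have q0 : (0 < q)%N.
      case: q qE => // /eqP; rewrite mul0n addn_eq0 => /andP[_ /eqP y00].
      by rewrite y00 in y0.
    have : (q * b < 2 * b)%N by rewrite -qE mul2n -addnn -addSn leq_add.
    by rewrite ltn_mul2r => /andP[_]; case: q q0 {qE} => [|[|]].
  by rewrite q1 mul1n in qE; rewrite -qE addnK.
subst b'.
have : (b %| 1)%N by rewrite -(dvdn_addr 1 (dvdn_mull v (dvdnn b))) -e dvdn_mull.
rewrite dvdn1 => /eqP b1; move: e vb v'b v0; rewrite b1 !muln1; clear; lia.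
Qed.

(** With y v = 1 + b c the neighbour is (v - c) / (b - y). An inverse of v - c modulo b - y is b,
    whose representative in [1, b - y] is at most y, so the trace bound is inherited. *)
Lemma next_triple b y v : sat_triple Q b y v -> t <= (b * (b - y))%:R ->
  exists y' v', sat_triple Q (b - y) y' v' /\ (v' * b = v * (b - y) + 1)%N.
Proof.
move=> /andP[tr bQ] tb; have [c yv] := inverse_triple_dvd tr.
have /and3P[/andP[y0 yb] /andP[v0 vb] _] := tr.
have t0 : 0 < t by rewrite divr_gt0 // ltr0n.
have : (0 < b * (b - y))%N by rewrite -(ltr_nat R) (lt_le_trans t0).
rewrite muln_gt0 => /andP[b0 b20].
set b2 := (b - y)%N in b20 *.
have bE : (b = b2 + y)%N by rewrite /b2 subnK.
have vltb : (v < b)%N.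
  rewrite ltn_neqAle vb andbT; apply/eqP => vE.
  have : (b %| 1)%N.
    by rewrite -(dvdn_addl 1 (dvdn_mulr c (dvdnn b))) -yv vE dvdn_mull.
  by rewrite dvdn1 => /eqP b1; move: bE y0 b20; rewrite b1; clear; lia.
have cv : (c < v)%N.
  by rewrite -(ltn_pmul2l b0) -add1n -yv leq_mul2r yb orbT.
have v'E : ((v - c) * b = v * b2 + 1)%N.
  rewrite mulnBl /b2 mulnBr [(v * y)%N]mulnC yv [(c * b)%N]mulnC.
  have : (1 + b * c <= v * b)%N by rewrite -yv mulnC leq_mul2l yb orbT.
  move: (v * b)%N (b * c)%N; clear=> *; lia.
exists ((b - 1) %% b2).+1, (v - c)%N; split=> //.
have y'y : ((b - 1) %% b2 < y)%N.
  have -> : (b - 1 = b2 + (y - 1))%N by rewrite {1}bE addnBA.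
  rewrite modnDl; apply: leq_ltn_trans (leq_mod _ _) _.
  by rewrite subn1 prednK.
apply/andP; split; last first.
  apply: leq_trans bQ; apply: leq_add (leq_subr _ _).
  by apply: leq_trans (leq_addr y b); rewrite {2}bE leq_add2l.
apply/and3P; split.
- by rewrite /= ltn_mod.
- rewrite subn_gt0 cv -(leq_pmul2r b0) v'E mulnC.
  apply: (@leq_trans (b2 * v + b2 * 1)); first by rewrite leq_add2l muln1.
  by rewrite -mulnDr addn1 leq_mul2l vltb orbT.
have -> : (((b - 1) %% b2).+1 * (v - c) = b * (v - c) %[mod b2])%N.
  have {2}-> : (b = (b - 1) %/ b2 * b2 + ((b - 1) %% b2).+1)%N.
    by rewrite addnS -divn_eq subn1 prednK.
  by rewrite mulnDl -mulnA [(b2 * _)%N]mulnC mulnA modnMDl.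
by rewrite mulnC v'E modnMDl.
Qed.

(** Each triple is sent to its fraction and the neighbour of determinant one; the first component
    alone is injective. Any fraction between the two has denominator at least b + b' > Q. *)
Lemma gap_count_le : (gap_count Q t <= #|` fset_set (smallGaps Q lambda)|%fset)%N.
Proof.
pose D b y v := (t <= (b * (b - y))%:R) && (b + y + v <= Q)%N.
rewrite /gap_count -(card_triples Q D) cardE.
set P := [pred T : triple_index Q | _].
pose next (T : triple_index Q) : rat * rat :=
  (triple_frac T, frac (T.1.1 - T.1.2) ((T.2 * (T.1.1 - T.1.2) + 1) %/ T.1.1)).
rewrite -(size_map next); apply: geq_card_fset_set_seq.
- exact: finite_smallGaps.
- rewrite map_inj_in_uniq ?enum_uniq // => T T'; rewrite !mem_enum => PT PT' [e _].
  exact: (@triple_frac_inj Q (fun T : triple_index Q => D T.1.1 T.1.2 T.2)).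
move=> g /mapP[[[b y] v]]; rewrite mem_enum => /andP[/= tr /andP[tb bQ]] -> {g}.
have st : sat_triple Q b y v by apply/andP.
have [y' [v' [st' e]]] := next_triple st tb.
have b0 : (0 < b)%N by have /and3P[/andP[y0 yb] _ _] := tr; apply: leq_trans yb.
have b'0 : (0 < b - y)%N.
  by have /andP[/and3P[/andP[y0 yb] _ _] _] := st'; apply: leq_trans yb.
rewrite /next /triple_frac /= -e mulnK //.
split; last by rewrite /= (small_frac b0 b'0 e) mul1r.
split => /=; [by apply/satFareyP; exists b, y, v|by apply/satFareyP; exists (b - y)%N, y', v'| |].
  by rewrite frac_lt // e addn1.
move=> x /satFareyP[c [z [w [/andP[tc cQ] ->]]]] [h1 h2].
have c0 : (0 < c)%N by have /and3P[/andP[z0 zc] _ _] := tc; apply: leq_trans zc.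
rewrite frac_lt // in h1; rewrite frac_lt // in h2.
have := between_denominator e h1 h2; apply/negP; rewrite -ltnNge.
apply: leq_ltn_trans (large_denominators tb).
by apply: leq_trans cQ; rewrite -addnA leq_addr.
Qed.

Lemma consecutive_unique (A : set rat) q r r' :
  consecutive A (q, r) -> consecutive A (q, r') -> r = r'.
Proof.
move=> [/= Aq Ar qr none] [/= _ Ar' qr' none'].
have [h|h|//] := ltgtP r r'.
  by case: (none' r Ar); split.
by case: (none r' Ar'); split.
Qed.

Lemma le_gap_count : (#|` fset_set (smallGaps Q lambda)|%fset <=
  gap_count Q t + \sum_(1 <= b < Q.+1 | (2 * t <= (b * Q)%:R)%R) b)%N.
Proof.
pose D b y v := ((t <= (b * (b - y))%:R) || (2 * t <= (b * Q)%:R)) && (b + y + v <= Q)%N.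
apply: (@leq_trans (\sum_(1 <= b < Q.+1) hyp b (D b))%N); last first.
  rewrite /gap_count [X in (_ <= _ + X)%N]big_mkcond -big_split /=.
  rewrite big_seq [leqRHS]big_seq; apply: leq_sum => b.
  rewrite mem_index_iota => /andP[b0 _]; case: ifP => h.
    by apply: leq_trans (leq_addl _ _); apply: leq_trans (hyp_le _ b0) (totient_le _).
  by rewrite addn0; apply: eq_leq; apply: hyp_ext => y v _ _ _; rewrite /D h orbF.
rewrite -(card_triples Q D) cardE.
set P := [pred T : triple_index Q | _].
(* [xget] picks the successor. Its default 0 occurs only at triples without one, which adds nothing
   wrong: the gaps need only be contained in the image. *)
pose next (T : triple_index Q) : rat * rat :=
  (triple_frac T, xget 0 [set q | consecutive (satFarey Q) (triple_frac T, q)]).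
rewrite -(size_map next); apply: leq_card_fset_set_seq; first exact: finite_smallGaps.
move=> [q r] [cons small].
have [/= Aq Ar qr none] := cons.
have [b [y [v [st qE]]]] := (satFareyP _ _).1 Aq.
have [b' [y' [v' [st' rE]]]] := (satFareyP _ _).1 Ar.
have [T [Tb Ty Tv]] := sat_tripleP st.
apply/mapP; exists T; last first.
  have TE : triple_frac T = q by rewrite /triple_frac Tb Tv.
  pose C := [set q | consecutive (satFarey Q) (triple_frac T, q)].
  have Cr : C r by rewrite /C /= TE.
  have Cx : C (xget 0 C) := xgetPex 0 (ex_intro _ r Cr).
  rewrite /next -/C; congr (_, _) => //; apply: (consecutive_unique cons).
  by rewrite -TE.
rewrite mem_enum inE /D Tb Ty Tv; have /andP[tr bQ] := st; rewrite tr bQ andbT /=.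
have b0 : (0 < b)%N by have /and3P[/andP[y0 yb] _ _] := tr; apply: leq_trans yb.
have /andP[tr' b'Q] := st'.
have b'0 : (0 < b')%N by have /and3P[/andP[y0 yb] _ _] := tr'; apply: leq_trans yb.
rewrite qE rE frac_lt // in qr.
pose d := (v' * b - v * b')%N.
have e : (v' * b = v * b' + d)%N by rewrite /d subnKC // ltnW.
have d0 : (0 < d)%N by rewrite subn_gt0.
move: small; rewrite /= qE rE (small_frac b0 b'0 e) => small.
have [d1|d2] := leqP d 1.
  have d1' : d = 1%N by apply/eqP; rewrite eqn_leq d1.
  rewrite d1' mul1r in small; rewrite d1' in e.
  by rewrite -(det1_gap_denominator st st' e small) small.
apply/orP; right; apply: (@le_trans _ _ (d%:R * t)).
  by rewrite ler_wpM2r ?ler_nat // divr_ge0 // ltW.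
apply: le_trans small _; rewrite ler_nat leq_mul2l; apply/orP; right.
by apply: leq_trans b'Q; rewrite -addnA leq_addr.
Qed.

End Gaps.

(** * Identification of the constants and the limit *)

Section Final.
Variable R : realType.
Notation Z := (zeta (2 : R)).

(** The b in the sum lie in [(1 - del) Q, Q]: at most del Q + 2 of them, each at most Q. *)
Lemma near_diagonal_sum (t del : R) (Q : nat) : 0 <= del <= 1 ->
  (1 - del) * Q%:R ^+ 2 <= 2 * t ->
  (\sum_(1 <= b < Q.+1 | (2 * t <= (b * Q)%:R)%R) b)%N%:R <= (del * Q%:R + 2) * Q%:R.
Proof.
move=> /andP[d0 d1] tQ; have [->|Q0] := posnP Q; first by rewrite big_geq // mulr0.
have Qp : 0 < Q%:R :> R by rewrite ltr0n.
have m0 : 0 <= (1 - del) * Q%:R by rewrite mulr_ge0 //; lra.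
set m := Num.Def.trunc ((1 - del) * Q%:R).
have /andP[m1 m2] := truncn_itv m0; rewrite -/m -natr1 in m2.
have le1 : (\sum_(1 <= b < Q.+1 | (2 * t <= (b * Q)%:R)%R) b <= (Q.+1 - m) * Q)%N.
  rewrite -sum_nat_const_nat.
  have mQ : (m <= Q.+1)%N.
    rewrite -(ler_nat R) -natr1; apply: le_trans m1 _.
    have : 0 <= del * Q%:R by rewrite mulr_ge0.
    lra.
  apply: (@leq_trans (\sum_(0 <= b < Q.+1 | (m <= b)%N) Q)%N); last first.
    by rewrite [leqRHS](@big_nat_widenl _ _ _ m 0).
  rewrite [leqRHS]big_mkcond [leqRHS]big_ltn // [leqLHS]big_mkcond.
  apply: leq_trans (leq_addl _ _).
  rewrite [leqLHS]big_seq [leqRHS]big_seq; apply: leq_sum => b.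
  rewrite mem_index_iota ltnS => /andP[b0 bQ]; case: ifP => // h.
  rewrite ifT // -(ler_nat R); apply: le_trans m1 _.
  rewrite -(ler_pM2r Qp) -mulrA -expr2; apply: le_trans tQ _.
  by rewrite -natrM.
apply: (@le_trans _ _ ((Q.+1 - m) * Q)%N%:R); first by rewrite ler_nat.
rewrite natrM ler_wpM2r //.
have mQ : (m <= Q.+1)%N.
  rewrite -(ler_nat R) -natr1; apply: le_trans m1 _.
  have : 0 <= del * Q%:R by rewrite mulr_ge0.
  lra.
rewrite natrB // -natr1; lra.
Qed.

Lemma Rintegral_FTC (f F : R -> R) (a b : R) : a < b ->
  (forall w, a <= w <= b -> derivable f w 1) ->
  (forall w, a <= w <= b -> is_derive w 1 F (f w)) ->
  \int[lebesgue_measure]_(w in `[a, b]) f w = F b - F a.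
Proof.
move=> ab df dF; rewrite /Rintegral (@continuous_FTC2 _ _ F) //.
- by apply: derivable_within_continuous => w; rewrite in_itv /=; apply: df.
- have cF w : a <= w <= b -> {for w, continuous F}.
    move=> wab; apply: differentiable_continuous; apply/derivable1_diffP.
    by have [] := dF w wab.
  split.
  + by move=> w; rewrite in_itv /= => /andP[aw wb]; have [] := dF w; rewrite ?ltW.
  + by apply: cvg_at_right_filter; apply: cF; rewrite lexx ltW.
  + by apply: cvg_at_left_filter; apply: cF; rewrite lexx ltW.
- move=> w; rewrite in_itv /= => /andP[aw wb]; rewrite derive1E.
  by have := dF w; rewrite !ltW // => /(_ isT) d; rewrite derive_val.
Qed.

Lemma gapA_gt0 : 0 < gapA R.
Proof.
rewrite /gapA divr_gt0 ?mulr_gt0 ?zeta2_gt0 //.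
by rewrite ln_gt0 // ltr_pdivlMr //; lra.
Qed.

(** With k = 1 / eta the integrands are 2 w times the two densities, which cancels the 2 in 1 / (2
    zeta(2)). Since eta > 1, both intervals of integration are nondegenerate. *)
Lemma C1_gap_const (eta : R) : 1 < eta <= 2 ->
  C1 eta = gap_const eta^-1 ((1 + Num.sqrt (1 + 8 * eta^-1)) / 4) / Z.
Proof.
move=> /andP[e1 e2]; have ep : 0 < eta by lra.
set k := eta^-1; have kp : 0 < k by rewrite invr_gt0.
have k1 : k < 1 by rewrite invf_lt1.
have k2 : 2^-1 <= k by rewrite lef_pV2 ?posrE.
have Zp := zeta2_gt0 R.
rewrite /C1 /w0 -/k.
set r := Num.sqrt (1 + 8 * k); set w := (1 + r) / 4.
have sE : 1 / Num.sqrt eta = Num.sqrt k by rewrite /k sqrtrV ?(ltW ep) // mul1r.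
rewrite sE; set s := Num.sqrt k.
have r2 : r ^+ 2 = 1 + 8 * k by rewrite sqr_sqrtr //; lra.
have s2 : s ^+ 2 = k by rewrite sqr_sqrtr //; lra.
have r0 : 0 <= r by apply: sqrtr_ge0.
have s0 : 0 <= s by apply: sqrtr_ge0.
have sp : 0 < s by rewrite sqrtr_gt0.
have s1 : s < 1 by nra.
have r3 : r < 3 by nra.
have wE : 2 * w ^+ 2 - w - k = 0 by rewrite /w; move: r2; lra.
have w1 : w < 1 by rewrite /w; lra.
have wp : 0 < w by rewrite /w; lra.
have sw : s < w by nra.
pose f1 (u : R) := (u - k * u^-1) * (2 - 3 * u + k * u^-1) * u^-1.
pose F1 (u : R) := 2 * antider1 k u.
have I1 : \int[lebesgue_measure]_(u in `[s, w]) f1 u = F1 w - F1 s.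
  apply: (Rintegral_FTC sw) => u /andP[su _]; have u0 : 0 < u by lra.
    by have di := is_derive_inv u0; apply: ex_derive.
  have d := is_derive_antider1 k u0.
  apply: is_derive_eq; rewrite -![_ *: _]/(_ * _) /f1.
  by field; rewrite lt0r_neq0.
have E1 : \int[lebesgue_measure]_(u in `[s, w])
    ((u - 1 / (eta * u)) * (2 - 3 * u + 1 / (eta * u)) / u) = F1 w - F1 s.
  by rewrite -I1; apply: eq_Rintegral => u _; rewrite div1r invfM.
pose f2 (u : R) := (1 - u) ^+ 2 / u.
pose F2 (u : R) := 2 * antider2 u.
have I2 : \int[lebesgue_measure]_(u in `[w, 1]) f2 u = F2 1 - F2 w.
  apply: (Rintegral_FTC w1) => u /andP[su _]; have u0 : 0 < u by lra.
    by have di := is_derive_inv u0; apply: ex_derive.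
  have d := is_derive_antider2 u0.
  apply: is_derive_eq; rewrite -![_ *: _]/(_ * _) /f2.
  by field; rewrite lt0r_neq0.
rewrite E1 I2 /F1 /F2 /gap_const -/s; field; rewrite lt0r_neq0 //.
Qed.

Lemma cvg_of_quadratic (f : nat -> nat) (l : R) :
  (forall e, 0 < e -> exists N, forall Q, (N <= Q)%N ->
     `|(f Q)%:R - l * Q%:R ^+ 2| <= e * Q%:R ^+ 2) ->
  (fun Q : nat => (f Q)%:R / Q%:R ^+ 2) @ \oo --> l.
Proof.
move=> fl; apply/cvgrPdist_le => e e0; have [N HN] := fl e e0.
exists N.+1 => // Q /= NQ.
have Qp : 0 < Q%:R ^+ 2 :> R by rewrite exprn_gt0 // ltr0n (leq_trans _ NQ).
rewrite distrC -(ler_pM2r Qp); apply: le_trans (HN Q (ltnW NQ)).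
rewrite -[X in _ * X](ger0_norm (ltW Qp)) -normrM mulrBl mulfVK ?lt0r_neq0 //.
Qed.

Lemma satCard_asymp (e : R) : 0 < e -> exists N, forall Q, (N <= Q)%N ->
  `|(satCard Q)%:R - gapA R * Q%:R ^+ 2| <= e * Q%:R ^+ 2.
Proof.
move=> /sat_count_asymp[N HN]; exists N => Q NQ.
by rewrite satCard_sat_count; apply: HN.
Qed.

Lemma smallGaps_asymp (lambda : R) : gapA R < lambda <= 2 * gapA R ->
  forall e, 0 < e -> exists N, forall Q, (N <= Q)%N ->
  `|(#|` fset_set (smallGaps Q lambda)|%fset)%:R - C1 (lambda / gapA R) * Q%:R ^+ 2|
    <= e * Q%:R ^+ 2.
Proof.
move=> /andP[l1 l2] e e0; have A0 := gapA_gt0.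
have l0 : 0 < lambda by apply: lt_trans l1.
pose k := gapA R / lambda.
have kE : (lambda / gapA R)^-1 = k by rewrite invf_div.
have kb : 2^-1 <= k < 1.
  by rewrite /k ler_pdivlMr // ltr_pdivrMr // mul1r l1 andbT; lra.
have [k2 k1] := andP kb.
have etab : 1 < lambda / gapA R <= 2.
  by rewrite ltr_pdivlMr // mul1r l1 ler_pdivrMr.
rewrite (C1_gap_const etab) kE.
set L := gap_const _ _ / _.
have e2 : 0 < e / 2 by rewrite divr_gt0.
have [N1 [del del0 HN1]] := gap_count_asymp kb e2.
(* d <= 1/8 gives t >= 3 Q^2 / 8, hence Q^2 < 4 t. d <= e / 8 controls the near-diagonal sum,
   applied with del = 2 d because lambda <= 2 A gives k >= 1/2. *)
pose d := Num.min del (Num.min (e / 8) (8^-1)).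
have d0 : 0 < d by rewrite !lt_min del0 divr_gt0 // invr_gt0 ltr0n.
have [dd1 [dd2 dd3]] : d <= del /\ d <= e / 8 /\ d <= 8^-1.
  by have := lexx d; rewrite {2}/d !le_min => /and3P[].
have [N2 HN2] := satCard_asymp (mulr_gt0 d0 l0).
pose N3 := (Num.bound (8 / e)).+1.
exists (maxn N1 (maxn N2 N3)) => Q; rewrite !geq_max => /and3P[Q1 Q2 Q3].
have Q0 : (0 < Q)%N by apply: leq_trans Q3.
have Qp : 0 < Q%:R :> R by rewrite ltr0n.
have Q2p : 0 < Q%:R ^+ 2 :> R by rewrite exprn_gt0.
have Qe : 8 <= e * Q%:R.
  have : 8 / e < Q%:R.
    apply: lt_le_trans (archi_boundP _) _; first by rewrite divr_ge0 // ltW.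
    by rewrite ler_nat ltnW.
  by rewrite ltr_pdivrMr // mulrC => /ltW.
pose t : R := (satCard Q)%:R / lambda.
have tk : `|t / Q%:R ^+ 2 - k| <= d.
  have := HN2 Q Q2.
  have -> : (satCard Q)%:R - gapA R * Q%:R ^+ 2 =
     (t / Q%:R ^+ 2 - k) * (lambda * Q%:R ^+ 2).
    by rewrite /t /k; field; rewrite !lt0r_neq0.
  rewrite normrM [X in _ * X]ger0_norm; last by rewrite mulr_ge0 // ltW.
  have -> : d * lambda * Q%:R ^+ 2 = d * (lambda * Q%:R ^+ 2) by ring.
  by rewrite ler_pM2r // mulr_gt0.
have tlow : (k - d) * Q%:R ^+ 2 <= t.
  by rewrite -ler_pdivlMr //; move: tk; rewrite ler_norml; lra.
have tl1 : (2^-1 - d) * Q%:R ^+ 2 <= t.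
  by apply: le_trans tlow; rewrite ler_wpM2r ?(ltW Q2p) //; lra.
have tlarge : Q%:R ^+ 2 < 4 * t.
  have : (3 / 8) * Q%:R ^+ 2 <= (2^-1 - d) * Q%:R ^+ 2.
    by rewrite ler_wpM2r ?(ltW Q2p) //; move: dd3; clear; lra.
  by move: Q2p tl1; move: (Q%:R ^+ 2) => q; clear; lra.
have N0 : (0 < satCard Q)%N.
  rewrite -(ltr_nat R).
  have : 0 < t by move: Q2p tlarge; clear; lra.
  by rewrite /t pmulr_lgt0 // invr_gt0.
have lo := gap_count_le l0 N0 tlarge.
have up := le_gap_count l0 N0 tlarge.
have main := HN1 Q Q1 t (le_trans tk dd1).
have diag : (\sum_(1 <= b < Q.+1 | (2 * t <= (b * Q)%:R)%R) b)%N%:R <= e / 2 * Q%:R ^+ 2.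
  apply: le_trans (near_diagonal_sum (del := 2 * d) _ _) _.
  - by move: d0 dd3; clear=> ? ?; apply/andP; split; lra.
  - by move: tl1; rewrite !mulrBl; clear; lra.
  rewrite expr2 mulrA ler_wpM2r //.
  have : 2 * d * Q%:R <= e / 4 * Q%:R by rewrite ler_wpM2r //; move: dd2; clear; lra.
  by move: Qe; clear; lra.
rewrite -/t in lo up.
have lo' : (gap_count Q t)%:R <= (#|` fset_set (smallGaps Q lambda)|%fset)%:R :> R.
  by rewrite ler_nat.
have up' : (#|` fset_set (smallGaps Q lambda)|%fset)%:R <=
    (gap_count Q t)%:R + e / 2 * Q%:R ^+ 2 :> R.
  apply: le_trans (lerD (lexx _) diag); rewrite -natrD ler_nat; exact: up.
move: main lo' up'; rewrite -/L.
move: (gap_count Q t)%:R (#|` _|%fset)%:R (L * Q%:R ^+ 2) (Q%:R ^+ 2) => a b c q.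
by rewrite !ler_norml; clear; lra.
Qed.

End Final.

Theorem mainTheorem7 (R : realType) (lambda : R)
    (hlambda : gapA R < lambda <= 2 * gapA R) :
  (fun Q : nat => gapDistr Q lambda) @ \oo --> C1 (lambda / gapA R) / gapA R.
Proof.
have A0 := gapA_gt0 R.
have cN := cvg_of_quadratic (@satCard_asymp R).
have cG := cvg_of_quadratic (smallGaps_asymp hlambda).
apply: (cvg_trans _ (cvgM cG (cvgV (lt0r_neq0 A0) cN))); apply: near_eq_cvg.
exists 1%N => // Q /= Q0.
have Qp : Q%:R ^+ 2 != 0 :> R by rewrite expf_neq0 // pnatr_eq0 -lt0n.
by rewrite /gapDistr /= invf_div mulrA mulfVK.
Qed.
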